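(* (The extension of Pimsner and Voiculescu.) Let $(A,\mathbb{N},\alpha)$ be a system in which $\alpha\in\operatorname{Aut}(A)$. Then there is an exact sequence $$0\longrightarrow A\otimes\mathcal{K}(\ell^{2}(\mathbb{N}))\longrightarrow\mathcal{T}_{PV}\longrightarrow A\times_{\alpha}\mathbb{Z}\longrightarrow 0.$$
   Context: $A$ is a (not necessarily unital) $C^*$-algebra, and $\mathbb{N}=\{0,1,2,\dots\}$ acts by the powers $\alpha_n=\alpha^n$ of the automorphism $\alpha$. $(A\times_\alpha\mathbb{Z},j_A,j_{\mathbb{Z}})$ is the group crossed product, with canonical homomorphism $j_A:A\to A\times_\alpha\mathbb{Z}$ and canonical unitary representation $j_{\mathbb{Z}}:\mathbb{Z}\to M(A\times_\alpha\mathbb{Z})$. $\mathcal{T}(\mathbb{Z})$ is the Toeplitz algebra, generated by the non-unitary isometries $T_n=T_1^n$ ($n\in\mathbb{N}$), where $T_1$ is the unilateral shift on $\ell^2(\mathbb{N})$. $\mathcal{T}_{PV}=\mathcal{T}_{PV}(\mathbb{Z})$ is the $C^*$-subalgebra of $M((A\times_\alpha\mathbb{Z})\otimes\mathcal{T}(\mathbb{Z}))$ generated by $\{j_A(a)\otimes I:a\in A\}$ and $\{j_{\mathbb{Z}}(n)\otimes T_n:n\in\mathbb{N}\}$ in the sense that $$\mathcal{T}_{PV}=\overline{\operatorname{span}}\{(j_{\mathbb{Z}}(m)\otimes T_m)(j_A(a)\otimes I)(j_{\mathbb{Z}}(n)\otimes T_n)^*:a\in A,\ m,n\in\mathbb{N}\}.$$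 *)

(* Defs.v *)
(* The scalars are R[i] for R : realType, so norms take their values in the   *)
(* real elements of R[i]. In ring_scope, z^* is the complex conjugate         *)
(* Num.conj z.                                                                *)
From HB Require Import structures.
From mathcomp Require Import all_boot all_order all_algebra.
From mathcomp Require Import complex.
From mathcomp Require Import all_classical all_reals topology normedtype sequences.
From mathcomp Require Import ring lra.
Set Implicit Arguments. Unset Strict Implicit. Unset Printing Implicit Defensive.
Import Order.TTheory GRing.Theory Num.Theory.
Import numFieldNormedType.Exports.
Local Open Scope classical_set_scope.
Local Open Scope complex_scope.
Local Open Scope ring_scope.

(* A C*-algebra is not required to be unital, hence is not a MathComp ring. *)
HB.mixin Record isCStar (R : realType) A of CompleteNormedModule R[i] A := {
  cmul : A -> A -> A;
  star : A -> A;
  cmulA : associative cmul;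
  cmulDl : left_distributive cmul +%R;
  cmulDr : right_distributive cmul +%R;
  cmulZl : forall (k : R[i]) x y, cmul (k *: x) y = k *: cmul x y;
  cmulZr : forall (k : R[i]) x y, cmul x (k *: y) = k *: cmul x y;
  starK : involutive star;
  starD : {morph star : x y / x + y};
  starZ : forall (k : R[i]) x, star (k *: x) = k^* *: star x;
  starM : forall x y, star (cmul x y) = cmul (star y) (star x);
  cnormM : forall x y, `|cmul x y| <= `|x| * `|y|;
  cstarE : forall x, `|cmul (star x) x| = `|x| ^+ 2;
}.
#[short(type="cstarAlgType")]
HB.structure Definition CStarAlg (R : realType) :=
  {A of CompleteNormedModule R[i] A & isCStar R A}.

Notation "x ** y" := (cmul x y) (at level 40, left associativity) : ring_scope.

Section ell2.
Variable R : realType.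
Implicit Types (z w : R[i]) (f g : nat -> R[i]).

Definition sqmod z : R := complex.Re z ^+ 2 + complex.Im z ^+ 2.

Lemma sqmod_ge0 z : 0 <= sqmod z.
Proof. by rewrite addr_ge0 ?sqr_ge0. Qed.

Lemma normr_sqmod z : `|z| = (Num.sqrt (sqmod z))%:C.
Proof. by case: z. Qed.

Definition square_summable f := cvgn (series (sqmod \o f)).

Lemma dominated_summable (u v : nat -> R) : (forall k, 0 <= u k <= v k) ->
  cvgn (series v) -> cvgn (series u).
Proof.
move=> uv; apply: series_le_cvg => k; have /andP[u0 uvk] := uv k => //.
exact: le_trans uvk.
Qed.

Lemma square_summableD f g : square_summable f -> square_summable g ->
  square_summable (fun k => f k + g k).
Proof.
move=> sf sg; apply: (@dominated_summable _ (2 *: ((sqmod \o f) + (sqmod \o g)))).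
  move=> k; rewrite sqmod_ge0/= /sqmod/= !fctE/=.
  case: (f k) => a b; case: (g k) => c d; rewrite /GRing.scale/=.
  have := sqr_ge0 (a - c); have := sqr_ge0 (b - d); nra.
by apply: is_cvg_seriesZ; exact: is_cvg_seriesD.
Qed.

Lemma square_summableZ (c : R[i]) f :
  square_summable f -> square_summable (fun k => c * f k).
Proof.
move=> sf; rewrite /square_summable.
have -> : sqmod \o (fun k => c * f k) = sqmod c *: (sqmod \o f).
  apply/funext => k; rewrite /= /sqmod !fctE/=.
  by case: c => a b; case: (f k) => x y /=; rewrite /GRing.scale/=; ring.
exact: is_cvg_seriesZ.
Qed.

Lemma square_summable0 : square_summable (fun=> 0).
Proof.
rewrite /square_summable (_ : series _ = (fun=> 0)); first exact: is_cvg_cst.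
apply/funext => n; rewrite /series/= big1// => k _.
by rewrite /sqmod/= expr0n/= addr0.
Qed.

Record ell2 := Ell2 { ell2_fun :> nat -> R[i]; ell2P : square_summable ell2_fun }.
Arguments ell2P _ : clear implicits.

Lemma ell2_eqP (x y : ell2) : (forall k, x k = y k) -> x = y.
Proof.
case: x y => [f fP] [g gP]/= fg; have {}fg : f = g by apply/funext.
by subst g; congr Ell2; exact: Prop_irrelevance.
Qed.

HB.instance Definition _ := gen_eqMixin ell2.
HB.instance Definition _ := gen_choiceMixin ell2.

Definition ell2_zero := Ell2 square_summable0.
Definition ell2_add (x y : ell2) := Ell2 (@square_summableD _ _ (ell2P x) (ell2P y)).
Definition ell2_scale c (x : ell2) := Ell2 (@square_summableZ c _ (ell2P x)).
Definition ell2_opp := ell2_scale (-1).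

Fact ell2_addA : associative ell2_add.
Proof. by move=> x y z; apply: ell2_eqP => k /=; rewrite addrA. Qed.
Fact ell2_addC : commutative ell2_add.
Proof. by move=> x y; apply: ell2_eqP => k /=; rewrite addrC. Qed.
Fact ell2_add0 : left_id ell2_zero ell2_add.
Proof. by move=> x; apply: ell2_eqP => k /=; rewrite add0r. Qed.
Fact ell2_addN : left_inverse ell2_zero ell2_opp ell2_add.
Proof. by move=> x; apply: ell2_eqP => k /=; rewrite mulN1r addNr. Qed.

HB.instance Definition _ :=
  GRing.isZmodule.Build ell2 ell2_addA ell2_addC ell2_add0 ell2_addN.

Fact ell2_scaleA a b (x : ell2) :
  ell2_scale a (ell2_scale b x) = ell2_scale (a * b) x.
Proof. by apply: ell2_eqP => k /=; rewrite mulrA. Qed.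
Fact ell2_scale1 : left_id 1 ell2_scale.
Proof. by move=> x; apply: ell2_eqP => k /=; rewrite mul1r. Qed.
Fact ell2_scaleDr : right_distributive ell2_scale +%R.
Proof. by move=> a x y; apply: ell2_eqP => k /=; rewrite mulrDr. Qed.
Fact ell2_scaleDl (x : ell2) : {morph ell2_scale^~ x : a b / a + b}.
Proof. by move=> a b; apply: ell2_eqP => k /=; rewrite mulrDl. Qed.

HB.instance Definition _ := GRing.Zmodule_isLmodule.Build R[i] ell2
  ell2_scaleA ell2_scale1 ell2_scaleDr ell2_scaleDl.

Lemma ell2DE (x y : ell2) k : (x + y) k = x k + y k. Proof. by []. Qed.
Lemma ell2ZE c (x : ell2) k : (c *: x) k = c * x k. Proof. by []. Qed.
Lemma ell2BE (x y : ell2) k : (x - y) k = x k - y k.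
Proof. by rewrite ell2DE -scaleN1r ell2ZE mulN1r. Qed.

Definition ell2_sq (x : ell2) : R := limn (series (sqmod \o x)).
Definition ell2_norm (x : ell2) : R := Num.sqrt (ell2_sq x).

Lemma lim_series_ge0 (u : nat -> R) : (forall k, 0 <= u k) ->
  cvgn (series u) -> 0 <= limn (series u).
Proof.
by move=> u0 cu; apply: limr_ge => //; apply: nearW => n; exact: sumr_ge0.
Qed.

Lemma partial_le_lim (u : nat -> R) n : (forall k, 0 <= u k) ->
  cvgn (series u) -> \sum_(0 <= k < n) u k <= limn (series u).
Proof.
move=> u0 cu; apply: (nondecreasing_cvgn_le _ cu).
exact: nondecreasing_series.
Qed.

Lemma lim_series_le_bound (u : nat -> R) M : (forall k, 0 <= u k) ->
  (forall n, \sum_(0 <= k < n) u k <= M) ->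
  cvgn (series u) /\ limn (series u) <= M.
Proof.
move=> u0 uM; have cu : cvgn (series u).
  apply: nondecreasing_is_cvgn; first exact: nondecreasing_series.
  by exists M => _ [n _ <-]; exact: uM.
by split=> //; apply: limr_le => //; apply: nearW => n; exact: uM.
Qed.

Lemma ell2_sq_ge0 x : 0 <= ell2_sq x.
Proof. by apply: lim_series_ge0; [move=> k; exact: sqmod_ge0|exact: ell2P]. Qed.

Lemma ell2_norm_ge0 x : 0 <= ell2_norm x. Proof. exact: sqrtr_ge0. Qed.

Lemma ell2_norm_sq x : ell2_norm x ^+ 2 = ell2_sq x.
Proof. by rewrite sqr_sqrtr// ell2_sq_ge0. Qed.

Lemma sqmod_le_ell2 (x : ell2) k : sqmod (x k) <= ell2_sq x.
Proof.
apply: le_trans (partial_le_lim k.+1 _ (ell2P x)) => [|j]; last exact: sqmod_ge0.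
by rewrite big_nat_recr//= lerDr; apply: sumr_ge0 => j _; exact: sqmod_ge0.
Qed.

Fact ell2_norm_eq0 x : ell2_norm x = 0 -> x = 0.
Proof.
move=> /eqP; rewrite -sqrf_eq0 ell2_norm_sq => /eqP x0.
apply: ell2_eqP => k; have := sqmod_le_ell2 x k; rewrite x0 /sqmod /=.
case: (x k) => a b /= ab.
have : a ^+ 2 + b ^+ 2 == 0 by rewrite eq_le ab addr_ge0 ?sqr_ge0.
by rewrite paddr_eq0 ?sqr_ge0// !sqrf_eq0 => /andP[/eqP-> /eqP->].
Qed.

Definition csummable (u : nat -> R[i]) :=
  cvgn (series (@complex.Re R \o u)) /\ cvgn (series (@complex.Im R \o u)).

Definition csum (u : nat -> R[i]) : R[i] :=
  limn (series (@complex.Re R \o u)) +i* limn (series (@complex.Im R \o u)).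

Lemma csumD u v : csummable u -> csummable v ->
  csum (fun k => u k + v k) = csum u + csum v.
Proof.
move=> [ru iu] [rv iv]; rewrite /csum.
have -> : @complex.Re R \o (fun k => u k + v k)
        = (@complex.Re R \o u) + (@complex.Re R \o v).
  by apply/funext => k; rewrite !fctE/=; case: (u k) (v k) => a b [].
have -> : @complex.Im R \o (fun k => u k + v k)
        = (@complex.Im R \o u) + (@complex.Im R \o v).
  by apply/funext => k; rewrite !fctE/=; case: (u k) (v k) => a b [].
by rewrite !lim_seriesD.
Qed.

Lemma csumZ c u : csummable u -> csum (fun k => c * u k) = c * csum u.
Proof.
case: c => a b [ru iu]; rewrite /csum.
have -> : @complex.Re R \o (fun k => (a +i* b) * u k)
        = a *: (@complex.Re R \o u) - b *: (@complex.Im R \o u).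
  by apply/funext => k; rewrite !fctE/=; case: (u k).
have -> : @complex.Im R \o (fun k => (a +i* b) * u k)
        = a *: (@complex.Im R \o u) + b *: (@complex.Re R \o u).
  by apply/funext => k; rewrite !fctE/=; case: (u k).
have cZ (t : R) (s : nat -> R) : cvgn (series s) -> cvgn (series (t *: s)).
  by move=> cs; exact: is_cvg_seriesZ.
have lZ (t : R) (s : nat -> R) : cvgn (series s) ->
    limn (series (t *: s)) = t * limn (series s).
  by move=> cs; rewrite lim_seriesZ.
by rewrite (lim_seriesB (cZ _ _ ru) (cZ _ _ iu)) (lim_seriesD (cZ _ _ iu) (cZ _ _ ru)) !lZ.
Qed.

Lemma csum_conj u : csummable u -> csum (fun k => (u k)^*) = (csum u)^*.
Proof.
move=> [ru iu]; have -> : (csum u)^* = limn (series (@complex.Re R \o u))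
                  +i* limn (series (- (@complex.Im R \o u))).
  by rewrite lim_seriesN.
congr (limn (series _) +i* limn (series _)); apply/funext => k;
  by rewrite ?fctE/=; case: (u k).
Qed.

Implicit Types x y : ell2.

Definition ell2_dot (x y : ell2) : R[i] := csum (fun k => (x k)^* * y k).

Lemma ell2_dot_csummable (x y : ell2) : csummable (fun k => (x k)^* * y k).
Proof.
have sxy : cvgn (series ((sqmod \o x) + (sqmod \o y))).
  by apply: is_cvg_seriesD; exact: ell2P.
split; apply: normed_cvg; apply: dominated_summable sxy => k;
  rewrite normr_ge0 !fctE/= /sqmod; case: (x k) (y k) => a b [c d]/=;
  have := (sqr_ge0 (a - c), sqr_ge0 (b - d), sqr_ge0 (a + c), sqr_ge0 (b + d),
           sqr_ge0 (a - d), sqr_ge0 (b - c), sqr_ge0 (a + d), sqr_ge0 (b + c));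
  move=> [[[[[[[h1 h2] h3] h4] h5] h6] h7] h8]; rewrite ler_norml; apply/andP;
  split; nra.
Qed.

Lemma ell2_dotDr x y (z : ell2) : ell2_dot x (y + z) = ell2_dot x y + ell2_dot x z.
Proof.
rewrite /ell2_dot -csumD; try exact: ell2_dot_csummable.
by congr csum; apply/funext => k; rewrite ell2DE mulrDr.
Qed.

Lemma ell2_dotZr c x y : ell2_dot x (c *: y) = c * ell2_dot x y.
Proof.
rewrite /ell2_dot -csumZ; last exact: ell2_dot_csummable.
by congr csum; apply/funext => k; rewrite ell2ZE mulrCA.
Qed.

Lemma ell2_dotC x y : (ell2_dot x y)^* = ell2_dot y x.
Proof.
rewrite /ell2_dot -csum_conj; last exact: ell2_dot_csummable.
congr csum; apply/funext => k; rewrite mulrC.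
by case: (x k) (y k) => a b [c d]/=; simpc.
Qed.

Lemma ell2_dotDl x y (z : ell2) : ell2_dot (x + y) z = ell2_dot x z + ell2_dot y z.
Proof. by rewrite -ell2_dotC ell2_dotDr raddfD/= !ell2_dotC. Qed.

Lemma ell2_dotZl c x y : ell2_dot (c *: x) y = c^* * ell2_dot x y.
Proof. by rewrite -ell2_dotC ell2_dotZr rmorphM/= ell2_dotC. Qed.

Lemma ell2_dotxx x : ell2_dot x x = (ell2_sq x)%:C.
Proof.
rewrite /ell2_dot /csum /ell2_sq; congr (_ +i* _).
  congr (limn (series _)); apply/funext => k /=; rewrite /sqmod.
  by case: (x k) => a b /=; ring.
rewrite (_ : series _ = (fun=> 0)) ?lim_cst//; apply/funext => n.
rewrite /series/= big1// => k _ /=; case: (x k) => a b /=; ring.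
Qed.

Lemma ell2_sqDZ (x y : ell2) c : ell2_sq (x + c *: y) =
  ell2_sq x + 2 * complex.Re (c * ell2_dot x y) + sqmod c * ell2_sq y.
Proof.
have := ell2_dotxx (x + c *: y).
rewrite !(ell2_dotDl, ell2_dotDr) !(ell2_dotZl, ell2_dotZr) !ell2_dotxx.
rewrite -(ell2_dotC x y) => /(congr1 (@complex.Re R))/= <-.
case: (ell2_dot x y) c => [a b] [u v]; rewrite /sqmod/=; ring.
Qed.

Lemma ell2_cauchy_schwarz x y : sqmod (ell2_dot x y) <= ell2_sq x * ell2_sq y.
Proof.
have [y0|y0] := eqVneq (ell2_sq y) 0.
  have -> : y = 0 by apply: ell2_norm_eq0; rewrite /ell2_norm y0 sqrtr0.
  have -> : ell2_dot x 0 = 0 by rewrite -(scale0r 0) ell2_dotZr mul0r.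
  by rewrite /sqmod/= expr0n/= addr0 mulr_ge0 ?ell2_sq_ge0.
have {}y0 : 0 < ell2_sq y by rewrite lt_def y0 ell2_sq_ge0.
pose c := - ((ell2_sq y)^-1%:C * (ell2_dot x y)^*).
have := ell2_sq_ge0 (x + c *: y); rewrite ell2_sqDZ {}/c.
case: (ell2_dot x y) => a b; rewrite /sqmod/=.
set Y := ell2_sq y; rewrite [X in 0 <= X -> _](_ : _ = ell2_sq x - (a ^+ 2 + b ^+ 2) / Y).
  by rewrite subr_ge0 ler_pdivrMr.
by field; rewrite gt_eqF.
Qed.

Lemma ell2_dot_le x y : `|ell2_dot x y| <= (ell2_norm x * ell2_norm y)%:C.
Proof.
rewrite normr_sqmod lecR /ell2_norm -sqrtrM ?ell2_sq_ge0//.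
by rewrite ler_wsqrtr// ell2_cauchy_schwarz.
Qed.

Lemma Re_le_sqmod z : complex.Re z <= Num.sqrt (sqmod z).
Proof.
case: z => a b; apply: le_trans (ler_norm a) _.
by rewrite -sqrtr_sqr ler_wsqrtr// lerDl sqr_ge0.
Qed.

Fact ell2_normD x y :
  (ell2_norm (x + y))%:C <= (ell2_norm x)%:C + (ell2_norm y)%:C.
Proof.
rewrite -rmorphD lecR -(@ler_pXn2r _ 2) ?nnegrE ?addr_ge0 ?ell2_norm_ge0//.
rewrite sqrrD !ell2_norm_sq -[y in x + y]scale1r ell2_sqDZ mul1r.
have := ell2_cauchy_schwarz x y; move: (ell2_dot x y) => d dxy.
rewrite [sqmod 1]/sqmod/= expr1n expr0n/= addr0 mul1r lerD2r lerD2l.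
rewrite mulr_natl ler_pMn2r//; apply: le_trans (Re_le_sqmod d) _.
by rewrite /ell2_norm -sqrtrM ?ell2_sq_ge0// ler_wsqrtr.
Qed.

Fact ell2_normZ c x : (ell2_norm (c *: x))%:C = `|c| * (ell2_norm x)%:C.
Proof.
rewrite normr_sqmod -rmorphM/= /ell2_norm -sqrtrM ?sqmod_ge0//.
congr (Num.sqrt _)%:C; have := ell2_dotxx (c *: x).
rewrite ell2_dotZl ell2_dotZr ell2_dotxx => /(congr1 (@complex.Re R))/= <-.
by case: c => a b; rewrite /sqmod/=; ring.
Qed.

Fact ell2_norm0_eq0 x : (ell2_norm x)%:C = 0 :> R[i] -> x = 0.
Proof. by move=> [] /ell2_norm_eq0. Qed.

HB.instance Definition _ := Lmodule_isNormed.Build R[i] ell2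
  ell2_normD ell2_normZ ell2_norm0_eq0.

Lemma ell2_normE x : `|x| = (ell2_norm x)%:C :> R[i]. Proof. by []. Qed.

Lemma sqmod_le_norm x k : Num.sqrt (sqmod (x k)) <= ell2_norm x.
Proof. by rewrite /ell2_norm ler_wsqrtr// sqmod_le_ell2. Qed.

Lemma Im_le_sqmod z : complex.Im z <= Num.sqrt (sqmod z).
Proof.
case: z => a b; apply: le_trans (ler_norm b) _.
by rewrite -sqrtr_sqr ler_wsqrtr// lerDr sqr_ge0.
Qed.

Lemma sqmodN z : sqmod (- z) = sqmod z.
Proof. by case: z => a b; rewrite /sqmod/= !sqrrN. Qed.

Lemma ell2_dist_coord x y k :
  `|complex.Re (x k) - complex.Re (y k)| <= ell2_norm (x - y) /\
  `|complex.Im (x k) - complex.Im (y k)| <= ell2_norm (x - y).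
Proof.
have := sqmod_le_norm (x - y) k; rewrite ell2BE.
move: (ell2_norm _) => M.
have := (Re_le_sqmod (x k - y k), Im_le_sqmod (x k - y k)).
have := (Re_le_sqmod (- (x k - y k)), Im_le_sqmod (- (x k - y k))).
rewrite sqmodN; move: (Num.sqrt _) => s; case: (x k) (y k) => a b [c d]/=.
by move=> [? ?] [? ?] ?; rewrite !ler_norml; split; lra.
Qed.

Lemma ell2_complete (F : set_system ell2) :
  ProperFilter F -> cauchy F -> cvg F.
Proof.
move=> FF /cauchyP cF.
have cex (e : R) : 0 < e -> exists x, F [set y | ell2_norm (x - y) < e].
  move=> e0; have [|x Fx] := cF e%:C; first by rewrite ltcR.
  exists x; apply: filterS Fx => y; rewrite -ball_normE/=.
  by rewrite ell2_normE ltcR.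
have /choice[g gP] : forall k, exists z : R[i],
    ((fun x : ell2 => complex.Re (x k)) @ F --> complex.Re z) /\
    ((fun x : ell2 => complex.Im (x k)) @ F --> complex.Im z).
  move=> k.
  have /R_complete/cvg_ex[a aP] : cauchy ((fun x : ell2 => complex.Re (x k)) @ F).
    apply/cauchyP => e e0; have [x Fx] := cex _ e0.
    exists (complex.Re (x k)).
    suff: F [set y | ball (complex.Re (x k)) e (complex.Re (y k))] by [].
    apply: filterS Fx => y/= xy.
    rewrite -ball_normE/=; apply: le_lt_trans xy.
    by have [] := ell2_dist_coord x y k.
  have /R_complete/cvg_ex[b bP] : cauchy ((fun x : ell2 => complex.Im (x k)) @ F).
    apply/cauchyP => e e0; have [x Fx] := cex _ e0.
    exists (complex.Im (x k)).
    suff: F [set y | ball (complex.Im (x k)) e (complex.Im (y k))] by [].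
    apply: filterS Fx => y/= xy.
    rewrite -ball_normE/=; apply: le_lt_trans xy.
    by have [] := ell2_dist_coord x y k.
  by exists (a +i* b).
have key (e : R) x : F [set y | ell2_norm (x - y) < e] ->
    forall n, \sum_(0 <= k < n) sqmod (x k - g k) <= e ^+ 2.
  move=> Fx n.
  have cv : (fun y : ell2 => \sum_(0 <= k < n) sqmod (x k - y k)) @ F -->
            \sum_(0 <= k < n) sqmod (x k - g k).
    elim: n => [|k ih].
      by under eq_fun do rewrite big_nil; rewrite big_nil; exact: cvg_cst.
    under eq_fun do rewrite big_nat_recr//=.
    rewrite big_nat_recr//=; apply: cvgD => //; have [re im] := gP k.
    have sqE z : sqmod (x k - z) =
        (complex.Re (x k) - complex.Re z) * (complex.Re (x k) - complex.Re z) +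
        (complex.Im (x k) - complex.Im z) * (complex.Im (x k) - complex.Im z).
      by case: (x k) z => a b [c d]; rewrite /sqmod/=; ring.
    rewrite sqE; under eq_fun do rewrite sqE.
    by apply: cvgD; apply: cvgM; apply: cvgB => //; exact: cvg_cst.
  apply: (cvgr_to_le cv).
  apply: filterS Fx => y/= xy.
  apply: (@le_trans _ _ (ell2_sq (x - y))).
    under eq_bigr do rewrite -ell2BE.
    exact: (partial_le_lim n (fun k => sqmod_ge0 ((x - y) k)) (ell2P (x - y))).
  rewrite -ell2_norm_sq ler_sqr ?nnegrE ?ell2_norm_ge0 ?ltW//.
  exact: le_lt_trans (ell2_norm_ge0 _) xy.
have sg : square_summable g.
  have [x Fx] := cex 1 ltr01.
  have [sxg _] := lim_series_le_bound (fun k => sqmod_ge0 (x k - g k)) (key _ _ Fx).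
  have -> : g = (fun k => x k + -1 * (x k - g k)).
    by apply/funext => k; rewrite mulN1r opprB addrC subrK.
  by apply: square_summableD; [exact: ell2P|exact: square_summableZ].
apply/cvg_ex; exists (Ell2 sg); apply/cvgrPdist_le => /= e e0.
have [r r0 er] : exists2 r : R, 0 < r & e = r%:C.
  case: e e0 => a b; rewrite ltcE/= => /andP[/eqP b0 a0].
  by exists a => //; rewrite b0.
have r20 : 0 < r / 2 by rewrite divr_gt0.
have [x Fx] := cex _ r20.
apply: filterS (Fx) => y/= xy.
rewrite er ell2_normE lecR.
have xg : ell2_norm (x - Ell2 sg) <= r / 2.
  rewrite -(@ler_pXn2r _ 2) ?nnegrE ?ell2_norm_ge0 ?(ltW r20)// ell2_norm_sq.
  have -> : ell2_sq (x - Ell2 sg) = limn (series (fun k => sqmod (x k - g k))).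
    by congr (limn (series _)); apply/funext => k; rewrite /comp ell2BE.
  by have [] := lim_series_le_bound (fun k => sqmod_ge0 (x k - g k)) (key _ _ Fx).
have -> : Ell2 sg - y = (x - y) - (x - Ell2 sg).
  by rewrite opprB [RHS]addrC -addrA addKr.
rewrite -lecR -ell2_normE (le_trans (ler_normB _ _))// !ell2_normE -rmorphD lecR.
by rewrite [r]splitr; lra.
Qed.

HB.instance Definition _ := Uniform_isComplete.Build ell2 ell2_complete.

End ell2.

Arguments ell2P {R} _.

Section real_norm.
Variable R : realType.

Definition rnorm (V : normedZmodType R[i]) (x : V) : R := complex.Re `|x|.

Lemma normr_rnorm (V : normedZmodType R[i]) (x : V) : `|x| = (rnorm x)%:C.
Proof.
have := normr_ge0 x; rewrite /rnorm; case: (`|x|) => a b.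
by rewrite lecE/= => /andP[/eqP -> _].
Qed.

Lemma rnorm_ge0 (V : normedZmodType R[i]) (x : V) : 0 <= rnorm x.
Proof. by rewrite -lecR -normr_rnorm normr_ge0. Qed.

Lemma rnormD (V : normedZmodType R[i]) (x y : V) :
  rnorm (x + y) <= rnorm x + rnorm y.
Proof. by rewrite -lecR rmorphD/= -!normr_rnorm ler_normD. Qed.

Lemma rnormN (V : normedZmodType R[i]) (x : V) : rnorm (- x) = rnorm x.
Proof. by rewrite /rnorm normrN. Qed.

Lemma rnorm0 (V : normedZmodType R[i]) : rnorm (0 : V) = 0.
Proof. by rewrite /rnorm normr0. Qed.

Lemma rnorm_eq0 (V : normedZmodType R[i]) (x : V) : rnorm x = 0 -> x = 0.
Proof. by move=> x0; apply: normr0_eq0; rewrite normr_rnorm x0. Qed.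

Lemma rnormZ (V : normedModType R[i]) (c : R[i]) (x : V) :
  rnorm (c *: x) = rnorm c * rnorm x.
Proof. by apply: complexI; rewrite rmorphM/= -!normr_rnorm normrZ. Qed.

Lemma rnorm_le0 (V : normedZmodType R[i]) (x : V) :
  (forall e, 0 < e -> rnorm x <= e) -> x = 0.
Proof.
move=> xe; apply: rnorm_eq0; apply/eqP; rewrite eq_le rnorm_ge0 andbT.
by apply/ler_addgt0Pl => e e0; rewrite addr0; exact: xe.
Qed.

Lemma posC_real (e : R[i]) : 0 < e -> exists2 r : R, 0 < r & e = r%:C.
Proof.
case: e => a b; rewrite ltcE/= => /andP[/eqP b0 a0].
by exists a => //; rewrite b0.
Qed.

Lemma rnorm_complete (V : normedModType R[i]) :
  (forall F : set_system V, ProperFilter F ->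
     (forall e : R, 0 < e -> exists x, F [set y | rnorm (x - y) < e]) ->
     exists l, forall e : R, 0 < e -> F [set y | rnorm (l - y) <= e]) ->
  forall F : set_system V, ProperFilter F -> cauchy F -> cvg F.
Proof.
move=> cV F FF /cauchyP cF.
have [e e0|l lP] := cV F FF.
  have [|x Fx] := cF e%:C; first by rewrite ltcR.
  exists x; apply: filterS Fx => y; rewrite -ball_normE/=.
  by rewrite normr_rnorm ltcR.
apply/cvg_ex; exists l; apply/cvgrPdist_le => /= e /posC_real[r r0 ->].
by apply: filterS (lP _ r0) => y/=; rewrite normr_rnorm lecR.
Qed.

Lemma rnorm_cvg (V : completeNormedModType R[i]) (T : Type)
    (F : set_system T) (f : T -> V) : ProperFilter F ->
  (forall e : R, 0 < e -> exists x, F [set t | rnorm (x - f t) < e]) ->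
  exists l, forall e : R, 0 < e -> F [set t | rnorm (l - f t) <= e].
Proof.
move=> FF cf; have /cauchy_cvg/cvg_ex[l lP] : cauchy (f @ F).
  apply/cauchyP => e /posC_real[r r0 ->]; have [x Fx] := cf _ r0; exists x.
  suff: F [set t | ball x r%:C (f t)] by [].
  by apply: filterS Fx => t/=; rewrite -ball_normE/= normr_rnorm ltcR.
exists l => e e0; move/cvgrPdist_le : lP => /(_ e%:C).
by rewrite ltcR => /(_ e0); apply: filterS => t; rewrite normr_rnorm lecR.
Qed.

End real_norm.

(* The part of the structure of a Hilbert module E that is used to form its   *)
(* algebra of adjointable operators: the inner product, conjugate linear on   *)
(* the left, with values in the coefficient algebra P, of which only the      *)
(* norm and the involution ip_conj are used. It is instantiated twice: to     *)
(* E = P = A with <a, b> = a^* b, and to E = l^2(N) with P = C.               *)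
Record inner_product (R : realType) (E : completeNormedModType R[i])
    (P : normedModType R[i]) := InnerProduct {
  ip :> E -> E -> P;
  ip_conj : P -> P;
  ipC : forall x y, ip_conj (ip x y) = ip y x;
  ipDr : forall x y z, ip x (y + z) = ip x y + ip x z;
  ipZr : forall c x y, ip x (c *: y) = c *: ip x y;
  ipDl : forall x y z, ip (x + y) z = ip x z + ip y z;
  ipZl : forall c x y, ip (c *: x) y = c^* *: ip x y;
  ip_norm : forall x, `|ip x x| = `|x| ^+ 2;
  ip_le : forall x y, `|ip x y| <= `|x| * `|y|
}.

Section adjointable_operators.
Variables (R : realType) (E : completeNormedModType R[i]).
Variables (P : normedModType R[i]) (I : inner_product E P).
Implicit Types x y z : E.

(* For a Hilbert space these are all the bounded operators (Riesz). For E = A *)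
(* they are the multipliers of A: T is the left part of the double            *)
(* centralizer whose right part is a |-> (op_adj T a^* )^*.                   *)
Record adjop := Adjop {
  op_fun :> E -> E;
  op_adj : E -> E;
  op_linear : linear op_fun;
  op_bounded : exists M : R, forall x, `|op_fun x| <= M%:C * `|x|;
  op_adjE : forall x y, I (op_adj x) y = I x (op_fun y)
}.

Lemma ipBr x y z : I x (y - z) = I x y - I x z.
Proof. by rewrite ipDr -scaleN1r ipZr scaleN1r. Qed.

Lemma ipBl x y z : I (x - y) z = I x z - I y z.
Proof. by rewrite ipDl -scaleN1r ipZl rmorphN1 scaleN1r. Qed.

Lemma ip_rnorm x : rnorm (I x x) = rnorm x ^+ 2.
Proof.
by apply: complexI; rewrite rmorphXn/= -!normr_rnorm ip_norm.
Qed.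

Lemma ip_rle x y : rnorm (I x y) <= rnorm x * rnorm y.
Proof. by rewrite -lecR rmorphM/= -!normr_rnorm ip_le. Qed.

Lemma ip_ext x y : (forall z, I z x = I z y) -> x = y.
Proof.
move=> xy; apply/eqP; rewrite -subr_eq0; apply/eqP; apply: rnorm_eq0.
apply/eqP; rewrite -sqrf_eq0; apply/eqP; rewrite -ip_rnorm ipBr xy subrr.
exact: rnorm0.
Qed.

Lemma adj_linear (f g : E -> E) : (forall x y, I (g x) y = I x (f y)) ->
  linear f.
Proof. by move=> fg c x y; apply: ip_ext => z; rewrite -fg !(ipDr, ipZr) !fg. Qed.

Lemma op_adjC (T : adjop) x y : I (T x) y = I x (op_adj T y).
Proof. by rewrite -ipC -op_adjE ipC. Qed.

Lemma adjop_eqP (S T : adjop) : (forall x, S x = T x) -> S = T.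
Proof.
move=> ST; have gg : op_adj S = op_adj T.
  apply/funext => x; apply: ip_ext => z.
  by rewrite -!op_adjC ST.
case: S T ST gg => [f g l b a] [f' g' l' b' a']/= ff gg.
have {}ff : f = f' by apply/funext.
subst f' g'; congr Adjop; exact: Prop_irrelevance.
Qed.

Lemma op_rbounded (T : adjop) :
  exists2 M : R, 0 <= M & forall x, rnorm (T x) <= M * rnorm x.
Proof.
have [M MP] := op_bounded T; exists (Num.max 0 M); first by rewrite le_max lexx.
move=> x; apply: (@le_trans _ _ (M * rnorm x)).
  by rewrite -lecR rmorphM/= -!normr_rnorm.
by rewrite ler_wpM2r ?rnorm_ge0// le_max lexx orbT.
Qed.

Definition opnorm (T : adjop) : R :=
  inf [set M : R | 0 <= M /\ forall x, `|T x| <= M%:C * `|x|].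

Lemma opnorm_set (T : adjop) : [set M : R | 0 <= M /\ forall x, `|T x| <= M%:C * `|x|]
  = [set M | 0 <= M /\ forall x, rnorm (T x) <= M * rnorm x].
Proof.
by apply/seteqP; split=> M /= [M0 MP]; split=> // x; have := MP x;
  rewrite !normr_rnorm -rmorphM/= lecR.
Qed.

Lemma opnorm_has_inf (T : adjop) :
  has_inf [set M | 0 <= M /\ forall x, rnorm (T x) <= M * rnorm x].
Proof.
by split; [have [M] := op_rbounded T; exists M|exists 0 => M []].
Qed.

Lemma opnorm_ge0 T : 0 <= opnorm T.
Proof.
rewrite /opnorm opnorm_set; apply: lb_le_inf; last by move=> M [].
by have [] := opnorm_has_inf T.
Qed.

Lemma opnorm_le (T : adjop) M : 0 <= M ->
  (forall x, rnorm (T x) <= M * rnorm x) -> opnorm T <= M.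
Proof.
move=> M0 MP; rewrite /opnorm opnorm_set.
by apply: ge_inf; [have [] := opnorm_has_inf T|split].
Qed.

Lemma op_le (T : adjop) x : rnorm (T x) <= opnorm T * rnorm x.
Proof.
have [x0|x0] := eqVneq (rnorm x) 0.
  by have [M _ /(_ x)] := op_rbounded T; rewrite x0 !mulr0.
have {}x0 : 0 < rnorm x by rewrite lt_def x0 rnorm_ge0.
rewrite -ler_pdivrMr// /opnorm opnorm_set; apply: lb_le_inf.
  by have [] := opnorm_has_inf T.
by move=> M [_ MP]; rewrite ler_pdivrMr.
Qed.

Lemma rbounded_bounded (f : E -> E) M :
  (forall x, rnorm (f x) <= M * rnorm x) ->
  exists M : R, forall x, `|f x| <= M%:C * `|x|.
Proof.
by move=> fM; exists M => x; rewrite !normr_rnorm -rmorphM/= lecR.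
Qed.

Definition make_adjop (f g : E -> E) (fg : forall x y, I (g x) y = I x (f y))
    M (fM : forall x, rnorm (f x) <= M * rnorm x) : adjop :=
  @Adjop f g (adj_linear fg) (rbounded_bounded fM) fg.

Fact op_adj_bounded (T : adjop) x : rnorm (op_adj T x) <= opnorm T * rnorm x.
Proof.
have [y0|y0] := eqVneq (rnorm (op_adj T x)) 0.
  by rewrite y0 mulr_ge0 ?opnorm_ge0 ?rnorm_ge0.
have {}y0 : 0 < rnorm (op_adj T x) by rewrite lt_def y0 rnorm_ge0.
rewrite -(ler_pM2r y0) -expr2 -ip_rnorm op_adjE.
apply: le_trans (ip_rle _ _) _; rewrite mulrAC mulrC.
by rewrite ler_wpM2r ?rnorm_ge0// op_le.
Qed.

Fact op_zeroP x y : I 0 y = I x 0.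
Proof. by rewrite -(scale0r 0) ipZl ipZr conjC0 !scale0r. Qed.
Fact op_zero_bounded x : rnorm (0 : E) <= 0 * rnorm x.
Proof. by rewrite rnorm0 mul0r. Qed.
Definition op_zero := make_adjop op_zeroP op_zero_bounded.

Fact op_addP (S T : adjop) x y : I (op_adj S x + op_adj T x) y = I x (S y + T y).
Proof. by rewrite ipDl ipDr !op_adjE. Qed.
Fact op_add_bounded (S T : adjop) x :
  rnorm (S x + T x) <= (opnorm S + opnorm T) * rnorm x.
Proof. by rewrite (le_trans (rnormD _ _))// mulrDl lerD ?op_le. Qed.
Definition op_add S T := make_adjop (op_addP S T) (op_add_bounded S T).

Fact op_scaleP c (T : adjop) x y : I (c^* *: op_adj T x) y = I x (c *: T y).
Proof. by rewrite ipZl ipZr conjCK op_adjE. Qed.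
Fact op_scale_bounded c (T : adjop) x :
  rnorm (c *: T x) <= (rnorm c * opnorm T) * rnorm x.
Proof. by rewrite rnormZ -mulrA ler_wpM2l ?rnorm_ge0 ?op_le. Qed.
Definition op_scale c T := make_adjop (op_scaleP c T) (op_scale_bounded c T).
Definition op_opp := op_scale (-1).

Fact op_mulP (S T : adjop) x y : I (op_adj T (op_adj S x)) y = I x (S (T y)).
Proof. by rewrite !op_adjE. Qed.
Fact op_mul_bounded (S T : adjop) x :
  rnorm (S (T x)) <= (opnorm S * opnorm T) * rnorm x.
Proof.
by rewrite (le_trans (op_le _ _))// -mulrA ler_wpM2l ?opnorm_ge0 ?op_le.
Qed.
Definition op_mul S T := make_adjop (op_mulP S T) (op_mul_bounded S T).

Definition op_star T := make_adjop (@op_adjC T) (@op_adj_bounded T).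

Fact op_oneP x y : I x y = I x y. Proof. by []. Qed.
Fact op_one_bounded x : rnorm x <= 1 * rnorm x. Proof. by rewrite mul1r. Qed.
Definition op_one := @make_adjop id id op_oneP 1 op_one_bounded.

HB.instance Definition _ := gen_eqMixin adjop.
HB.instance Definition _ := gen_choiceMixin adjop.

Fact op_addA : associative op_add.
Proof. by move=> ? ? ?; apply: adjop_eqP => x; rewrite /= addrA. Qed.
Fact op_addC : commutative op_add.
Proof. by move=> ? ?; apply: adjop_eqP => x; rewrite /= addrC. Qed.
Fact op_add0 : left_id op_zero op_add.
Proof. by move=> ?; apply: adjop_eqP => x; rewrite /= add0r. Qed.
Fact op_addN : left_inverse op_zero op_opp op_add.
Proof. by move=> ?; apply: adjop_eqP => x; rewrite /= scaleN1r addNr. Qed.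

HB.instance Definition _ :=
  GRing.isZmodule.Build adjop op_addA op_addC op_add0 op_addN.

Fact op_scaleA a b T : op_scale a (op_scale b T) = op_scale (a * b) T.
Proof. by apply: adjop_eqP => x; rewrite /= scalerA. Qed.
Fact op_scale1 : left_id 1 op_scale.
Proof. by move=> ?; apply: adjop_eqP => x; rewrite /= scale1r. Qed.
Fact op_scaleDr : right_distributive op_scale +%R.
Proof. by move=> ? ? ?; apply: adjop_eqP => x; rewrite /= scalerDr. Qed.
Fact op_scaleDl T : {morph op_scale^~ T : a b / a + b}.
Proof. by move=> ? ?; apply: adjop_eqP => x; rewrite /= scalerDl. Qed.

HB.instance Definition _ := GRing.Zmodule_isLmodule.Build R[i] adjop
  op_scaleA op_scale1 op_scaleDr op_scaleDl.

Fact opnormD (S T : adjop) :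
  (opnorm (S + T))%:C <= (opnorm S)%:C + (opnorm T)%:C.
Proof.
rewrite -rmorphD lecR opnorm_le ?addr_ge0 ?opnorm_ge0//.
exact: op_add_bounded.
Qed.

Fact opnormZ c (T : adjop) : (opnorm (c *: T))%:C = `|c| * (opnorm T)%:C.
Proof.
rewrite normr_rnorm -rmorphM; congr (_%:C).
have le d S : opnorm (d *: S) <= rnorm d * opnorm S.
  by rewrite opnorm_le ?mulr_ge0 ?rnorm_ge0 ?opnorm_ge0//; exact: op_scale_bounded.
apply/eqP; rewrite eq_le le/=; have [->|c0] := eqVneq c 0.
  by rewrite rnorm0 mul0r opnorm_ge0.
have c0' : 0 < rnorm c.
  by rewrite lt_def rnorm_ge0 andbT; apply: contra_neq c0; exact: rnorm_eq0.
have cV : rnorm c * rnorm c^-1 = 1.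
  apply: complexI; rewrite rmorphM/= -!normr_rnorm normfV divff//.
  by rewrite normr_eq0.
have := le c^-1 (c *: T); rewrite scalerA mulVf// scale1r.
by move/(ler_wpM2l (ltW c0')); rewrite mulrA cV mul1r.
Qed.

Fact opnorm_eq0 (T : adjop) : (opnorm T)%:C = 0 :> R[i] -> T = 0.
Proof.
move=> [] T0; apply: adjop_eqP => x; apply: rnorm_eq0; apply/eqP.
by rewrite eq_le rnorm_ge0 andbT; have := op_le T x; rewrite T0 mul0r.
Qed.

HB.instance Definition _ := Lmodule_isNormed.Build R[i] adjop
  opnormD opnormZ opnorm_eq0.

Lemma op_rnormE (T : adjop) : rnorm T = opnorm T. Proof. by []. Qed.

Lemma opBE (S T : adjop) x : (S - T) x = S x - T x.
Proof. by rewrite -scaleN1r /= scaleN1r. Qed.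

Lemma op_adjBE (S T : adjop) x : op_adj (S - T) x = op_adj S x - op_adj T x.
Proof. by rewrite -scaleN1r /= rmorphN1 scaleN1r. Qed.

Lemma adjop_complete (F : set_system adjop) :
  ProperFilter F -> cauchy F -> cvg F.
Proof.
apply: rnorm_complete => {}F FF cF.
have limit (h : adjop -> E -> E) :
    (forall S T x, rnorm (h S x - h T x) <= opnorm (S - T) * rnorm x) ->
    forall x, exists l, forall e : R, 0 < e -> F [set T | rnorm (l - h T x) <= e].
  move=> hP x; apply: rnorm_cvg => e e0.
  have xp : 0 < rnorm x + 1 by rewrite ltr_wpDl ?rnorm_ge0.
  have [S FS] := cF _ (divr_gt0 e0 xp); exists (h S x).
  apply: filterS FS => T/=; rewrite op_rnormE ltr_pdivlMr// => ST.
  apply: le_lt_trans (hP _ _ _) (le_lt_trans _ ST).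
  by rewrite ler_wpM2l ?opnorm_ge0// lerDl.
have /choice[f fP] : forall x, exists l, forall e : R, 0 < e ->
    F [set T : adjop | rnorm (l - T x) <= e].
  by apply: limit => S T x; rewrite -opBE op_le.
have /choice[g gP] : forall x, exists l, forall e : R, 0 < e ->
    F [set T : adjop | rnorm (l - op_adj T x) <= e].
  by apply: limit => S T x; rewrite -op_adjBE op_adj_bounded.
have near (S : adjop) (e : R) : 0 < e -> F [set T | rnorm (S - T) < e] ->
    forall x, rnorm (f x - S x) <= e * rnorm x.
  move=> e0 FS x; apply/ler_addgt0Pl => d d0.
  have [T [ST fT]] := filter_ex (filterI FS (fP x d d0)).
  rewrite (_ : f x - S x = (f x - T x) - (S - T) x); last first.
    by rewrite opBE opprB addrA subrK.
  rewrite (le_trans (rnormD _ _))// rnormN lerD//.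
  by rewrite (le_trans (op_le _ _))// ler_wpM2r ?rnorm_ge0// ltW.
have fg x y : I (g x) y = I x (f y).
  apply/eqP; rewrite -subr_eq0; apply/eqP; apply: rnorm_le0 => e e0.
  set M := rnorm x + rnorm y + 1.
  have M0 : 0 < M by rewrite ltr_wpDl ?addr_ge0 ?rnorm_ge0.
  have eM := divr_gt0 e0 M0.
  have [T [/= gT fT]] := filter_ex (filterI (gP x _ eM) (fP y _ eM)).
  rewrite (_ : _ - _ = I (g x - op_adj T x) y - I x (f y - T y)); last first.
    rewrite ipBr ipBl op_adjE.
    by rewrite opprB addrA subrK.
  rewrite (le_trans (rnormD _ _))// rnormN.
  apply: (@le_trans _ _ (e / M * (rnorm x + rnorm y))); last first.
    by rewrite mulrAC ler_pdivrMr// ler_wpM2l ?ltW// ltrDl.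
  rewrite mulrDr addrC lerD//; apply: le_trans (ip_rle _ _) _.
    by rewrite mulrC ler_wpM2r ?rnorm_ge0.
  by rewrite ler_wpM2r ?rnorm_ge0.
have [S FS] := cF 1 ltr01.
have fM x : rnorm (f x) <= (opnorm S + 1) * rnorm x.
  rewrite -[f x](subrK (S x)) (le_trans (rnormD _ _))// mulrDl addrC lerD//.
    exact: op_le.
  exact: (near S 1 ltr01 FS).
exists (make_adjop fg fM) => e e0.
have e20 : 0 < e / 2 by rewrite divr_gt0.
have [T FT] := cF _ e20; apply: filterS (FT) => T'/= TT'.
rewrite (_ : _ - T' = (make_adjop fg fM - T) + (T - T')); last first.
  by rewrite addrA subrK.
rewrite (le_trans (rnormD _ _))// [e]splitr lerD// ?(ltW TT')//.
rewrite op_rnormE opnorm_le ?(ltW e20)// => x; rewrite opBE/=.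
exact: near.
Qed.

HB.instance Definition _ := Uniform_isComplete.Build adjop adjop_complete.

Fact op_mulA : associative op_mul.
Proof. by move=> ? ? ?; exact: adjop_eqP. Qed.
Fact op_mulDl : left_distributive op_mul +%R.
Proof. by move=> ? ? ?; exact: adjop_eqP. Qed.
Fact op_mulDr : right_distributive op_mul +%R.
Proof.
move=> S T U; apply: adjop_eqP => x /=.
by have := op_linear S 1 (T x) (U x); rewrite !scale1r.
Qed.
Fact op_mulZl c S T : op_mul (c *: S) T = c *: op_mul S T.
Proof. exact: adjop_eqP. Qed.
Fact op_mulZr c S T : op_mul S (c *: T) = c *: op_mul S T.
Proof.
apply: adjop_eqP => x /=; have S0 : S 0 = 0.
  by have := op_linear S (-1) 0 0; rewrite !scaleN1r oppr0 addr0 addNr.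
by have := op_linear S c (T x) 0; rewrite S0 !addr0.
Qed.
Fact op_starK : involutive op_star.
Proof. by move=> ?; exact: adjop_eqP. Qed.
Fact op_starD : {morph op_star : S T / S + T}.
Proof. by move=> ? ?; exact: adjop_eqP. Qed.
Fact op_starZ c T : op_star (c *: T) = c^* *: op_star T.
Proof. exact: adjop_eqP. Qed.
Fact op_starM S T : op_star (op_mul S T) = op_mul (op_star T) (op_star S).
Proof. exact: adjop_eqP. Qed.
Fact op_normM (S T : adjop) : `|op_mul S T| <= `|S| * `|T|.
Proof.
rewrite !normr_rnorm -rmorphM lecR; apply: opnorm_le.
  by rewrite mulr_ge0 ?rnorm_ge0.
exact: op_mul_bounded.
Qed.
Fact op_norm_star (T : adjop) : opnorm (op_star T) <= opnorm T.
Proof. by apply: opnorm_le (opnorm_ge0 _) _; exact: op_adj_bounded. Qed.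

Fact op_cstarE (T : adjop) : `|op_mul (op_star T) T| = `|T| ^+ 2.
Proof.
apply/eqP; rewrite eq_le; apply/andP; split.
  rewrite (le_trans (op_normM _ _))// expr2 ler_wpM2r//.
  by rewrite !normr_rnorm lecR; exact: op_norm_star.
rewrite !normr_rnorm -rmorphXn lecR !op_rnormE.
set c := opnorm (op_mul _ _); have c0 : 0 <= c by exact: opnorm_ge0.
suff : opnorm T <= Num.sqrt c.
  move=> Tc; rewrite -[c in _ <= c]sqr_sqrtr// ler_sqr// nnegrE ?opnorm_ge0//.
  exact: sqrtr_ge0.
apply: opnorm_le => [|x]; first exact: sqrtr_ge0.
rewrite -(@ler_pXn2r _ 2) ?nnegrE ?rnorm_ge0 ?mulr_ge0 ?sqrtr_ge0 ?rnorm_ge0//.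
rewrite exprMn sqr_sqrtr// -ip_rnorm op_adjC.
rewrite (le_trans (ip_rle _ _))// mulrC expr2 mulrA ler_wpM2r ?rnorm_ge0//.
exact: (op_le (op_mul (op_star T) T)).
Qed.

HB.instance Definition _ := isCStar.Build R adjop op_mulA op_mulDl op_mulDr
  op_mulZl op_mulZr op_starK op_starD op_starZ op_starM op_normM op_cstarE.

End adjointable_operators.

Section linear_span.
Variables (R : realType) (V : lmodType R[i]).

Definition is_subspace (W : set V) :=
  W 0 /\ forall (c : R[i]) x y, W x -> W y -> W (c *: x + y).

Definition lspan (S : set V) : set V :=
  [set x | forall W, is_subspace W -> S `<=` W -> W x].

Lemma lspan_subspace S : is_subspace (lspan S).
Proof.
split=> [W sW _|c x y xS yS W sW SW]; first by case: sW.
have [_ Wlin] := sW.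
by apply: Wlin; [exact: xS|exact: yS].
Qed.

Lemma sub_lspan S : S `<=` lspan S.
Proof. by move=> x Sx W _; apply. Qed.

Lemma lspan_ind S (W : set V) : is_subspace W -> S `<=` W -> lspan S `<=` W.
Proof. by move=> sW SW x; apply. Qed.

End linear_span.

Section cstar_subalgebra.
Variables (R : realType) (A : cstarAlgType R).
Implicit Types (S B : set A) (x y : A).

Lemma cmul0r x : (0 : A) ** x = 0.
Proof. by rewrite -(scale0r 0) cmulZl !scale0r. Qed.

Lemma cmulr0 x : x ** 0 = 0.
Proof. by rewrite -(scale0r 0) cmulZr !scale0r. Qed.

Lemma star0 : star (0 : A) = 0.
Proof. by rewrite -(scale0r 0) starZ conjC0 !scale0r. Qed.

Lemma starB x y : star (x - y) = star x - star y.
Proof. by rewrite starD -scaleN1r starZ rmorphN1 scaleN1r. Qed.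

Lemma rnorm_cmul x y : rnorm (x ** y) <= rnorm x * rnorm y.
Proof. by rewrite -lecR rmorphM/= -!normr_rnorm cnormM. Qed.

Lemma rnorm_star_le x : rnorm x <= rnorm (star x).
Proof.
have [->|x0] := eqVneq x 0; first by rewrite star0.
have {}x0 : 0 < rnorm x.
  by rewrite lt_def rnorm_ge0 andbT; apply: contra_neq x0; exact: rnorm_eq0.
rewrite -(ler_pM2r x0) -expr2; apply: le_trans (rnorm_cmul _ _).
by rewrite -lecR rmorphXn/= -!normr_rnorm cstarE.
Qed.

Lemma rnorm_star x : rnorm (star x) = rnorm x.
Proof.
by apply/eqP; rewrite eq_le rnorm_star_le -{2}[x]starK rnorm_star_le.
Qed.

Definition star_closed B := [/\ is_subspace B,
  forall x y, B x -> B y -> B (x ** y) & forall x, B x -> B (star x)].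

Definition is_cstar_subalgebra B := star_closed B /\ closed B.

Lemma closure_rnorm B x :
  closure B x <-> forall e : R, 0 < e -> exists2 y, B y & rnorm (x - y) < e.
Proof.
split=> [xB e e0|xB U].
  have : nbhs x [set y | rnorm (x - y) < e].
    apply/nbhs_ballP; exists e%:C; first by rewrite /= ltcR.
    by move=> y; rewrite -ball_normE/= normr_rnorm ltcR.
  by move=> /xB[y [By xy]]; exists y.
move=> /nbhs_ballP[e /= /posC_real[r r0 ->] xU]; have [y By xy] := xB _ r0.
exists y; split=> //; apply: xU.
by rewrite -ball_normE/= normr_rnorm ltcR.
Qed.

Lemma closure_cstar_subalgebra B :
  star_closed B -> is_cstar_subalgebra (closure B).
Proof.
move=> [[B0 Blin] Bmul Bstar]; split; last exact: closed_closure.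
split; first split.
- exact: subset_closure.
- move=> c x y /closure_rnorm xB /closure_rnorm yB; apply/closure_rnorm => e e0.
  have c0 : 0 < rnorm c + 1 by rewrite ltr_wpDl ?rnorm_ge0.
  have e20 : 0 < e / 2 by rewrite divr_gt0.
  have [x' Bx' xx'] := xB _ (divr_gt0 e20 c0).
  have [y' By' yy'] := yB _ e20.
  exists (c *: x' + y'); first exact: Blin.
  rewrite (_ : _ - _ = c *: (x - x') + (y - y')); last first.
    by rewrite scalerBr opprD addrACA.
  rewrite (le_lt_trans (rnormD _ _))// rnormZ [e]splitr ler_ltD//.
  rewrite ltr_pdivlMr// in xx'; apply: le_trans (ltW xx').
  by rewrite mulrC ler_wpM2l ?rnorm_ge0// lerDl.
- move=> x y /closure_rnorm xB /closure_rnorm yB; apply/closure_rnorm => e e0.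
  set M := rnorm x + rnorm y + 2.
  have M0 : 0 < M by rewrite ltr_wpDl ?addr_ge0 ?rnorm_ge0.
  set d := Num.min 1 (e / M).
  have d0 : 0 < d by rewrite lt_min ltr01 divr_gt0.
  have [x' Bx' xx'] := xB _ d0; have [y' By' yy'] := yB _ d0.
  exists (x' ** y'); first exact: Bmul.
  rewrite (_ : _ - _ = (x - x') ** y' + x ** (y - y')); last first.
    have B1 u v w : (u - v) ** w = u ** w - v ** w :> A.
      by rewrite cmulDl -scaleN1r cmulZl scaleN1r.
    have B2 u v w : w ** (u - v) = w ** u - w ** v :> A.
      by rewrite cmulDr -scaleN1r cmulZr scaleN1r.
    by rewrite B1 B2 [RHS]addrC addrA subrK.
  have y'M : rnorm y' <= rnorm y + 1.
    rewrite -[y'](subrK y) (le_trans (rnormD _ _))// addrC lerD2l.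
    rewrite -rnormN opprB (le_trans (ltW yy'))//.
    by rewrite ge_min lexx.
  have dM : d * M <= e by rewrite -ler_pdivlMr// ge_min lexx orbT.
  apply: le_lt_trans (rnormD _ _) _; apply: lt_le_trans dM.
  apply: (@le_lt_trans _ _ (d * (rnorm y + 1) + rnorm x * d)).
    apply: lerD; apply: le_trans (rnorm_cmul _ _) _.
      by rewrite ler_pM ?rnorm_ge0// ltW.
    by rewrite ler_wpM2l ?rnorm_ge0// ltW.
  by rewrite [rnorm x * d]mulrC -mulrDr ltr_pM2l// /M; lra.
- move=> x /closure_rnorm xB; apply/closure_rnorm => e /xB[y By xy].
  by exists (star y); [exact: Bstar|rewrite -starB rnorm_star].
Qed.

Definition cstar_generated S : set A :=
  [set x | forall B, is_cstar_subalgebra B -> S `<=` B -> B x].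

Lemma cstar_generatedP S : is_cstar_subalgebra (cstar_generated S).
Proof.
split; first split; first split.
- by move=> B [[[B0 _] _ _] _] _.
- move=> c x y xS yS B cB SB; have [[[_ Blin] _ _] _] := cB.
  by apply: Blin; [exact: xS|exact: yS].
- move=> x y xS yS B cB SB; have [[_ Bmul _] _] := cB.
  by apply: Bmul; [exact: xS|exact: yS].
- move=> x xS B cB SB; have [[_ _ Bstar] _] := cB.
  by apply: Bstar; exact: xS.
- move=> x xS B cB SB; have [_ Bcl] := cB.
  by apply: Bcl; apply: closureS xS => y; exact.
Qed.

Lemma sub_cstar_generated S : S `<=` cstar_generated S.
Proof. by move=> x Sx B _; apply. Qed.

(* The proof cB is a parameter of the type so that the C*-algebra structure   *)
(* below can be inferred.                                                     *)
Record subalgebra B (cB : is_cstar_subalgebra B) :=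
  SubCStar { subcstar_val :> A; subcstarP : B subcstar_val }.

Section subalgebra_type.
Variables (B : set A) (cB : is_cstar_subalgebra B).
Local Notation subcstar := (subalgebra cB).
Local Notation SubCStar := (SubCStar cB).
Local Notation subcstar_val := (@subcstar_val B cB).


Let B0 : B 0. Proof. by have [[[]]] := cB. Qed.
Let Blin (c : R[i]) x y : B x -> B y -> B (c *: x + y).
Proof. by have [[[_ +] _ _] _] := cB; exact. Qed.
Let BD x y : B x -> B y -> B (x + y).
Proof. by rewrite -{2}[x]scale1r; exact: Blin. Qed.
Let BZ (c : R[i]) x : B x -> B (c *: x).
Proof. by move=> Bx; rewrite -[_ *: _]addr0; exact: Blin. Qed.
Let BM x y : B x -> B y -> B (x ** y).
Proof. by have [[_ + _] _] := cB; exact. Qed.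
Let BS x : B x -> B (star x).
Proof. by have [[_ _ +] _] := cB; exact. Qed.

Lemma subcstar_inj (u v : subcstar) : u = v :> A -> u = v.
Proof.
case: u v => [x xB] [y yB]/= xy; subst y.
by congr SubCStar; exact: Prop_irrelevance.
Qed.

HB.instance Definition _ := gen_eqMixin subcstar.
HB.instance Definition _ := gen_choiceMixin subcstar.

Definition sub_zero := SubCStar B0.
Definition sub_add (u v : subcstar) := SubCStar (BD (subcstarP u) (subcstarP v)).
Definition sub_scale c (u : subcstar) := SubCStar (BZ c (subcstarP u)).
Definition sub_opp := sub_scale (-1).
Definition sub_mul (u v : subcstar) := SubCStar (BM (subcstarP u) (subcstarP v)).
Definition sub_star (u : subcstar) := SubCStar (BS (subcstarP u)).

Fact sub_addA : associative sub_add.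
Proof. by move=> ? ? ?; apply: subcstar_inj; rewrite /= addrA. Qed.
Fact sub_addC : commutative sub_add.
Proof. by move=> ? ?; apply: subcstar_inj; rewrite /= addrC. Qed.
Fact sub_add0 : left_id sub_zero sub_add.
Proof. by move=> ?; apply: subcstar_inj; rewrite /= add0r. Qed.
Fact sub_addN : left_inverse sub_zero sub_opp sub_add.
Proof. by move=> ?; apply: subcstar_inj; rewrite /= scaleN1r addNr. Qed.

HB.instance Definition _ :=
  GRing.isZmodule.Build subcstar sub_addA sub_addC sub_add0 sub_addN.

Fact sub_scaleA a b u : sub_scale a (sub_scale b u) = sub_scale (a * b) u.
Proof. by apply: subcstar_inj; rewrite /= scalerA. Qed.
Fact sub_scale1 : left_id 1 sub_scale.
Proof. by move=> ?; apply: subcstar_inj; rewrite /= scale1r. Qed.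
Fact sub_scaleDr : right_distributive sub_scale +%R.
Proof. by move=> ? ? ?; apply: subcstar_inj; rewrite /= scalerDr. Qed.
Fact sub_scaleDl u : {morph sub_scale^~ u : a b / a + b}.
Proof. by move=> ? ?; apply: subcstar_inj; rewrite /= scalerDl. Qed.

HB.instance Definition _ := GRing.Zmodule_isLmodule.Build R[i] subcstar
  sub_scaleA sub_scale1 sub_scaleDr sub_scaleDl.

Definition sub_norm (u : subcstar) : R[i] := `|u : A|.
Fact sub_normD (u v : subcstar) : sub_norm (u + v) <= sub_norm u + sub_norm v.
Proof. exact: ler_normD. Qed.
Fact sub_normZ c (u : subcstar) : sub_norm (c *: u) = `|c| * sub_norm u.
Proof. exact: normrZ. Qed.
Fact sub_norm_eq0 (u : subcstar) : sub_norm u = 0 -> u = 0.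
Proof. by move=> u0; apply: subcstar_inj; exact: normr0_eq0. Qed.

HB.instance Definition _ := Lmodule_isNormed.Build R[i] subcstar
  sub_normD sub_normZ sub_norm_eq0.

Lemma sub_rnormB (u v : subcstar) : rnorm (u - v) = rnorm (subcstar_val u - subcstar_val v).
Proof. by rewrite -(scaleN1r (subcstar_val v)). Qed.

Lemma subcstar_complete (F : set_system subcstar) :
  ProperFilter F -> cauchy F -> cvg F.
Proof.
apply: rnorm_complete => {}F FF cF.
have [|l lP] := @rnorm_cvg R A _ F subcstar_val FF.
  move=> e /cF[u Fu]; exists (subcstar_val u); apply: filterS Fu => v/=.
  by rewrite sub_rnormB.
have lB : B l.
  have [_ Bcl] := cB; apply: Bcl; apply/closure_rnorm => e e0.
  have e20 : 0 < e / 2 by rewrite divr_gt0.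
  have [u/= lu] := filter_ex (lP _ e20); exists (subcstar_val u); first exact: subcstarP.
  by apply: le_lt_trans lu _; rewrite ltr_pdivrMr// mulr_natr mulr2n ltrDl.
exists (SubCStar lB) => e /lP; apply: filterS => v/=.
by rewrite sub_rnormB.
Qed.

HB.instance Definition _ := Uniform_isComplete.Build subcstar subcstar_complete.

Fact sub_mulA : associative sub_mul.
Proof. by move=> ? ? ?; apply: subcstar_inj; exact: cmulA. Qed.
Fact sub_mulDl : left_distributive sub_mul +%R.
Proof. by move=> ? ? ?; apply: subcstar_inj; exact: cmulDl. Qed.
Fact sub_mulDr : right_distributive sub_mul +%R.
Proof. by move=> ? ? ?; apply: subcstar_inj; exact: cmulDr. Qed.
Fact sub_mulZl c u v : sub_mul (c *: u) v = c *: sub_mul u v.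
Proof. by apply: subcstar_inj; exact: cmulZl. Qed.
Fact sub_mulZr c u v : sub_mul u (c *: v) = c *: sub_mul u v.
Proof. by apply: subcstar_inj; exact: cmulZr. Qed.
Fact sub_starK : involutive sub_star.
Proof. by move=> ?; apply: subcstar_inj; exact: starK. Qed.
Fact sub_starD : {morph sub_star : u v / u + v}.
Proof. by move=> ? ?; apply: subcstar_inj; exact: starD. Qed.
Fact sub_starZ c u : sub_star (c *: u) = c^* *: sub_star u.
Proof. by apply: subcstar_inj; exact: starZ. Qed.
Fact sub_starM u v : sub_star (sub_mul u v) = sub_mul (sub_star v) (sub_star u).
Proof. by apply: subcstar_inj; exact: starM. Qed.
Fact sub_normM (u v : subcstar) : `|sub_mul u v| <= `|u| * `|v|.
Proof. exact: cnormM. Qed.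
Fact sub_cstarE (u : subcstar) : `|sub_mul (sub_star u) u| = `|u| ^+ 2.
Proof. exact: cstarE. Qed.

HB.instance Definition _ := isCStar.Build R subcstar sub_mulA sub_mulDl
  sub_mulDr sub_mulZl sub_mulZr sub_starK sub_starD sub_starZ sub_starM
  sub_normM sub_cstarE.

End subalgebra_type.
End cstar_subalgebra.

Section star_homomorphisms.
Variables (R : realType) (A B : cstarAlgType R).

Definition star_hom (f : A -> B) := [/\ linear f,
  forall x y, f (x ** y) = f x ** f y & forall x, f (star x) = star (f x)].

End star_homomorphisms.

Section multipliers.
Variables (R : realType) (A : cstarAlgType R).

Fact cstar_ipC (x y : A) : star (star x ** y) = star y ** x.
Proof. by rewrite starM starK. Qed.
Fact cstar_ipDr (x y z : A) : star x ** (y + z) = star x ** y + star x ** z.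
Proof. exact: cmulDr. Qed.
Fact cstar_ipZr c (x y : A) : star x ** (c *: y) = c *: (star x ** y).
Proof. exact: cmulZr. Qed.
Fact cstar_ipDl (x y z : A) : star (x + y) ** z = star x ** z + star y ** z.
Proof. by rewrite starD cmulDl. Qed.
Fact cstar_ipZl c (x y : A) : star (c *: x) ** y = c^* *: (star x ** y).
Proof. by rewrite starZ cmulZl. Qed.
Fact cstar_ip_le (x y : A) : `|star x ** y| <= `|x| * `|y|.
Proof.
by rewrite !normr_rnorm -rmorphM lecR -(rnorm_star x) rnorm_cmul.
Qed.

Definition cstar_ip : inner_product A A := @InnerProduct R A A
  (fun x y => star x ** y) star cstar_ipC cstar_ipDr cstar_ipZr cstar_ipDl
  cstar_ipZl (@cstarE R A) cstar_ip_le.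

Fact left_mulP (a x y : A) : cstar_ip (star a ** x) y = cstar_ip x (a ** y).
Proof. by rewrite /= starM starK cmulA. Qed.
Fact left_mul_bounded (a x : A) : rnorm (a ** x) <= rnorm a * rnorm x.
Proof. exact: rnorm_cmul. Qed.

Definition left_mul (a : A) : adjop cstar_ip :=
  make_adjop (left_mulP a) (left_mul_bounded a).

End multipliers.

(* The multiplier algebra M(A); left_mul is the embedding of A into it. *)
Notation multiplier A := (adjop (cstar_ip A)).

Section operators_on_ell2.
Variable R : realType.
Local Notation H := (ell2 R).

Fact ell2_ip_norm (x : H) : `|ell2_dot x x| = `|x| ^+ 2.
Proof.
rewrite ell2_dotxx ell2_normE -rmorphXn/= ell2_norm_sq.
by rewrite ger0_norm// lecR ell2_sq_ge0.
Qed.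
Fact ell2_ip_le (x y : H) : `|ell2_dot x y| <= `|x| * `|y|.
Proof. by rewrite !ell2_normE -rmorphM/= ell2_dot_le. Qed.

Definition ell2_ip : inner_product H R[i]^o := @InnerProduct R H R[i]^o
  (@ell2_dot R) (@Num.conj R[i]) (@ell2_dotC R) (@ell2_dotDr R) (@ell2_dotZr R)
  (@ell2_dotDl R) (@ell2_dotZl R) ell2_ip_norm ell2_ip_le.

Fact rank_oneP (x y u v : H) :
  ell2_ip (ell2_ip x u *: y) v = ell2_ip u (ell2_ip y v *: x).
Proof. by rewrite ipZl ipZr -(ipC ell2_ip x u); exact: mulrC. Qed.

Fact rank_one_bounded (x y v : H) :
  rnorm (ell2_ip y v *: x) <= (rnorm x * rnorm y) * rnorm v.
Proof.
rewrite rnormZ mulrC -mulrA ler_wpM2l ?rnorm_ge0//.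
exact: (ip_rle ell2_ip).
Qed.

Definition rank_one (x y : H) : adjop ell2_ip :=
  make_adjop (rank_oneP x y) (rank_one_bounded x y).

Definition finite_rank : set (adjop ell2_ip) :=
  lspan [set T | exists x y, T = rank_one x y].

Lemma finite_rank_star_closed : star_closed finite_rank.
Proof.
have [S0 Slin] := lspan_subspace [set T | exists x y, T = rank_one x y].
split; first by split.
  move=> S T Sf Tf; move: S Sf; apply: lspan_ind.
    split=> [|c x y xT yT]; first by rewrite cmul0r.
    by rewrite cmulDl cmulZl; exact: Slin.
  move=> _ [x [y ->]] /=; move: T Tf; apply: lspan_ind.
    split=> [|c u v xu xv] /=; first by rewrite cmulr0.
    by rewrite cmulDr cmulZr; exact: Slin.
  move=> _ [u [v ->]] /=.
  have -> : rank_one x y ** rank_one u v = ell2_ip y u *: rank_one x v + 0.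
    rewrite addr0; apply: adjop_eqP => z /=.
    by rewrite ell2_dotZr scalerA mulrC.
  by apply: Slin => //; apply: sub_lspan; exists x, v.
apply: lspan_ind.
  split=> [|c x y xT yT] /=; first by rewrite star0.
  by rewrite starD starZ; exact: Slin.
move=> _ [x [y ->]] /=; apply: sub_lspan; exists y, x.
exact: adjop_eqP.
Qed.

(* K(l^2(N)), as the norm closure of the finite-rank operators. *)
Definition compacts : cstarAlgType R :=
  subalgebra (closure_cstar_subalgebra finite_rank_star_closed).

Definition shift_fun (f : nat -> R[i]) (n : nat) : R[i] :=
  if n is k.+1 then f k else 0.
Definition coshift_fun (f : nat -> R[i]) (n : nat) : R[i] := f n.+1.

Lemma series_shift (u : nat -> R) n :
  u 0%N = 0 -> series u n.+1 = series (fun k => u k.+1) n.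
Proof. by move=> u0; rewrite /series/= big_nat_recl//= u0 add0r. Qed.

Lemma cvg_series_shift (u : nat -> R) : u 0%N = 0 ->
  cvgn (series (fun k => u k.+1)) ->
  cvgn (series u) /\ limn (series u) = limn (series (fun k => u k.+1)).
Proof.
move=> u0 cu; have : series u n @[n --> \oo] --> limn (series (fun k => u k.+1)).
  rewrite -(cvg_shiftS (series u)).
  by rewrite (_ : [sequence _]_n = series (fun k => u k.+1))//;
    apply/funext => n; rewrite /= series_shift.
by move=> cv; split; [apply/cvg_ex; eexists; exact: cv|exact: cvg_lim].
Qed.

Fact shift_summable (x : H) : square_summable (shift_fun x).
Proof.
apply: (proj1 (cvg_series_shift _ _)); last exact: ell2P.
by rewrite /= /sqmod/= expr0n/= addr0.
Qed.
Definition shift_vec (x : H) : H := Ell2 (@shift_summable x).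

Fact coshift_summable (x : H) : square_summable (coshift_fun x).
Proof.
have := ell2P x; rewrite /square_summable => cx.
have [] // := @lim_series_le_bound R (@sqmod R \o coshift_fun x) (ell2_sq x).
  by move=> k; exact: sqmod_ge0.
move=> n; apply: le_trans (partial_le_lim n.+1 _ cx); last first.
  by move=> k; exact: sqmod_ge0.
by rewrite big_nat_recl//= lerDr sqmod_ge0.
Qed.
Definition coshift_vec (x : H) : H := Ell2 (@coshift_summable x).

Fact shiftP (x y : H) : ell2_ip (coshift_vec x) y = ell2_ip x (shift_vec y).
Proof.
have [rc ic] := ell2_dot_csummable (coshift_vec x) y.
rewrite /= /ell2_dot /csum.
rewrite (proj2 (@cvg_series_shift (@complex.Re R \o (fun k => (x k)^* * shift_vec y k)) _ rc)) /=; last by rewrite mulr0.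
by rewrite (proj2 (@cvg_series_shift (@complex.Im R \o (fun k => (x k)^* * shift_vec y k)) _ ic)) //= mulr0.
Qed.

Fact shift_bounded (x : H) : rnorm (shift_vec x) <= 1 * rnorm x.
Proof.
rewrite mul1r /rnorm !ell2_normE /= ler_wsqrtr//.
rewrite /ell2_sq (proj2 (@cvg_series_shift (@sqmod R \o shift_vec x) _ (ell2P x)))//.
by rewrite /= /sqmod/= expr0n/= addr0.
Qed.

Definition unilateral_shift : adjop ell2_ip := make_adjop shiftP shift_bounded.

Definition shift_pow (n : nat) : adjop ell2_ip :=
  iter n (cmul unilateral_shift) (op_one ell2_ip).

(* The Toeplitz algebra T(Z), the C*-subalgebra of B(l^2(N)) generated by the *)
(* T_n = T_1^n; it is unital with unit T_0 = 1.                               *)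
Definition toeplitz : cstarAlgType R :=
  subalgebra (cstar_generatedP (range shift_pow)).

Fact shift_pow_toeplitz n : cstar_generated (range shift_pow) (shift_pow n).
Proof. by apply: sub_cstar_generated; exists n. Qed.

Definition toeplitz_isometry (n : nat) : toeplitz :=
  SubCStar _ (shift_pow_toeplitz n).

End operators_on_ell2.

Section systems.
Variables (R : realType) (A : cstarAlgType R).

Record automorphism := Automorphism {
  aut_fun :> A -> A;
  aut_inv : A -> A;
  aut_star_hom : star_hom aut_fun;
  aut_funK : cancel aut_fun aut_inv;
  aut_invK : cancel aut_inv aut_fun
}.

Definition aut_pow (alpha : automorphism) (n : int) : A -> A :=
  match n with
  | Posz m => iter m alpha
  | Negz m => iter m.+1 (aut_inv alpha)
  end.

Definition unitary_rep (C : cstarAlgType R) (u : int -> multiplier C) :=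
  [/\ u 0 = op_one _, forall m n, u (m + n) = u m ** u n
    & forall m, star (u m) = u (- m)].

(* pi(B)C spans a dense subspace of C. *)
Definition nondegenerate (B C : cstarAlgType R) (pi : B -> multiplier C) :=
  closure (lspan [set x | exists b c, x = pi b c]) = setT.

Definition covariant (alpha : automorphism) (C : cstarAlgType R)
    (pi : A -> multiplier C) (u : int -> multiplier C) :=
  forall n a, pi (aut_pow alpha n a) = u n ** pi a ** star (u n).

(* The universal property of the crossed product by Z. The two last clauses   *)
(* say that Phi is the integrated form of (pi, u): since Phi is               *)
(* nondegenerate, it extends uniquely to multipliers, and an extension that   *)
(* maps jZ n to u n is the same as Phi (jZ n b) = u n ** Phi b for all b.     *)
Record is_crossed_product (alpha : automorphism) (B : cstarAlgType R)
    (jA : A -> B) (jZ : int -> multiplier B) : Prop := {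
  crossed_jA_hom : star_hom jA;
  crossed_jA_nondeg : nondegenerate (fun a => left_mul (jA a));
  crossed_jZ_rep : unitary_rep jZ;
  crossed_covariant : covariant alpha (fun a => left_mul (jA a)) jZ;
  crossed_dense : closure (lspan [set b | exists n a, b = jZ n (jA a)]) = setT;
  crossed_universal : forall (C : cstarAlgType R)
      (pi : A -> multiplier C) (u : int -> multiplier C),
    star_hom pi -> nondegenerate pi -> unitary_rep u -> covariant alpha pi u ->
    exists Phi : B -> multiplier C, [/\ star_hom Phi, nondegenerate Phi,
      forall a, Phi (jA a) = pi a & forall n b, Phi (jZ n b) = u n ** Phi b]
}.

End systems.

(* C is the completion of the algebraic tensor product of A and B for some    *)
(* C*-norm, with t a b the elementary tensor; tensor_inj is the injectivity   *)
(* of the induced map from the algebraic tensor product into C. Below, the    *)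
(* second factor is the algebra of compact operators or the Toeplitz algebra, *)
(* which are nuclear, so that there is exactly one C*-norm.                   *)
Record is_tensor_product (R : realType) (A B C : cstarAlgType R)
    (t : A -> B -> C) : Prop := {
  tensor_linearl : forall b, linear (t^~ b);
  tensor_linearr : forall a, linear (t a);
  tensor_mul : forall a a' b b', t (a ** a') (b ** b') = t a b ** t a' b';
  tensor_star : forall a b, t (star a) (star b) = star (t a b);
  tensor_inj : forall n (a : 'I_n -> A) (b : 'I_n -> B),
    (forall c : 'I_n -> R[i], \sum_i c i *: b i = 0 -> forall i, c i = 0) ->
    \sum_i t (a i) (b i) = 0 -> forall i, a i = 0;
  tensor_dense : closure (lspan [set x | exists a b, x = t a b]) = setT
}.

(* The multiplier m (x) s of B (x) T, for m in M(B) and s in T: the unique    *)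
(* one sending b (x) r to (m b) (x) (s r).                                    *)
Definition tensor_multiplier (R : realType) (B T D : cstarAlgType R)
    (t : B -> T -> D) (m : multiplier B) (s : T) : multiplier D :=
  xget 0 [set x : multiplier D | forall b r, x (t b r) = t (m b) (s ** r)].

(* The closed linear span of the (j_Z(m) (x) T_m)(j_A(a) (x) I)               *)
(* (j_Z(n) (x) T_n)^* in M(B (x) T(Z)), where I = T_0.                        *)
Definition pimsner_voiculescu_set (R : realType) (A B D : cstarAlgType R)
    (jA : A -> B) (jZ : int -> multiplier B) (t : B -> toeplitz R -> D) :
    set (multiplier D) :=
  let T := @toeplitz_isometry R in
  closure (lspan [set x | exists (m n : nat) (a : A),
    x = tensor_multiplier t (jZ m) (T m)
        ** tensor_multiplier t (left_mul (jA a)) (T 0)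
        ** star (tensor_multiplier t (jZ n) (T n))]).

Definition short_exact (R : realType) (E F G : cstarAlgType R)
    (i : E -> F) (q : F -> G) :=
  [/\ star_hom i, star_hom q, injective i, range i = [set x | q x = 0]
    & range q = setT].

(* Main.v *)
(* Let W_n = 1 (x) T_n and U_n = j_Z(n) (x) 1 in M((A x Z) (x) T(Z)), put     *)
(* beta(b) = b (x) 1, C_(m,n)(a) = U_m beta(j_A a) U_n^* and e_0 = 1 -        *)
(* W_1 W_1^*. The algebra T_PV is the closed span of the W_m C_(m,n)(a)       *)
(* W_n^*. As W_(m+1) C W_(n+1)^* = W_m C W_n^* - W_m C e_0 W_n^*, it is       *)
(* spanned modulo the matrix-unit-like elements X_(m,n)(a) = W_m C_(m,n)(a)   *)
(* e_0 W_n^* by the elements S_n U_n beta(j_A a) with n in Z, where S_n is    *)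
(* W_n or W_(-n)^*.                                                           *)
(* Everything then follows from three norm estimates.                         *)
(* (1) The quotient map W_m C W_n^* |-> C is contractive: compress by the     *)
(* almost shift-invariant vectors N^(-1/2) (W_K + ... + W_(K+N-1)) e_0.       *)
(* (2) The map j_Z(n) j_A(a) |-> S_n U_n beta(j_A a) is contractive: the S_n  *)
(* are unitary in the Choi-Effros algebra of the projection x |-> lim W_N^* x *)
(* W_N, to which the universal property of the crossed product therefore      *)
(* applies.                                                                   *)
(* (3) The map a (x) e_(m,n) |-> X_(m,n)(a) is isometric: two equivalent      *)
(* C*-norms on a *-algebra coincide. This needs j_A to be injective, which is *)
(* shown by representing the system on A (x) K by diagonal matrices and a     *)
(* bilateral shift.                                                           *)
(* With these, i and q are the closures of densely defined linear relations,  *)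
(* and exactness is read off from (1) and (2).                                *)
Require Import Defs.
From HB Require Import structures.
From mathcomp Require Import all_boot all_algebra reals.
From mathcomp Require Import all_order complex.
From mathcomp Require Import all_classical all_reals topology normedtype sequences.
From mathcomp Require Import zify ring lra.
Set Implicit Arguments. Unset Strict Implicit. Unset Printing Implicit Defensive.
Import Order.TTheory GRing.Theory Num.Theory.
Import numFieldNormedType.Exports.
Local Open Scope classical_set_scope.
Local Open Scope complex_scope.
Local Open Scope ring_scope.

(** * Norms and spectra *)

(** The monomials [W_m C W_n^*] and [W_(m+1) C W_(n+1)^*] have the same image in the crossed
    product, and their difference [X] is a matrix unit with an entry from [A], carried by the defect
    projection [e0 = 1 - W_1 W_1^*]. Dividing out these differences makes the shift unitary and
    leaves only the degree [m - n], which is the crossed product; the differences themselves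
    multiply like matrices over [A] and span a copy of [A (x) K].

    No map is defined by a formula. Each one starts as the span of a set of pairs (generator,
    image), and a norm inequality between the two coordinates makes its closure the graph of a
    continuous map ([gcl_total], [gcl_uniq]). Three relations occur: [Q] for the quotient map,
    bounded by averaging ([Q_bound]); [T] for a linear lifting of the crossed product, bounded by
    [toeplitz_norm_le]; and [I] for the ideal, isometric by [matrix_system_norm_le] applied in both
    directions. The lifting gives surjectivity and also identifies the kernel: an element with small
    image differs from the lift of that image, which is small too, by an element of the span [J] of
    the [X] ([Q_T]). All this is assembled in [pv_short_exact].

    The analysis behind it rests on self-adjoint elements: their norm is their spectral radius
    ([sa_spectral_radius]), so star-homomorphisms are contractive, and isometric when injective
    ([star_hom_isometric]). Multipliers are built from their values on a dense span
    ([multiplier_exists]), which supplies the operators [1 (x) T_n] and [j_Z(n) (x) 1] from the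
    axioms of a tensor product. The universal property enters as the inequality
    [crossed_product_norm_le], which also yields the injectivity of [jA]
    ([crossed_product_faithful]). *)

Section real_norm_lemmas.
Variable R : realType.

Lemma rnormC (V : normedZmodType R[i]) (x y : V) : rnorm (x - y) = rnorm (y - x).
Proof. by rewrite -rnormN opprB. Qed.

Lemma rnorm_split (V : normedZmodType R[i]) (z x y : V) :
  rnorm (x - y) <= rnorm (x - z) + rnorm (z - y).
Proof. by rewrite -[x - y](subrKA z) rnormD. Qed.

Lemma rnormB_le (V : normedZmodType R[i]) (x y : V) :
  rnorm x <= rnorm y + rnorm (x - y).
Proof. by rewrite -{1}[x](subrK y) addrC rnormD. Qed.

Lemma rnorm_real (a : R) : rnorm (a%:C : R[i]) = `|a|.
Proof. by rewrite /rnorm normc_def /= expr0n /= addr0 sqrtr_sqr. Qed.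

Lemma rnorm1 : rnorm (1 : R[i]) = 1.
Proof. by rewrite -(rmorph1 (real_complex R)) rnorm_real normr1. Qed.

Lemma rnormM (a b : R[i]) : rnorm (a * b) = rnorm a * rnorm b.
Proof. exact: (@rnormZ R R[i]^o). Qed.

Lemma rnormX (a : R[i]) n : rnorm (a ^+ n) = rnorm a ^+ n.
Proof. by elim: n => [|n ih]; rewrite ?expr0 ?rnorm1// !exprS rnormM ih. Qed.

Lemma rnorm_sum (V : normedZmodType R[i]) I (s : seq I) (P : pred I) (F : I -> V) :
  rnorm (\sum_(i <- s | P i) F i) <= \sum_(i <- s | P i) rnorm (F i).
Proof.
elim/big_ind2: _ => // [|x a y b xa yb]; first by rewrite rnorm0.
by rewrite (le_trans (rnormD _ _))// lerD.
Qed.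

Lemma le_eps (x y : R) : (forall e, 0 < e -> x <= y + e) -> x <= y.
Proof. by move=> xy; apply/ler_addgt0Pr. Qed.

(** The constant [C] absorbs the norms of fixed factors, so that identities between limits can be
    proved with an unscaled error [e]. *)
Lemma rnorm_eq_eps (V : normedZmodType R[i]) (x y : V) (C : R) :
  (forall e, 0 < e -> rnorm (x - y) <= C * e) -> x = y.
Proof.
move=> xy; apply/eqP; rewrite -subr_eq0; apply/eqP; apply: rnorm_le0 => e e0.
have C0 : 0 < `|C| + 1 by rewrite ltr_wpDl.
apply: le_trans (xy _ (divr_gt0 e0 C0)) _.
rewrite mulrA ler_pdivrMr// mulrC ler_pM2l//.
by rewrite (le_trans (ler_norm C))// lerDl.
Qed.

Lemma seq_complete (V : completeNormedModType R[i]) (u : nat -> V) :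
  (forall e : R, 0 < e -> exists N, forall n, (N <= n)%N -> rnorm (u N - u n) < e) ->
  exists l, forall e : R, 0 < e -> exists N, forall n, (N <= n)%N -> rnorm (l - u n) <= e.
Proof.
move=> uC; have [|l lP] := @rnorm_cvg R V _ (\oo) u _.
  move=> e /uC[N NP]; exists (u N).
  by exists N => // n /= Nn; exact: NP.
by exists l => e /lP[N _ NP]; exists N => n Nn; exact: NP.
Qed.

Lemma expr_lt_eps (r e : R) : 0 <= r < 1 -> 0 < e -> exists N, forall n, (N <= n)%N -> r ^+ n < e.
Proof.
move=> /andP[r0 r1] e0.
have : r ^+ n @[n --> \oo] --> (0 : R) by apply: cvg_expr; rewrite ger0_norm.
move/cvgrPdist_lt => /(_ e e0)[N _ NP]; exists N => n Nn.
by have := NP n Nn; rewrite sub0r normrN ger0_norm// exprn_ge0.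
Qed.

Lemma inv_lt_eps (C e : R) : 0 < e -> exists N : nat, forall n, (N <= n)%N -> C / n.+1%:R < e.
Proof.
move=> e0; have [N NP] : exists N : nat, C / e < N%:R.
  by exists (Num.truncn (C / e)).+1; exact: real_truncnS_gt (num_real _).
exists N => n Nn; rewrite ltr_pdivrMr ?ltr0n// mulrC -ltr_pdivrMr//.
by apply: lt_le_trans NP _; rewrite ler_nat ltnW.
Qed.

Lemma geo_complete (V : completeNormedModType R[i]) (u : nat -> V) (r C : R) :
  0 <= r < 1 -> (forall n, rnorm (u n.+1 - u n) <= C * r ^+ n) ->
  exists l, forall e : R, 0 < e -> exists N, forall n, (N <= n)%N -> rnorm (l - u n) <= e.
Proof.
move=> r01 uP; have /andP[r0 r1] := r01.
have C0 : 0 <= C.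
  by have := uP 0%N; rewrite expr0 mulr1; apply: le_trans; exact: rnorm_ge0.
have r'0 : 0 < 1 - r by rewrite subr_gt0.
have H n k : rnorm (u n - u (n + k)%N) <= C * r ^+ n * (1 - r ^+ k) / (1 - r).
  elim: k => [|k ih]; first by rewrite addn0 subrr rnorm0 expr0 subrr mulr0 mul0r.
  apply: le_trans (rnorm_split (u (n + k)%N) _ _) _.
  have -> : C * r ^+ n * (1 - r ^+ k.+1) / (1 - r) =
     C * r ^+ n * (1 - r ^+ k) / (1 - r) + C * r ^+ (n + k).
    by rewrite exprD exprS; field; rewrite gt_eqF.
  by rewrite lerD// rnormC addnS.
apply: seq_complete => e e0.
have C1 : 0 < C + 1 by rewrite ltr_wpDl.
have [|N NP] := @expr_lt_eps r (e * (1 - r) / (C + 1)) r01.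
  by rewrite divr_gt0 ?mulr_gt0.
exists N => n Nn; rewrite -(subnKC Nn); apply: le_lt_trans (H _ _) _.
rewrite ltr_pdivrMr//; have := NP N (leqnn _); rewrite ltr_pdivlMr// => NN.
apply: le_lt_trans NN; apply: (@le_trans _ _ (C * r ^+ N)).
  by rewrite ler_piMr ?mulr_ge0 ?exprn_ge0// gerBl exprn_ge0.
by rewrite mulrC ler_wpM2l ?exprn_ge0// lerDl.
Qed.

Lemma rnorm_sq (z : R[i]) : rnorm z ^+ 2 = complex.Re z ^+ 2 + complex.Im z ^+ 2.
Proof. by rewrite /rnorm normr_sqmod sqr_sqrtr ?sqmod_ge0. Qed.

Lemma rnorm_circle_neq0 (mu : R[i]) : rnorm mu = 1 -> mu != 0.
Proof.
move=> m1; apply/eqP => m0.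
by move: m1; rewrite m0 rnorm0 => /esym/eqP; rewrite oner_eq0.
Qed.

Lemma circle_mul_conj (mu : R[i]) : rnorm mu = 1 -> mu * mu^* = 1.
Proof. by move=> m1; rewrite -normCK normr_rnorm m1 expr1n. Qed.

Lemma rnorm_circleV (mu : R[i]) : rnorm mu = 1 -> rnorm mu^-1 = 1.
Proof.
move=> m1; rewrite -[LHS]mul1r -{1}m1 -rnormM divff ?rnorm1//.
exact: rnorm_circle_neq0.
Qed.

Lemma circle_sqrt (nu : R[i]) : rnorm nu = 1 ->
  exists2 mu : R[i], rnorm mu = 1 & mu ^+ 2 = nu.
Proof.
move=> n1; exists (sqrtC nu); last exact: sqrtCK.
apply/eqP; rewrite -(@eqrXn2 _ 2) ?rnorm_ge0// -rnormX sqrtCK n1 expr1n//.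
Qed.

End real_norm_lemmas.

Section cstar_lemmas.
Variables (R : realType) (A : cstarAlgType R).
Implicit Types x y z : A.

Lemma cmulNl x y : (- x) ** y = - (x ** y).
Proof. by rewrite -scaleN1r cmulZl scaleN1r. Qed.
Lemma cmulNr x y : x ** (- y) = - (x ** y).
Proof. by rewrite -scaleN1r cmulZr scaleN1r. Qed.
Lemma cmulBl x y z : (x - y) ** z = x ** z - y ** z.
Proof. by rewrite cmulDl cmulNl. Qed.
Lemma cmulBr x y z : x ** (y - z) = x ** y - x ** z.
Proof. by rewrite cmulDr cmulNr. Qed.
Lemma cmul_suml I (s : seq I) (P : pred I) (F : I -> A) x :
  (\sum_(i <- s | P i) F i) ** x = \sum_(i <- s | P i) F i ** x.
Proof. by elim/big_rec2: _ => [|i a b _ <-]; rewrite ?cmul0r ?cmulDl. Qed.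
Lemma cmul_sumr I (s : seq I) (P : pred I) (F : I -> A) x :
  x ** (\sum_(i <- s | P i) F i) = \sum_(i <- s | P i) x ** F i.
Proof. by elim/big_rec2: _ => [|i a b _ <-]; rewrite ?cmulr0 ?cmulDr. Qed.
Lemma star_sum I (s : seq I) (P : pred I) (F : I -> A) :
  star (\sum_(i <- s | P i) F i) = \sum_(i <- s | P i) star (F i).
Proof. by elim/big_rec2: _ => [|i a b _ <-]; rewrite ?star0 ?starD. Qed.

Lemma rnorm_cstar x : rnorm (star x ** x) = rnorm x ^+ 2.
Proof. by apply: complexI; rewrite rmorphXn/= -!normr_rnorm cstarE. Qed.

Lemma rnorm_cstar' x : rnorm (x ** star x) = rnorm x ^+ 2.
Proof. by rewrite -{1}[x]starK rnorm_cstar rnorm_star. Qed.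

Lemma rnorm_sa_sq (h : A) : star h = h -> rnorm (h ** h) = rnorm h ^+ 2.
Proof. by move=> hh; rewrite -{1}hh rnorm_cstar. Qed.

End cstar_lemmas.

(** * Neumann series, resolvents and the spectral radius of self-adjoint elements *)

Section unital.
Variables (R : realType) (A : cstarAlgType R) (e : A).
Hypotheses (e1l : forall x : A, e ** x = x) (e1r : forall x : A, x ** e = x).
Implicit Types x y z h : A.

Lemma star_unit : star e = e.
Proof. by rewrite -[star e]e1l -{1}[e]starK -starM e1l starK. Qed.

Lemma rnorm_unit_le1 : rnorm e <= 1.
Proof.
have := rnorm_cstar e; rewrite star_unit e1l expr2.
have [->|n0 H] := eqVneq (rnorm e) 0; first by rewrite ler01.
by rewrite -(mulIf n0 (etrans (esym H) (esym (mul1r _)))).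
Qed.

Definition inverse_of x y := x ** y = e /\ y ** x = e.

Lemma inverse_ofC x y : inverse_of x y -> inverse_of y x.
Proof. by case. Qed.

Lemma inverse_of_uniq x y z : inverse_of x y -> inverse_of x z -> y = z.
Proof. by move=> [xy yx] [xz zx]; rewrite -[y]e1r -xz cmulA yx e1l. Qed.

Lemma inverse_ofM x x' y y' : inverse_of x x' -> inverse_of y y' ->
  inverse_of (x ** y) (y' ** x').
Proof.
move=> [xx' x'x] [yy' y'y]; split.
  by rewrite cmulA -(cmulA x) yy' e1r.
by rewrite cmulA -(cmulA y') x'x e1r.
Qed.

Lemma inverse_ofZ (c : R[i]) x y : c != 0 -> inverse_of x y ->
  inverse_of (c *: x) (c^-1 *: y).
Proof.
by move=> c0 [xy yx]; split; rewrite cmulZl cmulZr ?xy ?yx scalerA ?divff ?mulVf// scale1r.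
Qed.

Lemma inverse_of_star x y : inverse_of x y -> inverse_of (star x) (star y).
Proof. by move=> [xy yx]; split; rewrite -starM ?xy ?yx star_unit. Qed.

Lemma inverse_of_unit : inverse_of e e.
Proof. by split; rewrite e1l. Qed.

(** The [u n] are the partial sums of the geometric series; they commute with [x], so their limit
    [l] is a two-sided inverse. The bound is read off from [l = e + x l]. *)
Lemma neumann x : rnorm x < 1 ->
  exists2 y, inverse_of (e - x) y & rnorm y <= (1 - rnorm x)^-1.
Proof.
move=> x1; pose fix u n := if n is n.+1 then e + x ** u n else 0 : A.
have uC n : u n ** x = x ** u n.
  by elim: n => [|n ih] /=; rewrite ?cmul0r ?cmulr0// cmulDl cmulDr e1l e1r -cmulA ih.
have uS n : u n.+1 = e + u n ** x by rewrite uC.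
have [||l lP] := @geo_complete R A u (rnorm x) (rnorm e).
- by rewrite rnorm_ge0.
- elim=> [|n ih]; first by rewrite /= cmulr0 addr0 subr0 expr0 mulr1.
  have -> : u n.+2 - u n.+1 = x ** (u n.+1 - u n).
    by rewrite cmulBr /= opprD addrACA subrr add0r.
  rewrite (le_trans (rnorm_cmul _ _))// exprS mulrCA ler_wpM2l ?rnorm_ge0//.
have xl : l - x ** l = e.
  apply: (@rnorm_eq_eps _ _ _ _ (1 + rnorm x)) => d d0.
  have [N NP] := lP d d0.
  have -> : l - x ** l - e = (l - u N.+1) - x ** (l - u N).
    by rewrite cmulBr /= opprD opprB -!addrA addKr [- e + _]addrC.
  rewrite (le_trans (rnormD _ _))// rnormN mulrDl mul1r lerD ?NP ?leqnSn//.
  by rewrite (le_trans (rnorm_cmul _ _))// ler_wpM2l ?rnorm_ge0 ?NP.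
have lx : l - l ** x = e.
  apply: (@rnorm_eq_eps _ _ _ _ (1 + rnorm x)) => d d0.
  have [N NP] := lP d d0.
  have -> : l - l ** x - e = (l - u N.+1) - (l - u N) ** x.
    by rewrite cmulBl uS opprD opprB -!addrA addKr [- e + _]addrC.
  rewrite (le_trans (rnormD _ _))// rnormN mulrDl mul1r lerD ?NP ?leqnSn//.
  by rewrite (le_trans (rnorm_cmul _ _))// mulrC ler_wpM2l ?rnorm_ge0 ?NP.
exists l; first by split; rewrite ?cmulBl ?cmulBr ?e1l ?e1r.
rewrite -div1r ler_pdivlMr ?subr_gt0// mulrBr mulr1 lerBlDr.
have lE : l = e + x ** l by rewrite -xl subrK.
rewrite {1}lE (le_trans (rnormD _ _))// lerD ?rnorm_unit_le1//.
by rewrite mulrC rnorm_cmul.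
Qed.

(** Factor [x - z = x (e - y z)]. The bound is stated through [C] instead of [rnorm y] so that it is
    uniform over a family of inverses. *)
Lemma inverse_perturb x y z (C : R) : inverse_of x y -> rnorm y <= C ->
  C * rnorm z < 1 ->
  exists2 w, inverse_of (x - z) w & rnorm w <= C / (1 - C * rnorm z).
Proof.
move=> xy yC Cz.
have yz : rnorm (y ** z) <= C * rnorm z.
  by rewrite (le_trans (rnorm_cmul _ _))// ler_wpM2r ?rnorm_ge0.
have [w wP wn] := neumann (le_lt_trans yz Cz).
exists (w ** y).
  have -> : x - z = x ** (e - y ** z) by rewrite cmulBr e1r cmulA (proj1 xy) e1l.
  exact: inverse_ofM.
rewrite (le_trans (rnorm_cmul _ _))// mulrC ler_pM ?rnorm_ge0//.
by rewrite (le_trans wn)// lef_pV2 ?posrE ?subr_gt0 ?lerD2l ?lerN2// (le_lt_trans yz).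
Qed.

(* With [k = h - Re l] and [m] real, [l - h] is a perturbation of             *)
(* [i (Im l + m)] by [k + i m], of norm at most [sqrt (|k|^2 + m^2)].         *)
Lemma sa_resolvent_pos h (a b : R) : star h = h -> 0 < b ->
  exists2 y, inverse_of ((a +i* b) *: e - h) y & rnorm y <= 2 / b.
Proof.
move=> hh b0; have [k kk hk] : exists2 k, star k = k & h = k + a%:C *: e.
  exists (h - a%:C *: e); last by rewrite subrK.
  rewrite starB hh starZ star_unit; congr (_ - _ *: _).
  by apply/eqP; rewrite eq_complex /= oppr0 !eqxx.
pose m := (rnorm k) ^+ 2 / b.
have m0 : 0 <= m by rewrite divr_ge0 ?exprn_ge0 ?rnorm_ge0// ltW.
pose im : R[i] := 0 +i* m.
have kim : rnorm (k + im *: e) <= m + b / 2.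
  rewrite -(@ler_pXn2r _ 2) ?nnegrE ?rnorm_ge0//; last by rewrite addr_ge0// divr_ge0// ltW.
  rewrite -rnorm_cstar starD kk starZ star_unit.
  have -> : (k + im^* *: e) ** (k + im *: e) = k ** k + (m ^+ 2)%:C *: e.
    rewrite cmulDl !cmulDr !(cmulZl, cmulZr) e1l e1r e1l -!addrA; congr (_ + _).
    rewrite addrA -scalerDl scalerA.
    rewrite [X in X *: k](_ : _ = 0) ?scale0r ?add0r//.
      congr (_ *: e).
      apply/eqP; rewrite eq_complex /=; apply/andP; split; apply/eqP; ring.
    by apply/eqP; rewrite eq_complex /= ?addr0 ?addrN !eqxx.
  rewrite (le_trans (rnormD _ _))// rnorm_sa_sq// rnormZ rnorm_real ger0_norm ?sqr_ge0//.
  have -> : rnorm k ^+ 2 = m * b by rewrite /m divfK// gt_eqF.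
  apply: (@le_trans _ _ (m * b + m ^+ 2)).
    by rewrite lerD2l ler_piMr ?sqr_ge0 ?rnorm_unit_le1.
  have := sqr_ge0 b; nra.
have bm0 : 0 < b + m by rewrite ltr_wpDr.
have bmi : rnorm (0 +i* (b + m) : R[i]) = b + m.
  by rewrite /rnorm normc_def /= expr0n /= add0r sqrtr_sqr ger0_norm// ltW.
have bm_neq0 : (0 +i* (b + m) : R[i]) != 0.
  by rewrite eq_complex /= negb_and (gt_eqF bm0) orbT.
have iP := inverse_ofZ bm_neq0 inverse_of_unit.
have iN : rnorm ((0 +i* (b + m) : R[i])^-1 *: e) <= (b + m)^-1.
  rewrite rnormZ -[leRHS]mulr1 ler_pM ?rnorm_ge0 ?rnorm_unit_le1//.
  have : rnorm (0 +i* (b + m) : R[i]) * rnorm (0 +i* (b + m) : R[i])^-1 = 1.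
    by rewrite -rnormM divff ?rnorm1.
  by rewrite bmi => /(canRL (mulKf (negbT (gt_eqF bm0)))) ->; rewrite mulr1.
have small : (b + m)^-1 * rnorm (k + im *: e) < 1.
  by rewrite mulrC ltr_pdivrMr// mul1r (le_lt_trans kim)//; lra.
have [w wP wn] := inverse_perturb iP iN small; exists w.
  have -> : (a +i* b) *: e - h = (0 +i* (b + m)) *: e - (k + im *: e) => //.
  rewrite hk !opprD addrCA [RHS]addrCA; congr (_ + _).
  rewrite -!scaleNr -!scalerDl; congr (_ *: e).
  by rewrite /im; apply/eqP; rewrite eq_complex /=; apply/andP; split; apply/eqP; ring.
apply: le_trans wn _; rewrite -[leLHS]mul1r mulrA mul1r -invfM mulrBr mulr1.
rewrite mulrA divff ?gt_eqF// mul1r -[2 / b]invf_div lef_pV2 ?posrE ?divr_gt0//; first by lra.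
by rewrite subr_gt0 (le_lt_trans kim)//; lra.
Qed.

Lemma sa_resolvent h (l : R[i]) : star h = h -> complex.Im l != 0 ->
  exists2 y, inverse_of (l *: e - h) y & rnorm y <= 2 / `|complex.Im l|.
Proof.
case: l => a b hh /= b0; have [bp|bn] := ltP 0 b.
  by have := sa_resolvent_pos a hh bp; rewrite gtr0_norm.
have {}bn : 0 < - b by rewrite oppr_gt0 lt_def bn eq_sym b0.
have [y yP yn] := sa_resolvent_pos a hh bn; exists (star y); last first.
  by rewrite rnorm_star -normrN gtr0_norm.
have := inverse_of_star yP; rewrite starB hh starZ star_unit.
by rewrite (_ : (_ +i* _)^* = a +i* b)//; apply/eqP; rewrite eq_complex /= opprK !eqxx.
Qed.

(** Close to [1] or [-1] the given inverses are perturbed; elsewhere on the circle the imaginary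
    part of [mu] is bounded below and [sa_resolvent] applies. Uniformity is thus obtained by
    explicit estimates instead of compactness. *)
Lemma sa_circle_resolvent g : star g = g -> rnorm g <= 1 ->
  (exists y, inverse_of (e - g) y) -> (exists y, inverse_of (e + g) y) ->
  exists2 C : R, 1 <= C & forall mu : R[i], rnorm mu = 1 ->
    exists2 y, inverse_of (e - mu *: g) y & rnorm y <= C.
Proof.
move=> gg g1 [y1 y1P] [y2 y2P].
pose C0 := 1 + rnorm y1 + rnorm y2.
have C01 : 1 <= C0 by rewrite /C0 -addrA lerDl addr_ge0 ?rnorm_ge0.
have C0p : 0 < C0 by rewrite (lt_le_trans ltr01).
have y1C : rnorm y1 <= C0 by have := rnorm_ge0 y2; rewrite /C0; lra.
have y2C : rnorm y2 <= C0 by have := rnorm_ge0 y1; rewrite /C0; lra.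
exists (16 * C0 ^+ 2); first by nra.
move=> mu mu1; have mu0 := rnorm_circle_neq0 mu1.
have muq := rnorm_sq mu; rewrite mu1 expr1n in muq.
have near (y : A) (s : R[i]) : inverse_of (e - s *: g) y -> rnorm y <= C0 ->
    C0 * rnorm (mu - s) <= 1 / 2 ->
    exists2 y, inverse_of (e - mu *: g) y & rnorm y <= 16 * C0 ^+ 2.
  move=> yP yC mus.
  have ms : C0 * rnorm ((mu - s) *: g) <= 1 / 2.
    apply: le_trans mus; rewrite ler_pM2l// rnormZ.
    by rewrite ler_piMr ?rnorm_ge0.
  have [|w wP wn] := inverse_perturb yP yC (z := (mu - s) *: g).
    by apply: le_lt_trans ms _; lra.
  exists w; first by move: wP; rewrite scalerBl opprB addrA subrK.
  apply: le_trans wn _; rewrite ler_pdivrMr; last by lra.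
  by nra.
have [n1|f1] := lerP (C0 * rnorm (mu - 1)) (1 / 2).
  by apply: (near y1 1) => //; rewrite scale1r.
have [n2|f2] := lerP (C0 * rnorm (mu + 1)) (1 / 2).
  by apply: (near y2 (-1)); rewrite ?scaleN1r ?opprK.
(* On the circle [|mu - 1| |mu + 1| = |mu^2 - 1| = 2 |Im mu|], and here both factors exceed
   [1 / (2 C0)]. *)
have im : 1 / (8 * C0 ^+ 2) <= `|complex.Im mu|.
  have E : rnorm (mu - 1) * rnorm (mu + 1) = 2 * `|complex.Im mu|.
    rewrite -rnormM; have -> : (mu - 1) * (mu + 1) = mu * (0 +i* (2 * complex.Im mu)).
      move: muq; case: mu {mu1 mu0 near f1 f2} => a b /= ab.
      by apply/eqP; rewrite eq_complex /=; apply/andP; split; apply/eqP;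
        move: ab; rewrite !expr2 => ab; nra.
    rewrite rnormM mu1 mul1r /rnorm normc_def /= expr0n /= add0r sqrtr_sqr normrM.
    by rewrite ger0_norm.
  rewrite ler_pdivrMr ?mulr_gt0 ?exprn_gt0//.
  have : 1 / 2 * (1 / 2) <= C0 * rnorm (mu - 1) * (C0 * rnorm (mu + 1)).
    by rewrite ler_pM ?divr_ge0// ltW.
  by rewrite [X in _ <= X]mulrACA E -expr2; lra.
have imp : 0 < `|complex.Im mu|.
  by apply: lt_le_trans im; rewrite divr_gt0 ?mulr_gt0 ?exprn_gt0.
have imc : complex.Im (mu^*) = - complex.Im mu by case: (mu).
(* Since [mu^* = mu^-1], one has [e - mu g = mu (mu^* e - g)]. *)
have [|w wP wn] := @sa_resolvent g (mu^*) gg.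
  by rewrite imc oppr_eq0 -normr_gt0.
exists (mu^-1 *: w).
  have := inverse_ofZ mu0 wP; rewrite scalerBr scalerA.
  by rewrite circle_mul_conj// scale1r.
rewrite rnormZ rnorm_circleV// mul1r; apply: le_trans wn _.
rewrite imc normrN ler_pdivrMr//.
move: im; rewrite ler_pdivrMr ?mulr_gt0 ?exprn_gt0//; lra.
Qed.

(** This closeness, uniform over the circle, survives the passage from [(t, g)] to [(t^2, g^2)] with
    the same [eps]. It plays the part that analyticity of the resolvent plays in the usual proof of
    the spectral radius formula. *)
Definition close_resolvents (t eps : R) g := forall mu : R[i], rnorm mu = 1 ->
  exists x y, [/\ inverse_of (e - mu *: g) x, inverse_of (e - (t%:C * mu) *: g) y
    & rnorm (x - y) <= eps].

(** By the resolvent identity, [x - y = x ((e - t mu g) - (e - mu g)) y], where [|x| <= C] and, by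
    perturbation, [|y| <= 2 C]. *)
Lemma close_resolvents_circle g (C t : R) : rnorm g <= 1 -> 1 <= C ->
  (forall mu : R[i], rnorm mu = 1 ->
    exists2 y, inverse_of (e - mu *: g) y & rnorm y <= C) ->
  0 <= t <= 1 -> C * (1 - t) <= 1 / 2 ->
  close_resolvents t (2 * C ^+ 2 * (1 - t)) g.
Proof.
move=> g1 C1 HC /andP[t0 t1] Ct mu mu1; have [x xP xn] := HC mu mu1.
pose z := ((t%:C - 1) * mu) *: g.
have zn : rnorm z <= 1 - t.
  rewrite rnormZ rnormM mu1 mulr1 -(rmorph1 (real_complex R)) -rmorphB /=.
  rewrite rnorm_real distrC ger0_norm ?subr_ge0//.
  by rewrite ler_piMr ?subr_ge0.
have C0 : 0 <= C by rewrite (le_trans ler01).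
have Cz : C * rnorm z <= 1 / 2 by rewrite (le_trans _ Ct)// ler_wpM2l.
have [|y yP yn] := inverse_perturb xP xn (z := z); first by lra.
have zE : e - mu *: g - z = e - (t%:C * mu) *: g.
  by rewrite /z mulrBl mul1r scalerBl opprB addrA subrK.
rewrite zE in yP; exists x, y; split=> //.
have -> : x - y = x ** (- z) ** y.
  have -> : - z = e - (t%:C * mu) *: g - (e - mu *: g).
    by rewrite -zE addrAC subrr sub0r.
  by rewrite cmulBr cmulBl (proj2 xP) -cmulA (proj1 yP) e1l e1r.
rewrite (le_trans (rnorm_cmul _ _))//.
have y2C : rnorm y <= 2 * C.
  by rewrite (le_trans yn)// ler_pdivrMr; [nra|lra].
have xz : rnorm (x ** - z) <= C * (1 - t).
  by rewrite (le_trans (rnorm_cmul _ _))// rnormN ler_pM ?rnorm_ge0.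
rewrite (@le_trans _ _ (C * (1 - t) * (2 * C)))//; last by nra.
by rewrite ler_pM ?rnorm_ge0.
Qed.

Lemma inverse_of_sq_avg x y h : inverse_of (e - h) x -> inverse_of (e + h) y ->
  inverse_of (e - h ** h) (2^-1 *: (x + y)).
Proof.
move=> [hx xh] [hy yh].
have two : (2^-1 : R[i]) *: (e + e) = e.
  by rewrite scalerDr -scalerDl (_ : _ + _ = 1) ?scale1r// -[2^-1]mul1r -splitr.
have E1 : e - h ** h = (e + h) ** (e - h).
  by rewrite cmulBr !cmulDl !e1l !e1r opprD addrA addrK.
have E2 : e - h ** h = (e - h) ** (e + h).
  by rewrite cmulDr !cmulBl !e1l !e1r addrA subrK.
split.
  rewrite cmulZr cmulDr {1}E1 E2 -!cmulA hx hy !e1r.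
  by rewrite addrACA ?(subrr, addNr) addr0 two.
rewrite cmulZl cmulDl {1}E2 E1 !cmulA xh yh !e1l.
by rewrite addrACA ?(subrr, addNr) addr0 two.
Qed.

(* [2 (1 - mu^2 g^2)^-1 = (1 - mu g)^-1 + (1 + mu g)^-1], so averaging over   *)
(* the two square roots keeps the bound [eps].                                *)
Lemma close_resolvents_sq t eps g :
  close_resolvents t eps g -> close_resolvents (t ^+ 2) eps (g ** g).
Proof.
move=> cg nu /circle_sqrt[mu mu1 <-].
have [x [y [xP yP xy]]] := cg mu mu1.
have [|x' [y' [xP' yP' xy']]] := cg (- mu); first by rewrite rnormN.
exists (2^-1 *: (x + x')), (2^-1 *: (y + y')); split.
- have -> : mu ^+ 2 *: (g ** g) = (mu *: g) ** (mu *: g).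
    by rewrite cmulZl cmulZr scalerA.
  by apply: inverse_of_sq_avg => //; move: xP'; rewrite scaleNr opprK.
- have -> : ((t ^+ 2)%:C * mu ^+ 2) *: (g ** g) =
      ((t%:C * mu) *: g) ** ((t%:C * mu) *: g).
    by rewrite cmulZl cmulZr scalerA rmorphXn /= -exprMn.
  by apply: inverse_of_sq_avg => //; move: yP'; rewrite mulrN scaleNr opprK.
- rewrite -scalerBr opprD addrACA rnormZ.
  have -> : rnorm (2^-1 : R[i]) = 2^-1.
    have -> : (2^-1 : R[i]) = (2^-1 : R)%:C by rewrite fmorphV /= rmorph_nat.
    by rewrite rnorm_real ger0_norm// invr_ge0 ler0n.
  by have := rnormD (x - y) (x' - y'); lra.
Qed.

Definition cpow h n := iter n (cmul h) e.

(** Put [G = g^(2^N)]; it still has norm [1], by the C*-identity. Repeated squaring keeps the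
    inverses of [e - G] and of [e - s G] within [1 / 8] of each other, while [s = t^(2^N)] becomes
    tiny. So the inverse of [e - s G] is close to [e], hence so is that of [e - G], which forces
    [|G| <= 1 / 2]. *)
Lemma sa_resolvent_norm1 g : star g = g -> rnorm g = 1 ->
  (exists y, inverse_of (e - g) y) -> (exists y, inverse_of (e + g) y) -> False.
Proof.
move=> gg g1 i1 i2.
have [|C C1 HC] := sa_circle_resolvent gg _ i1 i2; first by rewrite g1.
have C0 : 0 < C by rewrite (lt_le_trans ltr01).
(* Chosen so that the distance [2 C^2 d] between the resolvents is [1 / 8]. *)
pose d := (16 * C ^+ 2)^-1.
have d0 : 0 < d by rewrite invr_gt0 mulr_gt0// exprn_gt0.
have dC : 16 * C ^+ 2 * d = 1 by rewrite divff// gt_eqF// mulr_gt0// exprn_gt0.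
have d1 : d <= 1 by nra.
pose t := 1 - d.
have t01 : 0 <= t <= 1 by rewrite /t subr_ge0 d1 /= gerBl ltW.
have tE : 1 - t = d by rewrite /t opprB addrC subrK.
have cr0 : close_resolvents t (2 * C ^+ 2 * d) g.
  rewrite -tE; apply: close_resolvents_circle => //; first by rewrite g1.
  by rewrite tE; nra.
pose fix G n := if n is n.+1 then G n ** G n else g.
have Gsa n : star (G n) = G n by elim: n => //= n ih; rewrite starM ih.
have G1 n : rnorm (G n) = 1.
  by elim: n => //= n ih; rewrite rnorm_sa_sq// ih expr1n.
have cr n : close_resolvents (t ^+ (2 ^ n)%N) (1 / 8) (G n).
  elim: n => [|n ih].
    move=> mu /cr0[x [y [xP yP xy]]]; exists x, y; split=> //.
    by apply: le_trans xy _; move: dC; lra.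
  by rewrite expnSr exprM; exact: close_resolvents_sq.
have [||N NP] := @expr_lt_eps R t (1 / 8); rewrite ?divr_gt0//.
  by rewrite (proj1 (andP t01)) /t gtrBl.
pose s := t ^+ (2 ^ N)%N.
have s8 : s < 1 / 8 by apply: NP; exact: ltnW (ltn_expl _ _).
have s0 : 0 <= s by rewrite exprn_ge0//; case/andP: t01.
have [x [y [xP yP xy]]] := cr N 1 (rnorm1 R).
rewrite mulr1 scale1r in xP yP; rewrite -/s in yP.
have sG : rnorm (s%:C *: G N) <= 1 / 8.
  by rewrite rnormZ G1 mulr1 rnorm_real ger0_norm// ltW.
have [|y' yP' yn'] := @neumann (s%:C *: G N); first by apply: le_lt_trans sG _; lra.
have {yP' yn'} yn : rnorm y <= 8 / 7.
  rewrite -(inverse_of_uniq yP' yP) (le_trans yn')//.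
  by rewrite -[8 / 7]invf_div lef_pV2 ?posrE//; lra.
have ye : rnorm (y - e) <= 1 / 7.
  have -> : y - e = (s%:C *: G N) ** y.
    by rewrite -{1}(proj1 yP) cmulBl e1l opprB addrC subrK.
  by rewrite (le_trans (rnorm_cmul _ _))//; have := rnorm_ge0 y;
    have := rnorm_ge0 (s%:C *: G N); nra.
have ex : rnorm (e - x) <= 1 / 3.
  by have := rnorm_split y e x; rewrite (rnormC y x) (rnormC e y); lra.
have [|w] := @neumann (e - x); first by lra.
rewrite opprB addrC subrK => /inverse_ofC wP wn.
have eqw := inverse_of_uniq (inverse_ofC wP) (inverse_ofC xP).
have wn' : rnorm w <= 3 / 2.
  by rewrite (le_trans wn)// -[3 / 2]invf_div lef_pV2 ?posrE//; lra.
have : rnorm (G N) <= 1 / 2.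
  have -> : G N = (x - e) ** w.
    by rewrite cmulBl e1l (proj2 wP) eqw opprB addrC subrK.
  rewrite (le_trans (rnorm_cmul _ _))// rnormC.
  by have := rnorm_ge0 w; have := rnorm_ge0 (e - x); nra.
by rewrite G1; lra.
Qed.

(** If [M < rnorm h], scale [h] to norm [1]: invertibility at the two points [rnorm h] and
    [- rnorm h] already contradicts [sa_resolvent_norm1]. Only real points have to be examined. *)
Lemma sa_spectral_radius h (M : R) : star h = h -> 0 <= M ->
  (forall t : R, M < `|t| -> exists y, inverse_of (t%:C *: e - h) y) ->
  rnorm h <= M.
Proof.
move=> hh M0 HM; rewrite leNgt; apply/negP => Mh.
have h0 : 0 < rnorm h by rewrite (le_lt_trans M0).
pose c : R[i] := ((rnorm h)^-1)%:C.
have c0 : c != 0 by rewrite /c fmorph_eq0 invr_eq0 gt_eqF.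
have cE : c^-1 = (rnorm h)%:C by rewrite /c fmorphV invrK.
have inv (s : R) : `|s| = 1 -> exists y, inverse_of (s%:C *: e - c *: h) y.
  move=> s1; have [|y yP] := HM (rnorm h * s).
    by rewrite normrM s1 mulr1 ger0_norm// ltW.
  exists (c^-1 *: y); have := inverse_ofZ c0 yP.
  by rewrite scalerBr scalerA rmorphM /= mulrA -cE divff// mul1r.
apply: (@sa_resolvent_norm1 (c *: h)).
- rewrite starZ hh; congr (_ *: h).
  by apply/eqP; rewrite eq_complex /= oppr0 !eqxx.
- by rewrite rnormZ rnorm_real ger0_norm ?invr_ge0 ?(ltW h0)// mulVf// gt_eqF.
- by have := inv 1; rewrite normr1 scale1r; exact.
- have [|y yP] := inv (-1); first by rewrite normrN1.
  exists (- y); move: yP; rewrite rmorphN1 scaleN1r => -[yl yr].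
  rewrite -opprD in yl yr.
  by split; [rewrite cmulNr -cmulNl|rewrite cmulNl -cmulNr].
Qed.

End unital.

(** * Polynomial calculus of a self-adjoint element *)

Section polynomial_calculus.
Variables (R : realType) (A : cstarAlgType R) (e : A).
Hypotheses (e1l : forall x : A, e ** x = x) (e1r : forall x : A, x ** e = x).
Implicit Types (x y h : A) (p q : {poly R[i]}).

Definition ceval h p : A := \sum_(i < size p) p`_i *: cpow e h i.

Lemma cevalE h p n : (size p <= n)%N -> ceval h p = \sum_(i < n) p`_i *: cpow e h i.
Proof.
move=> pn; rewrite /ceval (big_ord_widen n (fun i => p`_i *: cpow e h i))//.
rewrite big_mkcond; apply: eq_bigr => i _.
by case: ltnP => // ip; rewrite nth_default// scale0r.
Qed.

Lemma cevalD h p q : ceval h (p + q) = ceval h p + ceval h q.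
Proof.
rewrite !(@cevalE h _ (maxn (size p) (size q))) ?leq_maxl ?leq_maxr//.
  by rewrite -big_split; apply: eq_bigr => i _; rewrite coefD scalerDl.
exact: size_polyD.
Qed.

Lemma cevalZ h c p : ceval h (c *: p) = c *: ceval h p.
Proof.
rewrite !(@cevalE h _ (size p)) ?size_scale_leq// scaler_sumr.
by apply: eq_bigr => i _; rewrite coefZ scalerA.
Qed.

Lemma ceval0 h : ceval h 0 = 0.
Proof. by rewrite /ceval size_poly0 big_ord0. Qed.

Lemma cevalN h p : ceval h (- p) = - ceval h p.
Proof. by rewrite -scaleN1r cevalZ scaleN1r. Qed.

Lemma cevalB h p q : ceval h (p - q) = ceval h p - ceval h q.
Proof. by rewrite cevalD cevalN. Qed.

Lemma cevalC h c : ceval h c%:P = c *: e.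
Proof. by rewrite (@cevalE h _ 1) ?size_polyC_leq1// big_ord1 coefC. Qed.

Lemma ceval_mulX h p : ceval h ('X * p) = h ** ceval h p.
Proof.
rewrite (@cevalE h _ (size p).+1); last first.
  by rewrite (leq_trans (size_polyMleq _ _))// size_polyX.
rewrite big_ord_recl coefXM eqxx scale0r add0r cmul_sumr.
by apply: eq_bigr => i _; rewrite coefXM /= cmulZr.
Qed.

Lemma cevalX h : ceval h 'X = h.
Proof. by rewrite -['X]mulr1 ceval_mulX cevalC scale1r e1r. Qed.

Lemma cevalM h p q : ceval h (p * q) = ceval h p ** ceval h q.
Proof.
elim/poly_ind: p q => [|p c ih] q; first by rewrite mul0r ceval0 cmul0r.
rewrite mulrDl -mulrA mul_polyC !cevalD ih cevalZ ceval_mulX cmulDl cevalC.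
by rewrite cmulZl e1l cmulA ih cevalX.
Qed.

Lemma cevalXn h n : ceval h ('X^n) = cpow e h n.
Proof. by elim: n => [|n ih]; rewrite ?expr0 ?cevalC ?scale1r// exprS ceval_mulX ih. Qed.

Lemma star_cpow h n : star h = h -> star (cpow e h n) = cpow e h n.
Proof.
move=> hh; elim: n => [|n ih] /=; first exact: star_unit.
rewrite starM ih hh; elim: n {ih} => [|n ih] /=; first by rewrite e1l e1r.
by rewrite -cmulA ih.
Qed.

Lemma star_ceval h (p : {poly R}) : star h = h ->
  star (ceval h (map_poly (real_complex R) p)) = ceval h (map_poly (real_complex R) p).
Proof.
move=> hh; rewrite star_sum; apply: eq_bigr => i _.
rewrite starZ star_cpow// coef_map /=; congr (_ *: _).
by apply/eqP; rewrite eq_complex /= oppr0 !eqxx.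
Qed.

(** Spectral mapping: for [|t| > M] factor [t - p] over the complex numbers. At a non-real root [z],
    [z - h] is invertible by [sa_resolvent]; a real root satisfies [p(z) = t], hence
    [|z| > r >= |h|], and the Neumann series applies. So [t - p(h)] is invertible and
    [sa_spectral_radius] concludes. *)
Lemma sa_poly_norm h (p : {poly R}) (r M : R) : star h = h -> rnorm h <= r ->
  (forall t, `|t| <= r -> `|p.[t]| <= M) ->
  rnorm (ceval h (map_poly (real_complex R) p)) <= M.
Proof.
move=> hh hr pM; have r0 : 0 <= r := le_trans (rnorm_ge0 _) hr.
have M0 : 0 <= M by apply: le_trans (pM 0 _); rewrite ?normr0.
apply: (sa_spectral_radius e1l e1r) => //; first exact: star_ceval.
move=> t Mt; pose q := (t%:C)%:P - map_poly (real_complex R) p.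
have qE (x : R) : q.[x%:C] = (t - p.[x])%:C.
  by rewrite !hornerE horner_map /= rmorphB.
have -> : t%:C *: e - ceval h (map_poly (real_complex R) p) = ceval h q.
  by rewrite cevalB cevalC.
have q0 : q != 0.
  apply/eqP => q0; have := qE 0; rewrite q0 horner0 => -[] /esym/eqP.
  by rewrite subr_eq0 => /eqP tp; move: Mt; rewrite tp ltNge pM// normr0.
have [rs qrs] := closed_field_poly_normal q.
have lc0 : lead_coef q != 0 by rewrite lead_coef_eq0.
have rsP z : z \in rs -> q.[z] = 0.
  move=> zrs; apply/eqP; change (root q z); rewrite qrs rootZ// root_prod_XsubC//.
have inv z : z \in rs -> exists y, inverse_of e (ceval h ('X - z%:P)) y.
  move=> /rsP qz; rewrite cevalB cevalX cevalC.
  suff [y yP] : exists y, inverse_of e (z *: e - h) y.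
    exists (- y); rewrite -opprB; case: yP => yl yr.
    by split; rewrite cmulNl cmulNr opprK.
  have [z0|z0] := eqVneq (complex.Im z) 0; last first.
    by have [y] := sa_resolvent e1l e1r hh z0; exists y.
  have zE : z = (complex.Re z)%:C by move: z0; case: (z) => a b /= ->.
  move: qz; rewrite zE qE => -[] /eqP; rewrite subr_eq0 => /eqP tp.
  set x := complex.Re z in tp *.
  have hx : rnorm h < `|x|.
    apply: le_lt_trans hr _; rewrite ltNge; apply/negP => /pM.
    by rewrite -tp leNgt Mt.
  have x0 : 0 < `|x| := le_lt_trans (rnorm_ge0 _) hx.
  have xc0 : x%:C != 0 :> R[i] by rewrite fmorph_eq0 -normr_gt0.
  have [|y yP _] := @neumann _ _ _ e1l e1r ((x%:C)^-1 *: h).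
    rewrite rnormZ -fmorphV rnorm_real normfV mulrC ltr_pdivrMr// mul1r//.
  exists ((x%:C)^-1 *: y); have := inverse_ofZ xc0 yP.
  by rewrite scalerBr scalerA divff// scale1r.
rewrite qrs cevalZ.
suff [y yP] : exists y, inverse_of e (ceval h (\prod_(z <- rs) ('X - z%:P))) y.
  by exists ((lead_coef q)^-1 *: y); exact: inverse_ofZ.
elim: rs {qrs rsP} inv => [|z rs ih] inv.
  by exists e; rewrite big_nil cevalC scale1r; split; rewrite e1l.
have [|y yP] := ih; first by move=> w wrs; apply: inv; rewrite inE wrs orbT.
have [|w wP] := inv z; first by rewrite inE eqxx.
by exists (y ** w); rewrite big_cons cevalM; exact: inverse_ofM.
Qed.

End polynomial_calculus.

(** * Multipliers and star-homomorphisms *)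

Section multiplier_lemmas.
Variables (R : realType) (E : completeNormedModType R[i]) (P : normedModType R[i]).
Variable (I : inner_product E P).
Implicit Types T : adjop I.

Lemma opD T x y : T (x + y) = T x + T y.
Proof. by have := op_linear T 1 x y; rewrite !scale1r. Qed.
Lemma op0 T : T 0 = 0.
Proof. by have := op_linear T (-1) 0 0; rewrite !scaleN1r oppr0 addr0 addNr. Qed.
Lemma opZ T c x : T (c *: x) = c *: T x.
Proof. by have := op_linear T c x 0; rewrite op0 !addr0. Qed.
Lemma opB T x y : T (x - y) = T x - T y.
Proof. by rewrite opD -[- y]scaleN1r opZ scaleN1r. Qed.

Lemma op_onel T : op_one I ** T = T. Proof. exact: adjop_eqP. Qed.
Lemma op_oner T : T ** op_one I = T. Proof. exact: adjop_eqP. Qed.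

End multiplier_lemmas.

Section left_multiplication.
Variables (R : realType) (A : cstarAlgType R).
Implicit Types (a b x y : A) (T : multiplier A).

(** Adjointability forces linearity over right multiplication: move [T] to the other side of the
    inner product and use associativity. *)
Lemma op_mulr T a x : T (a ** x) = T a ** x.
Proof.
apply: (@ip_ext _ _ _ (cstar_ip A)) => z.
by rewrite -op_adjE /= !cmulA; congr (_ ** x); exact: (op_adjE T z a).
Qed.

Lemma mul_left_mul T a : T ** left_mul a = left_mul (T a).
Proof. by apply: adjop_eqP => x /=; rewrite op_mulr. Qed.

Lemma left_mulD a b : left_mul (a + b) = left_mul a + left_mul b.
Proof. by apply: adjop_eqP => x /=; rewrite cmulDl. Qed.
Lemma left_mulZ c a : left_mul (c *: a) = c *: left_mul a.
Proof. by apply: adjop_eqP => x /=; rewrite cmulZl. Qed.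
Lemma left_mulM a b : left_mul (a ** b) = left_mul a ** left_mul b.
Proof. by apply: adjop_eqP => x /=; rewrite cmulA. Qed.
Lemma left_mul_star a : left_mul (star a) = star (left_mul a).
Proof. exact: adjop_eqP. Qed.
Lemma left_mulB a b : left_mul (a - b) = left_mul a - left_mul b.
Proof. by rewrite left_mulD -scaleN1r left_mulZ scaleN1r. Qed.

Lemma left_mul_star_hom : star_hom (@left_mul R A).
Proof.
split=> [c x y|x y|x]; last exact: left_mul_star.
  by rewrite left_mulD left_mulZ.
exact: left_mulM.
Qed.

Lemma rnorm_left_mul a : rnorm (left_mul a) = rnorm a.
Proof.
apply/eqP; rewrite eq_le; apply/andP; split.
  by rewrite op_rnormE; apply: opnorm_le (rnorm_ge0 _) _; exact: left_mul_bounded.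
have [->|a0] := eqVneq (rnorm a) 0; first exact: rnorm_ge0.
have {}a0 : 0 < rnorm a by rewrite lt_def a0 rnorm_ge0.
rewrite -(ler_pM2r a0) -expr2 -rnorm_cstar' -(rnorm_star a).
by have := op_le (left_mul a) (star a); rewrite op_rnormE.
Qed.

Lemma left_mul_inj : injective (@left_mul R A).
Proof.
move=> a b ab; apply/eqP; rewrite -subr_eq0; apply/eqP/rnorm_eq0.
by rewrite -rnorm_left_mul left_mulB ab subrr rnorm0.
Qed.

(* [a - a y = a (1 - y)] with [1 - y = d^2 (h^2 + d^2)^-1] and [h = a^* a].   *)
Lemma cmul_dense a (eps : R) : 0 < eps -> exists x y, rnorm (a - x ** y) < eps.
Proof.
move=> eps0; pose h := star a ** a; pose L := left_mul h.
have o1 := @op_onel _ _ _ (cstar_ip A); have o2 := @op_oner _ _ _ (cstar_ip A).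
set one := op_one (cstar_ip A) in o1 o2.
have Lsa : star L = L by rewrite -left_mul_star /h starM starK.
pose d := eps ^+ 2 / 25; have d0 : 0 < d by rewrite divr_gt0// exprn_gt0.
have di : complex.Im (0 +i* d) != 0 by rewrite /= gt_eqF.
have dni : complex.Im (0 +i* (- d)) != 0 by rewrite /= oppr_eq0 gt_eqF.
have [y1 y1P y1n] := sa_resolvent o1 o2 Lsa di.
have [y2 y2P y2n] := sa_resolvent o1 o2 Lsa dni.
rewrite /= ?normrN ger0_norm ?(ltW d0)// in y1n y2n.
pose Y := y1 ** y2.
have YP : (d ^+ 2)%:C *: Y + Y ** (L ** L) = one.
  have [_ YQ] := inverse_ofM o2 y2P y1P; rewrite -[RHS]YQ -/Y.
  have -> : ((0 +i* (- d)) *: one - L) ** ((0 +i* d) *: one - L) =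
      (d ^+ 2)%:C *: one + L ** L.
    rewrite cmulBl !cmulBr !(cmulZl, cmulZr) o1 o2 o1 scalerA opprB addrA addrAC.
    congr (_ + _).
      rewrite -addrA -opprD -scalerDl [X in X *: L](_ : _ = 0) ?scale0r ?subr0.
        congr (_ *: _).
        by apply/eqP; rewrite eq_complex /=; apply/andP; split; apply/eqP; ring.
      by apply/eqP; rewrite eq_complex /=; apply/andP; split; apply/eqP; ring.
  by rewrite cmulDr cmulZr o2.
have Ly : rnorm (L ** Y) <= 6 / d.
  have Ly1 : rnorm (L ** y1) <= 3.
    have -> : L ** y1 = (0 +i* d) *: y1 - one.
      by rewrite -(proj1 y1P) cmulBl cmulZl o1 opprB addrC subrK.
    rewrite (le_trans (rnormD _ _))// rnormN rnormZ.
    have -> : rnorm (0 +i* d : R[i]) = d.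
      by rewrite /rnorm normc_def /= expr0n /= add0r sqrtr_sqr ger0_norm// ltW.
    have := rnorm_unit_le1 o1; rewrite -/one.
    by move: y1n; rewrite ler_pdivlMr// mulrC; lra.
  rewrite /Y cmulA (le_trans (rnorm_cmul _ _))//.
  rewrite (@le_trans _ _ (3 * (2 / d)))//; first by rewrite ler_pM ?rnorm_ge0.
  by rewrite mulrA; lra.
have Yn : rnorm Y <= 4 / d ^+ 2.
  rewrite (le_trans (rnorm_cmul _ _))//.
  have -> : 4 / d ^+ 2 = 2 / d * (2 / d) by field; rewrite gt_eqF.
  by rewrite ler_pM ?rnorm_ge0.
exists a, (Y (h ** h)).
rewrite -rnorm_left_mul left_mulB left_mulM -mul_left_mul [left_mul (h ** h)]left_mulM.
have -> : left_mul a - left_mul a ** (Y ** (L ** L)) = (d ^+ 2)%:C *: (left_mul a ** Y).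
  by rewrite -{1}[left_mul a]o2 -cmulBr -YP addrK cmulZr.
rewrite -(@ltr_pXn2r _ 2) ?nnegrE ?rnorm_ge0 ?(ltW eps0)//.
rewrite rnormZ exprMn -rnorm_cstar starM -cmulA (cmulA (star (left_mul a))).
rewrite -left_mul_star -left_mulM -/h -/L rnorm_real ger0_norm ?sqr_ge0//.
apply: (@le_lt_trans _ _ ((d ^+ 2) ^+ 2 * (4 / d ^+ 2 * (6 / d)))).
  rewrite ler_wpM2l ?sqr_ge0// (le_trans (rnorm_cmul _ _))// rnorm_star.
  by rewrite ler_pM ?rnorm_ge0.
have -> : (d ^+ 2) ^+ 2 * (4 / d ^+ 2 * (6 / d)) = 24 * d by field; rewrite gt_eqF.
by rewrite /d; have := exprn_gt0 2 eps0; lra.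
Qed.

End left_multiplication.

Section star_homomorphism_lemmas.
Variables (R : realType) (A B : cstarAlgType R) (f : A -> B).
Hypothesis fH : star_hom f.

Lemma star_homD x y : f (x + y) = f x + f y.
Proof. by case: fH => fl _ _; have := fl 1 x y; rewrite !scale1r. Qed.
Lemma star_hom0 : f 0 = 0.
Proof. by case: fH => fl _ _; have := fl (-1) 0 0; rewrite !scaleN1r oppr0 addr0 addNr. Qed.
Lemma star_homZ c x : f (c *: x) = c *: f x.
Proof. by case: fH => fl _ _; have := fl c x 0; rewrite star_hom0 !addr0. Qed.
Lemma star_homB x y : f (x - y) = f x - f y.
Proof. by rewrite star_homD -scaleN1r star_homZ scaleN1r. Qed.
Lemma star_homM x y : f (x ** y) = f x ** f y. Proof. by case: fH. Qed.
Lemma star_homS x : f (star x) = star (f x). Proof. by case: fH. Qed.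

(* A quasi-inverse of [h] is mapped by [f] to one of [f h], so [f] does not   *)
(* increase the spectral radius.                                              *)
Lemma star_hom_contractive x : rnorm (f x) <= rnorm x.
Proof.
rewrite -(@ler_pXn2r _ 2) ?nnegrE ?rnorm_ge0// -!rnorm_cstar -star_homS -star_homM.
set h := star x ** x; have hh : star h = h by rewrite /h starM starK.
have o1 := @op_onel _ _ _ (cstar_ip B); have o2 := @op_oner _ _ _ (cstar_ip B).
have p1 := @op_onel _ _ _ (cstar_ip A); have p2 := @op_oner _ _ _ (cstar_ip A).
rewrite -rnorm_left_mul; apply: (sa_spectral_radius o1 o2) (rnorm_ge0 _) _.
  by rewrite -left_mul_star -star_homS hh.
move=> t ht; have t0 : 0 < `|t| := le_lt_trans (rnorm_ge0 _) ht.
have tc0 : t%:C != 0 :> R[i] by rewrite fmorph_eq0 -normr_gt0.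
pose k := (t%:C)^-1 *: h.
have [|y yP _] := @neumann _ _ _ p1 p2 (left_mul k).
  by rewrite rnorm_left_mul rnormZ -fmorphV rnorm_real normfV mulrC ltr_pdivrMr// mul1r.
pose c := y k.
have cE : left_mul c = y - op_one _.
  by rewrite -mul_left_mul -(proj2 yP) cmulBr p2 opprB addrC subrK.
have c1 : c = k + c ** k.
  apply: left_mul_inj; rewrite left_mulD left_mulM cE cmulBl p1.
  by rewrite addrCA addrN addr0 mul_left_mul cE.
have c2 : c = k + k ** c.
  apply: left_mul_inj; rewrite left_mulD left_mulM cE cmulBr p2.
  by rewrite addrCA addrN addr0 -(proj1 yP) cmulBl p1 opprB addrC subrK.
have inv : inverse_of (op_one _) (op_one _ - left_mul (f k)) (op_one _ + left_mul (f c)).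
  split.
    rewrite cmulBl !cmulDr o1 o1 o2 -addrA -left_mulM -star_homM.
    rewrite [X in _ + X](_ : _ = 0) ?addr0//.
    by rewrite -left_mulD -left_mulB -star_homD -c2 subrr -(scale0r 0) left_mulZ scale0r.
  rewrite cmulBr !cmulDl o1 o2 o1 -addrA -left_mulM -star_homM.
  rewrite [X in _ + X](_ : _ = 0) ?addr0//.
  by rewrite -left_mulD -left_mulB -star_homD -c1 subrr -(scale0r 0) left_mulZ scale0r.
exists ((t%:C)^-1 *: (op_one _ + left_mul (f c))).
have := inverse_ofZ tc0 inv.
by rewrite scalerBr -left_mulZ -star_homZ /k scalerA divff// scale1r.
Qed.

Lemma star_hom_ceval h a (p : {poly R[i]}) :
  f (ceval (op_one (cstar_ip A)) (left_mul h) p a) =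
  ceval (op_one (cstar_ip B)) (left_mul (f h)) p (f a).
Proof.
have o1 := @op_onel _ _ _ (cstar_ip B); have o2 := @op_oner _ _ _ (cstar_ip B).
have p1 := @op_onel _ _ _ (cstar_ip A); have p2 := @op_oner _ _ _ (cstar_ip A).
elim/poly_ind: p a => [|p c ih] a; first by rewrite !ceval0 /= star_hom0.
rewrite !cevalD !cevalC !cevalM// !cevalX//= star_homD star_homZ.
by rewrite ih star_homM.
Qed.

End star_homomorphism_lemmas.

(** * Injective star-homomorphisms are isometric *)

Section injective_star_hom.
Variable R : realType.
Local Notation toC := (map_poly (real_complex R)).

(** The classical iteration for [|x|] as the square root of [x^2], increasing from [0]. *)
Fixpoint abs_poly n : {poly R} :=
  if n is n.+1 then abs_poly n + 2^-1 *: ('X^2 - abs_poly n ^+ 2) else 0.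

(** One step multiplies the gap [|x| - q] by [1 - (|x| + q) / 2], which is at most [1 - |x| / 2],
    and [(1 - |x| / 2) (2 + (n + 1) |x|) <= 2 + n |x|]. This product form of the rate does not
    degenerate at [x = 0]. *)
Lemma abs_polyP n (x : R) : `|x| <= 1 ->
  0 <= (abs_poly n).[x] <= `|x| /\
  (`|x| - (abs_poly n).[x]) * (2 + n%:R * `|x|) <= 2 * `|x|.
Proof.
move=> x1; have x0 := normr_ge0 x.
elim: n => [|n [/andP[q0 qx] ih]].
  by rewrite /= horner0 lexx x0 subr0 mul0r addr0 mulrC.
rewrite [abs_poly n.+1]/= !hornerE -[x ^+ 2]real_normK ?num_real//.
have nS : n.+1%:R = n%:R + 1 :> R by rewrite natr1.
have n0 : (0 : R) <= n%:R by rewrite ler0n.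
rewrite nS {nS}; move: x1 x0 q0 qx n0 ih; move: (abs_poly n).[x] `|x| n%:R.
move=> q y m y1 y0 q0 qx m0 ih.
have -> : q + 2^-1 * (y ^+ 2 - q ^+ 2) = q + (y - q) * ((y + q) / 2) by field.
have yq0 : 0 <= y - q by rewrite subr_ge0.
split.
  apply/andP; split; first by rewrite addr_ge0// mulr_ge0// divr_ge0// addr_ge0.
  rewrite -lerBrDl ler_piMr//; lra.
have -> : y - (q + (y - q) * ((y + q) / 2)) = (y - q) * (1 - (y + q) / 2) by ring.
have A1 : (y - q) * (1 - (y + q) / 2) <= (y - q) * (1 - y / 2).
  by rewrite ler_wpM2l//; lra.
have pos : 0 <= 2 + (m + 1) * y by rewrite addr_ge0// mulr_ge0// addr_ge0.
apply: (@le_trans _ _ ((y - q) * (1 - y / 2) * (2 + (m + 1) * y))).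
  by rewrite ler_wpM2r.
apply: le_trans ih; rewrite -mulrA ler_wpM2l//.
have := mulr_ge0 m0 (sqr_ge0 y); have := sqr_ge0 y; rewrite !expr2; nra.
Qed.

Lemma abs_poly_dist n (x : R) : `|x| <= 1 -> `| `|x| - (abs_poly n).[x] | <= 2 / n.+1%:R.
Proof.
move=> x1; have [/andP[q0 qx]] := abs_polyP n x1.
move=> H; rewrite ger0_norm ?subr_ge0// ler_pdivlMr ?ltr0n//.
have nS : n.+1%:R = n%:R + 1 :> R by rewrite natr1.
rewrite nS {nS}; have := ler0n R n; have := normr_ge0 x.
move: x1 q0 qx H; move: (abs_poly n).[x] `|x| n%:R.
move=> q y m y1 q0 qx H y0 m0.
have D0 : 0 < 2 + m * y by rewrite ltr_wpDr// mulr_ge0.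
rewrite -(ler_pM2r D0) mulrAC (le_trans (ler_wpM2r _ H))//; first by rewrite addr_ge0.
by nra.
Qed.

(** Approximates [max(0, t^2 - s)], written as half of [(t^2 - s) + |t^2 - s|]. The value at [0],
    itself nearly [0], is subtracted so that the polynomial can be applied in an algebra without
    unit. *)
Definition cut_poly (s : R) n : {poly R} :=
  let p := 2^-1 *: (('X^2 - s%:P) + (abs_poly n \Po ('X^2 - s%:P))) in p - (p.[0])%:P.

Lemma cut_polyP (s : R) n (t : R) : 0 <= s <= 1 -> `|t| <= 1 ->
  `|Num.max 0 (t ^+ 2 - s) - (cut_poly s n).[t]| <= 2 / n.+1%:R.
Proof.
move=> /andP[s0 s1] t1.
have maxE (x : R) : Num.max 0 x = (x + `|x|) / 2.
  by case: (lerP x 0) => x0; [rewrite ler0_norm// subrr mul0r|rewrite gtr0_norm//; lra].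
have t2 : t ^+ 2 <= 1 by rewrite -real_normK ?num_real// exprn_ile1.
have t20 := sqr_ge0 t.
have xt : `|t ^+ 2 - s| <= 1 by rewrite ler_norml; apply/andP; split; lra.
have x0 : `|0 - s| <= 1 by rewrite sub0r normrN ger0_norm.
have := abs_poly_dist n xt; have := abs_poly_dist n x0.
rewrite /cut_poly !hornerE !horner_comp !hornerE maxE expr0n /=.
rewrite ?sub0r normrN (ger0_norm s0).
move: (abs_poly n).[_] (abs_poly n).[_] (2 / _) => u v c.
rewrite !ler_norml => /andP[? ?] /andP[? ?]; apply/andP; split; lra.
Qed.

Lemma cut_poly_factor s n : exists g, cut_poly s n = g * 'X.
Proof.
have : root (cut_poly s n) 0 by rewrite /root /cut_poly !hornerE subrr.
by move=> /factor_theorem[g ->]; exists g; rewrite subr0.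
Qed.

Variables (A B : cstarAlgType R) (f : A -> B).
Hypotheses (fH : star_hom f) (fI : injective f).

(** Suppose [|f x| < |x|] and normalise [h = x^* x] to norm [1], so that [r = |f h| < 1]. The
    function [max(0, t^2 - r)] vanishes for [|t| <= r], hence [f] kills its value at [h], and by
    injectivity that value is [0]. But it differs from [h^2] by at most [r] in norm, while
    [|h^2| = 1]. *)
Lemma star_hom_isometric x : rnorm (f x) = rnorm x.
Proof.
apply/eqP; rewrite eq_le star_hom_contractive//= leNgt; apply/negP => fx.
have x0 : 0 < rnorm x := le_lt_trans (rnorm_ge0 _) fx.
have x20 : 0 < rnorm x ^+ 2 by rewrite exprn_gt0.
pose h := ((rnorm x ^+ 2)^-1)%:C *: (star x ** x).
have hh : star h = h.
  rewrite /h starZ starM starK; congr (_ *: _).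
  by apply/eqP; rewrite eq_complex /= oppr0 !eqxx.
have cn : rnorm (((rnorm x ^+ 2)^-1)%:C : R[i]) = (rnorm x ^+ 2)^-1.
  by rewrite rnorm_real ger0_norm// invr_ge0 ltW.
have h1 : rnorm h = 1 by rewrite rnormZ cn rnorm_cstar mulVf// gt_eqF.
pose r := rnorm (f h).
have r1 : r < 1.
  rewrite /r star_homZ// rnormZ cn star_homM// star_homS// rnorm_cstar mulrC.
  by rewrite ltr_pdivrMr// mul1r ltr_pXn2r ?nnegrE ?rnorm_ge0.
have r0 : 0 <= r := rnorm_ge0 _.
have r01 : 0 <= r <= 1 by rewrite r0 ltW.
have o1 := @op_onel _ _ _ (cstar_ip B); have o2 := @op_oner _ _ _ (cstar_ip B).
have p1 := @op_onel _ _ _ (cstar_ip A); have p2 := @op_oner _ _ _ (cstar_ip A).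
have Lsa : star (left_mul h) = left_mul h by rewrite -left_mul_star hh.
have Ln : rnorm (left_mul h) <= 1 by rewrite rnorm_left_mul h1.
have fLsa : star (left_mul (f h)) = left_mul (f h) by rewrite -left_mul_star -star_homS// hh.
have fLn : rnorm (left_mul (f h)) <= r by rewrite rnorm_left_mul.
have /choice[g gP] : forall n, exists g, cut_poly r n = g * 'X by exact: cut_poly_factor.
have pP n t : `|t| <= 1 -> _ := cut_polyP n r01.
(* The factor ['X] of [cut_poly r n] lands in [A], so its value at [left_mul h] is left
   multiplication by an element of [A], to which [f] applies. *)
pose u n : A := ceval (op_one (cstar_ip A)) (left_mul h) (toC (g n)) h.
have Lu n : left_mul (u n) = ceval (op_one _) (left_mul h) (toC (cut_poly r n)).
  by rewrite -mul_left_mul gP rmorphM /= map_polyX cevalM// cevalX.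
have uB n m : rnorm (u n - u m) <= 2 / n.+1%:R + 2 / m.+1%:R.
  rewrite -rnorm_left_mul left_mulB !Lu -cevalB -rmorphB.
  apply: (sa_poly_norm p1 p2 Lsa Ln) => t t1.
  have := pP n t t1; have := pP m t t1; rewrite !hornerE.
  move: (2 / _) (2 / _) => c d.
  by rewrite !ler_norml => /andP[? ?] /andP[? ?]; apply/andP; split; lra.
have fu n : rnorm (f (u n)) <= 2 / n.+1%:R.
  rewrite /u star_hom_ceval// -rnorm_left_mul -mul_left_mul -[X in _ ** X](cevalX o2).
  rewrite -(map_polyX (real_complex R)) -cevalM// -rmorphM -gP.
  apply: (sa_poly_norm o1 o2 fLsa fLn) => t tr.
  have t1 : `|t| <= 1 by rewrite (le_trans tr)// ltW.
  have := pP n t t1; rewrite (_ : Num.max _ _ = 0) ?sub0r ?normrN//.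
  apply/max_idPl; rewrite subr_le0 -real_normK ?num_real//.
  by rewrite (le_trans (@lerXn2r _ 2 _ _ _ _ tr))// ?nnegrE//; nra.
have [|l lP] := @seq_complete R A u.
  move=> e e0; have [N NP] := @inv_lt_eps R 4 e e0; exists N => n Nn.
  apply: le_lt_trans (uB _ _) _; have := NP N (leqnn _).
  have : 2 / n.+1%:R <= 2 / N.+1%:R :> R.
    by rewrite ler_pM2l// lef_pV2 ?posrE ?ltr0n// ler_nat.
  have -> : 4 / N.+1%:R = 2 / N.+1%:R + 2 / N.+1%:R :> R by rewrite -mulrDl -natrD.
  by move: (2 / _) (2 / _) => c d; lra.
have l0 : l = 0.
  apply: fI; rewrite star_hom0//; apply: rnorm_le0 => e e0.
  have e20 : 0 < e / 2 by rewrite divr_gt0.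
  have [N NP] := lP _ e20; have [M MP] := @inv_lt_eps R 2 _ e20.
  apply: le_trans (rnormB_le _ (f (u (maxn N M)))) _.
  rewrite -star_homB// [e]splitr; apply: lerD.
    by rewrite (le_trans (fu _))// ltW// MP// leq_maxr.
  by rewrite (le_trans (star_hom_contractive fH _))// NP// leq_maxl.
(* With this [e], [|h^2| <= (r + e) + e = (1 + r) / 2 < 1]. *)
pose e := (1 - r) / 4; have e0 : 0 < e by rewrite divr_gt0// subr_gt0.
have [N NP] := lP _ e0; have [M MP] := @inv_lt_eps R 2 _ e0.
pose n := maxn N M.
have un : rnorm (u n) <= e by have := NP n (leq_maxl _ _); rewrite l0 sub0r rnormN.
have dn : 2 / n.+1%:R < e by rewrite MP// leq_maxr.
have : rnorm (left_mul h ** left_mul h - left_mul (u n)) <= r + e.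
  have -> : left_mul h ** left_mul h = ceval (op_one _) (left_mul h) (toC 'X^2).
    by rewrite map_polyXn cevalXn /cpow /= p2.
  rewrite Lu -cevalB -rmorphB; apply: (sa_poly_norm p1 p2 Lsa Ln) => t t1.
  have := pP n t t1; rewrite !hornerE => H.
  have : `|t ^+ 2 - Num.max 0 (t ^+ 2 - r)| <= r.
    have := sqr_ge0 t; case: (lerP (t ^+ 2 - r) 0) => ? ?.
      by rewrite subr0 ger0_norm//; lra.
    by rewrite opprB addrC subrK ger0_norm.
  move: H dn; move: (2 / _) => c.
  by rewrite !ler_norml => /andP[? ?] ? /andP[? ?]; apply/andP; split; lra.
have := rnormB_le (left_mul h ** left_mul h) (left_mul (u n)).
rewrite rnorm_sa_sq// !rnorm_left_mul h1 expr1n /e in un *.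
by lra.
Qed.

End injective_star_hom.

(** * Closed linear relations *)

Section linear_span_lemmas.
Variable R : realType.

Lemma lspan_map (V W : lmodType R[i]) (f : V -> W) (s : R[i] -> R[i]) (S : set V) (T : set W) :
  {morph f : x y / x + y} -> (forall c x, f (c *: x) = s c *: f x) ->
  (forall x, S x -> lspan T (f x)) -> forall x, lspan S x -> lspan T (f x).
Proof.
move=> fD fZ ST; have [T0 Tl] := lspan_subspace T.
apply: lspan_ind => //; split=> [|c x y xT yT] /=; last by rewrite fD fZ; exact: Tl.
suff -> : f 0 = 0 by [].
by apply: (addrI (f 0)); rewrite -fD !addr0.
Qed.

Lemma lspan_bilin (V V' W : lmodType R[i]) (b : V -> V' -> W) (S : set V) (S' : set V')
    (T : set W) :
  (forall y, linear (b^~ y)) -> (forall x, linear (b x)) ->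
  (forall x y, S x -> S' y -> lspan T (b x y)) ->
  forall x y, lspan S x -> lspan S' y -> lspan T (b x y).
Proof.
move=> bl br ST x y Sx; have [T0 Tl] := lspan_subspace T.
have lin0 (U W' : lmodType R[i]) (f : U -> W') : linear f -> f 0 = 0.
  by move=> fl; have := fl (-1) 0 0; rewrite !scaleN1r oppr0 addr0 addNr.
move: y; apply: lspan_ind.
  split=> [|c u v uT vT] /=; first by rewrite (lin0 _ _ _ (br x)).
  by rewrite br; exact: Tl.
move=> y S'y; move: x Sx; apply: lspan_ind => [|x Sx]; last exact: ST.
split=> [|c u v uT vT] /=; first by rewrite (lin0 _ _ _ (bl y)).
by rewrite bl; exact: Tl.
Qed.

End linear_span_lemmas.

Section relations.
Variables (R : realType) (V F : cstarAlgType R).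
Implicit Types (G : set (V * F)) (x : V) (y : F).

(** The closure of [G], as a relation. A map prescribed on generators whose linear relations are
    unknown is handled as the closure of the span of its pairs; a bound on the pairs then gives
    existence, uniqueness and continuity of values. *)
Definition gcl G x y := forall e : R, 0 < e ->
  exists p, [/\ G p, rnorm (x - p.1) < e & rnorm (y - p.2) < e].

Lemma sub_gcl G p : G p -> gcl G p.1 p.2.
Proof. by move=> Gp e e0; exists p; rewrite !subrr !rnorm0. Qed.

Lemma gcl_lin G c x x' y y' : is_subspace G -> gcl G x y -> gcl G x' y' ->
  gcl G (c *: x + x') (c *: y + y').
Proof.
move=> [_ Gl] xy xy' e e0.
have c0 : 0 < rnorm c + 1 by rewrite ltr_wpDl ?rnorm_ge0.
have e20 : 0 < e / 2 by rewrite divr_gt0.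
have [p [Gp px py]] := xy _ (divr_gt0 e20 c0).
have [q [Gq qx qy]] := xy' _ e20.
have est (U : normedModType R[i]) (u v u' v' : U) : rnorm (u - v) < e / 2 / (rnorm c + 1) ->
    rnorm (u' - v') < e / 2 -> rnorm (c *: u + u' - (c *: v + v')) < e.
  move=> uv uv'; rewrite opprD addrACA -scalerBr.
  rewrite (le_lt_trans (rnormD _ _))// rnormZ [e]splitr ler_ltD//.
  rewrite ltr_pdivlMr// in uv; apply: le_trans (ltW uv).
  by rewrite mulrC ler_wpM2l ?rnorm_ge0// lerDl.
by exists (c *: p + q); split; [exact: Gl|exact: est|exact: est].
Qed.

Lemma gcl_bound G M x y : 0 <= M -> (forall p, G p -> rnorm p.2 <= M * rnorm p.1) ->
  gcl G x y -> rnorm y <= M * rnorm x.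
Proof.
move=> M0 GM xy; apply: le_eps => e e0.
have M1 : 0 < M + 1 by rewrite ltr_wpDl.
have [p [Gp px py]] := xy _ (divr_gt0 e0 M1).
apply: le_trans (rnormB_le _ p.2) _.
apply: (@le_trans _ _ (M * (rnorm x + e / (M + 1)) + e / (M + 1))).
  apply: lerD; last exact: ltW.
  apply: le_trans (GM _ Gp) _; rewrite ler_wpM2l//.
  by rewrite (le_trans (rnormB_le _ x))// lerD2l rnormC ltW.
rewrite mulrDr -addrA lerD2l -[X in _ + X]mul1r -mulrDl mulrC divfK//.
by rewrite gt_eqF.
Qed.

Lemma gcl_uniq G M x y y' : is_subspace G -> 0 <= M ->
  (forall p, G p -> rnorm p.2 <= M * rnorm p.1) ->
  gcl G x y -> gcl G x y' -> y = y'.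
Proof.
move=> Gs M0 GM xy xy'; have := gcl_bound M0 GM (gcl_lin (-1) Gs xy xy').
rewrite !scaleN1r !addNr rnorm0 mulr0 => y0.
apply/esym/eqP; rewrite -subr_eq0 addrC; apply/eqP/rnorm_eq0/eqP.
by rewrite eq_le y0 rnorm_ge0.
Qed.

(** The bound turns approximants of [x] from the domain into a Cauchy sequence of images. *)
Lemma gcl_total G M x : is_subspace G -> 0 <= M ->
  (forall p, G p -> rnorm p.2 <= M * rnorm p.1) ->
  closure [set u | exists v, G (u, v)] x -> exists y, gcl G x y.
Proof.
move=> [_ Gl] M0 GM /closure_rnorm xG.
have M1 : 0 < M + 1 by rewrite ltr_wpDl.
have /choice[u uP] : forall n : nat, exists p, G p /\ rnorm (x - p.1) < 1 / n.+1%:R.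
  move=> n; have [|a [v Gav] xa] := xG (1 / n.+1%:R); first by rewrite divr_gt0// ltr0n.
  by exists (a, v).
have uB n m : rnorm ((u n).2 - (u m).2) <= M * (1 / n.+1%:R + 1 / m.+1%:R).
  have -> : (u n).2 - (u m).2 = ((-1) *: u m + u n).2 by rewrite /= scaleN1r addrC.
  apply: le_trans (GM _ _) _; first by apply: Gl; exact: (proj1 (uP _)).
  rewrite ler_wpM2l//= scaleN1r addrC (le_trans (rnorm_split x _ _))//.
  by rewrite lerD// ?(rnormC _ x) ltW// (proj2 (uP _)).
have mono (n m : nat) : (n <= m)%N -> 1 / m.+1%:R <= 1 / n.+1%:R :> R.
  by move=> nm; rewrite !div1r lef_pV2 ?posrE ?ltr0n// ler_nat.
have [|l lP] := @seq_complete R F (fun n => (u n).2).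
  move=> e e0; have [N NP] := @inv_lt_eps R (M * 2) e e0; exists N => n Nn.
  apply: le_lt_trans (uB _ _) _; apply: le_lt_trans (NP N (leqnn _)).
  rewrite -mulrA ler_wpM2l// -[2]/(1 + 1) mulrDl lerD2l; exact: mono.
exists l => e e0; have e20 : 0 < e / 2 by rewrite divr_gt0.
have [N NP] := lP _ e20; have [K KP] := @inv_lt_eps R 1 _ e0.
exists (u (maxn N K)); have [Gu ux] := uP (maxn N K); split=> //.
  by apply: lt_trans ux (KP _ _); exact: leq_maxr.
by apply: le_lt_trans (NP _ _) _; [exact: leq_maxl|lra].
Qed.

End relations.

Lemma cmul_close (R : realType) (A : cstarAlgType R) (x y : A) (e : R) : 0 < e ->
  exists2 d : R, 0 < d & forall p q, rnorm (x - p) < d -> rnorm (y - q) < d ->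
    rnorm (x ** y - p ** q) < e.
Proof.
move=> e0; set M := rnorm x + rnorm y + 2.
have M0 : 0 < M by rewrite ltr_wpDl ?addr_ge0 ?rnorm_ge0.
exists (Num.min 1 (e / M)); first by rewrite lt_min ltr01 divr_gt0.
move=> p q; set d := Num.min _ _ => xp yq.
have d0 : 0 < d by rewrite /d lt_min ltr01 divr_gt0.
have d1 : d <= 1 by rewrite /d ge_min lexx.
have dM : d * M <= e by rewrite -ler_pdivlMr// ge_min lexx orbT.
have -> : x ** y - p ** q = (x - p) ** q + x ** (y - q).
  by rewrite cmulBl cmulBr [RHS]addrC addrA subrK.
have qn : rnorm q <= rnorm y + 1.
  by rewrite (le_trans (rnormB_le _ y))// lerD2l rnormC ltW// (lt_le_trans yq).
apply: le_lt_trans (rnormD _ _) _; apply: lt_le_trans dM.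
apply: (@le_lt_trans _ _ (d * (rnorm y + 1) + rnorm x * d)).
  apply: lerD; apply: le_trans (rnorm_cmul _ _) _.
    by rewrite ler_pM ?rnorm_ge0// ltW.
  by rewrite ler_wpM2l ?rnorm_ge0// ltW.
by rewrite [rnorm x * d]mulrC -mulrDr ltr_pM2l// /M; lra.
Qed.

Section relation_algebra.
Variables (R : realType) (V F : cstarAlgType R) (G : set (V * F)).

Lemma gclM x x' y y' :
  (forall p q, G p -> G q -> G (p.1 ** q.1, p.2 ** q.2)) ->
  gcl G x y -> gcl G x' y' -> gcl G (x ** x') (y ** y').
Proof.
move=> GM xy xy' e e0.
have [d d0 dP] := cmul_close x x' e0; have [d' d'0 d'P] := cmul_close y y' e0.
have m0 : 0 < Num.min d d' by rewrite lt_min d0.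
have [p [Gp px py]] := xy _ m0; have [q [Gq qx qy]] := xy' _ m0.
move: px py qx qy; rewrite !lt_min => /andP[? _] /andP[_ ?] /andP[? _] /andP[_ ?].
by exists (p.1 ** q.1, p.2 ** q.2); split; [exact: GM|exact: dP|exact: d'P].
Qed.

Lemma gcl_star x y : (forall p, G p -> G (star p.1, star p.2)) ->
  gcl G x y -> gcl G (star x) (star y).
Proof.
move=> GS xy e /xy[p [Gp px py]]; exists (star p.1, star p.2).
by rewrite /= -!starB !rnorm_star; split=> //; exact: GS.
Qed.

Lemma gcl_swap x y : gcl G x y -> gcl [set p | G (p.2, p.1)] y x.
Proof. by move=> xy e /xy[[a b] [Gp px py]]; exists (b, a). Qed.

End relation_algebra.

(** * Multipliers prescribed on a dense span *)

Section multiplier_construction.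
Variables (R : realType) (D : cstarAlgType R) (I : Type).
Implicit Types (g f : I -> D).

Lemma lspan_fst (V F : lmodType R[i]) (S : set (V * F)) x :
  lspan [set p.1 | p in S] x -> exists y, lspan S (x, y).
Proof.
have [S0 Sl] := lspan_subspace S.
move: x; apply: lspan_ind.
  split=> [|c x y [u xu] [v yv]]; first by exists 0.
  by exists (c *: u + v); exact: Sl xu yv.
by move=> _ [[x y] Sp <-]; exists y; exact: sub_lspan.
Qed.

Lemma multiplier_ext g (X Y : multiplier D) : closure (lspan (range g)) = setT ->
  (forall i, X (g i) = Y (g i)) -> X = Y.
Proof.
move=> gd XY; apply: adjop_eqP => x.
have lXY z : lspan (range g) z -> X z = Y z.
  move: z; apply: lspan_ind => [|_ [i _ <-]//]; split=> [|c u v uE vE] /=.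
    by rewrite !op0.
  by rewrite !opD !opZ uE vE.
apply: (@rnorm_eq_eps _ _ _ _ (opnorm X + opnorm Y)) => e e0.
have /closure_rnorm /(_ e e0)[z /lXY zE xz] : closure (lspan (range g)) x by rewrite gd.
have -> : X x - Y x = X (x - z) - Y (x - z).
  by rewrite !opB zE opprB addrA subrK.
rewrite (le_trans (rnormD _ _))// rnormN mulrDl.
by apply: lerD; apply: le_trans (op_le _ _) _; rewrite ler_wpM2l ?opnorm_ge0// ltW.
Qed.

(* The bound on the adjoint [f'] comes for free: [|f' x|^2 = |<x, f (f' x)>|]. *)
Lemma multiplier_exists g f f' (M : R) : 0 <= M ->
  (forall i j, star (f' i) ** g j = star (g i) ** f j) ->
  closure (lspan (range g)) = setT ->
  (forall p, lspan [set (g i, f i) | i in setT] p -> rnorm p.2 <= M * rnorm p.1) ->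
  exists X : multiplier D, [/\ forall i, X (g i) = f i,
    forall i, op_adj X (g i) = f' i & rnorm X <= M].
Proof.
move=> M0 adj gd GM.
set G := lspan _ in GM; pose G' := lspan [set (g i, f' i) | i in setT].
have Gs : is_subspace G := lspan_subspace _.
have G's : is_subspace G' := lspan_subspace _.
have dom k z : closure [set u | exists v, lspan [set (g i, k i) | i in setT] (u, v)] z.
  have : closure (lspan (range g)) z by rewrite gd.
  apply: closureS z => z zg; apply: lspan_fst.
  move: z zg; apply: lspan_ind; first exact: lspan_subspace.
  by move=> _ [i _ <-]; apply: sub_lspan; exists (g i, k i) => //; exists i.
have /choice[F FP] : forall z, exists y, gcl G z y.
  by move=> z; apply: (gcl_total Gs M0 GM); exact: dom.
have adjG p q : G' p -> G q -> star p.2 ** q.1 = star p.1 ** q.2.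
  move=> G'p; move: q; apply: lspan_ind.
    split=> [|c u v uE vE] /=; first by rewrite !cmulr0.
    by rewrite !cmulDr !cmulZr uE vE.
  move=> _ [j _ <-] /=; move: p G'p; apply: lspan_ind.
    split=> [|c u v uE vE] /=; first by rewrite !star0 !cmul0r.
    by rewrite !starD !starZ !cmulDl !cmulZl uE vE.
  by move=> _ [i _ <-] /=; exact: adj.
have adjF p z : G' p -> star p.2 ** z = star p.1 ** F z.
  move=> G'p; apply: (@rnorm_eq_eps _ _ _ _ (rnorm p.2 + rnorm p.1)) => e e0.
  have [q [Gq qz qF]] := FP z e e0.
  have -> : star p.2 ** z - star p.1 ** F z =
      star p.2 ** (z - q.1) - star p.1 ** (F z - q.2).
    by rewrite !cmulBr (adjG p q)// opprB addrA subrK.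
  rewrite (le_trans (rnormD _ _))// rnormN mulrDl.
  apply: lerD; rewrite (le_trans (rnorm_cmul _ _))// rnorm_star ler_wpM2l ?rnorm_ge0//;
    exact: ltW.
have FM z : rnorm (F z) <= M * rnorm z := gcl_bound M0 GM (FP z).
have G'M p : G' p -> rnorm p.2 <= M * rnorm p.1.
  move=> G'p; have [->|p0] := eqVneq (rnorm p.2) 0; first by rewrite mulr_ge0 ?rnorm_ge0.
  have {}p0 : 0 < rnorm p.2 by rewrite lt_def p0 rnorm_ge0.
  rewrite -(ler_pM2r p0) -expr2 -rnorm_cstar adjF// (le_trans (rnorm_cmul _ _))//.
  by rewrite rnorm_star mulrAC mulrC ler_wpM2r ?rnorm_ge0.
have /choice[F' F'P] : forall z, exists y, gcl G' z y.
  by move=> z; apply: (gcl_total G's M0 G'M); exact: dom.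
have FF' x y : cstar_ip D (F' x) y = cstar_ip D x (F y).
  rewrite /=; apply: (@rnorm_eq_eps _ _ _ _ (rnorm y + rnorm (F y))) => e e0.
  have [p [G'p px pF]] := F'P x e e0.
  have -> : star (F' x) ** y - star x ** F y =
      star (F' x - p.2) ** y - star (x - p.1) ** F y.
    by rewrite !starB !cmulBl adjF// opprB addrA subrK.
  rewrite (le_trans (rnormD _ _))// rnormN mulrDl.
  by apply: lerD; rewrite (le_trans (rnorm_cmul _ _))// rnorm_star mulrC;
    rewrite ler_wpM2l ?rnorm_ge0// ltW.
exists (make_adjop FF' FM); split=> [i|i|] /=.
- apply: gcl_uniq Gs M0 GM (FP _) _.
  by apply: (@sub_gcl _ _ _ G (g i, f i)); apply: sub_lspan; exists i.
- apply: gcl_uniq G's M0 G'M (F'P _) _.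
  by apply: (@sub_gcl _ _ _ G' (g i, f' i)); apply: sub_lspan; exists i.
- by rewrite op_rnormE; apply: opnorm_le.
Qed.

(** Preservation of the inner products [g_i^* g_j] extends to the span and gives the bound [1]
    through the C*-identity. *)
Lemma isometric_multiplier g f f' :
  (forall i j, star (f' i) ** g j = star (g i) ** f j) ->
  (forall i j, star (f i) ** f j = star (g i) ** g j) ->
  closure (lspan (range g)) = setT ->
  exists X : multiplier D, [/\ forall i, X (g i) = f i,
    forall i, op_adj X (g i) = f' i & rnorm X <= 1].
Proof.
move=> adj iso gd; apply: multiplier_exists ler01 adj gd _.
have isoG p q : lspan [set (g i, f i) | i in setT] p ->
    lspan [set (g i, f i) | i in setT] q -> star p.2 ** q.2 = star p.1 ** q.1.
  move=> Gp; move: q; apply: lspan_ind.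
    split=> [|c u v uE vE] /=; first by rewrite !cmulr0.
    by rewrite !cmulDr !cmulZr uE vE.
  move=> _ [j _ <-] /=; move: p Gp; apply: lspan_ind.
    split=> [|c u v uE vE] /=; first by rewrite !star0 !cmul0r.
    by rewrite !starD !starZ !cmulDl !cmulZl uE vE.
  by move=> _ [i _ <-] /=; exact: iso.
move=> p Gp; rewrite mul1r -(@ler_pXn2r _ 2) ?nnegrE ?rnorm_ge0//.
by rewrite -!rnorm_cstar isoG.
Qed.

End multiplier_construction.

(** * Tensor products *)

Lemma closure_subspace (R : realType) (A : cstarAlgType R) (W : set A) :
  is_subspace W -> is_subspace (closure W).
Proof.
move=> [W0 Wl]; split=> [|c x y xW yW]; first exact: subset_closure.
move: xW yW => /closure_rnorm xW /closure_rnorm yW; apply/closure_rnorm => e e0.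
have c0 : 0 < rnorm c + 1 by rewrite ltr_wpDl ?rnorm_ge0.
have e20 : 0 < e / 2 by rewrite divr_gt0.
have [x' Wx' xx'] := xW _ (divr_gt0 e20 c0).
have [y' Wy' yy'] := yW _ e20.
exists (c *: x' + y'); first exact: Wl.
rewrite opprD addrACA -scalerBr.
rewrite (le_lt_trans (rnormD _ _))// rnormZ [e]splitr ler_ltD//.
rewrite ltr_pdivlMr// in xx'; apply: le_trans (ltW xx').
by rewrite mulrC ler_wpM2l ?rnorm_ge0// lerDl.
Qed.

Lemma closure_lspan_sub (R : realType) (A : cstarAlgType R) (S T : set A) :
  (forall x, S x -> closure (lspan T) x) -> closure (lspan S) `<=` closure (lspan T).
Proof.
move=> ST; rewrite [X in _ `<=` X](closure_id _).1; last exact: closed_closure.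
apply: closureS; apply: lspan_ind => //.
by apply: closure_subspace; exact: lspan_subspace.
Qed.

(** The unitary is [u = c + i m], where [m] is the square root of [1 - c^2]. It is obtained as
    [m = e - l] with [l] a fixed point of [l = (c^2 + l^2) / 2], which is equivalent to
    [c^2 + m^2 = e]. *)
Lemma sa_average_unitary (R : realType) (A : cstarAlgType R) (e c : A) :
  (forall x : A, e ** x = x) -> (forall x : A, x ** e = x) ->
  star c = c -> rnorm c <= 1 / 2 ->
  exists u, [/\ star u ** u = e, u ** star u = e & c = 2^-1 *: (u + star u)].
Proof.
move=> e1l e1r cc c2.
have half : rnorm (2^-1 : R[i]) = 2^-1.
  have -> : (2^-1 : R[i]) = (2^-1 : R)%:C by rewrite fmorphV /= rmorph_nat.
  by rewrite rnorm_real ger0_norm// invr_ge0 ler0n.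
(* The iterates stay in the ball of radius [1 / 4], where the map contracts by the factor [1 / 4];
   this is where [|c| <= 1 / 2] enters. *)
pose fix s n := if n is n.+1 then 2^-1 *: (c ** c + s n ** s n) else 0 : A.
have sn n : rnorm (s n) <= 1 / 4.
  elim: n => [|n ih] /=; first by rewrite rnorm0 divr_ge0.
  rewrite rnormZ half; have := rnormD (c ** c) (s n ** s n).
  have := rnorm_cmul c c; have := rnorm_cmul (s n) (s n).
  by have := rnorm_ge0 c; have := rnorm_ge0 (s n); nra.
have sC n : c ** s n = s n ** c.
  elim: n => [|n ih] /=; first by rewrite cmul0r cmulr0.
  by rewrite cmulZr cmulZl cmulDr cmulDl !cmulA ih -(cmulA (s n)) ih cmulA.
have sS n : star (s n) = s n.
  elim: n => [|n ih] /=; first by rewrite star0.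
  rewrite starZ starD !starM cc ih; congr (_ *: _).
  by rewrite fmorphV rmorph_nat.
have sq (x y : A) : x ** x - y ** y = x ** (x - y) + (x - y) ** y.
  by rewrite cmulBr cmulBl addrA subrK.
have [||l lP] := @geo_complete R A s (1 / 4) 1.
- by rewrite divr_ge0//=; lra.
- elim=> [|n ih].
    rewrite /= cmul0r addr0 subr0 rnormZ half; have := rnorm_cmul c c.
    by have := rnorm_ge0 c; rewrite expr0; nra.
  have -> : s n.+2 - s n.+1 = 2^-1 *: (s n.+1 ** s n.+1 - s n ** s n).
    by rewrite [s n.+2]/= [in X in _ - X]/= -scalerBr opprD addrACA subrr add0r.
  rewrite sq rnormZ half exprS.
  have := rnormD (s n.+1 ** (s n.+1 - s n)) ((s n.+1 - s n) ** s n).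
  have := rnorm_cmul (s n.+1) (s n.+1 - s n).
  have := rnorm_cmul (s n.+1 - s n) (s n).
  have := sn n.+1; have := sn n; have := rnorm_ge0 (s n.+1 - s n).
  have := rnorm_ge0 (s n.+1); have := rnorm_ge0 (s n).
  move: ih; move: (rnorm _) (rnorm _) (rnorm _) (rnorm _) (rnorm _) (rnorm _) => a b d f g h.
  by move: (_ ^+ n) => r; nra.
have lE : l = 2^-1 *: (c ** c + l ** l).
  apply: (@rnorm_eq_eps _ _ _ _ (2 + rnorm l)) => d d0.
  have [N NP] := lP d d0.
  have -> : l - 2^-1 *: (c ** c + l ** l) =
      (l - s N.+1) - 2^-1 *: (l ** l - s N ** s N).
    rewrite [s N.+1]/= -[RHS]addrA -opprD -scalerDr; congr (_ - _ *: _).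
    by rewrite -addrA [s N ** s N + _]addrC subrK.
  have := rnormD (l - s N.+1) (- (2^-1 *: (l ** l - s N ** s N))).
  rewrite rnormN rnormZ half sq.
  have := rnormD (l ** (l - s N)) ((l - s N) ** s N).
  have := rnorm_cmul l (l - s N); have := rnorm_cmul (l - s N) (s N).
  have := NP N (leqnn _); have := NP N.+1 (leqnSn _).
  have := sn N; have := rnorm_ge0 (l - s N); have := rnorm_ge0 l; have := rnorm_ge0 (s N).
  move: (rnorm _) (rnorm _) (rnorm _) (rnorm _) (rnorm _) (rnorm _) (rnorm _) (rnorm _).
  by move=> x1 x2 x3 x4 x5 x6 x7 x8; nra.
have lC : c ** l = l ** c.
  apply: (@rnorm_eq_eps _ _ _ _ (2 * rnorm c)) => d d0.
  have [N NP] := lP d d0; have {}NP := NP N (leqnn _).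
  have -> : c ** l - l ** c = c ** (l - s N) - (l - s N) ** c.
    by rewrite cmulBr cmulBl sC opprB addrA subrK.
  rewrite (le_trans (rnormD _ _))// rnormN.
  have := rnorm_cmul c (l - s N); have := rnorm_cmul (l - s N) c; have := rnorm_ge0 c.
  by move: NP; move: (rnorm _) (rnorm _) (rnorm _) (rnorm _) => x1 x2 x3 x4; nra.
have lS : star l = l.
  apply: (@rnorm_eq_eps _ _ _ _ 2) => d d0.
  have [N NP] := lP d d0; have {}NP := NP N (leqnn _).
  have -> : star l - l = star (l - s N) - (l - s N).
    by rewrite starB sS opprB addrA subrK.
  rewrite (le_trans (rnormD _ _))// rnormN rnorm_star; lra.
have eS := star_unit e1l.
pose i := (0 +i* 1 : R[i]).
have iS : i^* = - i by apply/eqP; rewrite eq_complex /= oppr0 !eqxx.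
have ii : i * i = -1.
  by apply/eqP; rewrite eq_complex /=; apply/andP; split; apply/eqP; ring.
pose m := e - l.
have mS : star m = m by rewrite starB eS lS.
have mC : c ** m = m ** c by rewrite cmulBl cmulBr e1l e1r lC.
have mm : c ** c + m ** m = e.
  rewrite /m cmulBl !cmulBr e1l !e1r e1l.
  have l2 : c ** c + l ** l = l + l.
    rewrite {3 4}lE -scalerDl (_ : _ + _ = 1) ?scale1r//.
    by rewrite -[2^-1]mul1r -splitr.
  have -> : c ** c = l + l - l ** l by rewrite -l2 addrK.
  rewrite -[l + l - _]addrA; move: (l - l ** l) => z.
  by rewrite -[e - l - z]addrA -(opprD l z) [LHS]addrC subrK.
have uS : star (c + i *: m) = c - i *: m by rewrite starD cc starZ mS iS scaleNr.
exists (c + i *: m); rewrite uS; split.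
- rewrite cmulBl !cmulDr !(cmulZl, cmulZr) scalerA ii scaleN1r mC -mm.
  by rewrite opprD opprK addrA addrK.
- rewrite cmulBr !cmulDl !(cmulZl, cmulZr) scalerA ii scaleN1r mC -mm.
  by rewrite opprD opprK addrA addrK.
- rewrite addrACA subrr addr0 scalerDr -scalerDl (_ : _ + _ = 1) ?scale1r//.
  by rewrite -[2^-1]mul1r -splitr.
Qed.

Record tensor_map (R : realType) (A B D : cstarAlgType R) (t : A -> B -> D) : Prop :=
TensorMap {
  tmap_linearl : forall b, linear (t^~ b);
  tmap_linearr : forall a, linear (t a);
  tmapM : forall a a' b b', t (a ** a') (b ** b') = t a b ** t a' b';
  tmapS : forall a b, t (star a) (star b) = star (t a b);
  tmap_dense : closure (lspan (range (fun p => t p.1 p.2))) = setT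
}.

Lemma is_tensor_product_map (R : realType) (A B D : cstarAlgType R) (t : A -> B -> D) :
  is_tensor_product t -> tensor_map t.
Proof.
case=> tl tr tM tS _ td; split=> //; rewrite -td; congr (closure (lspan _)).
apply/seteqP; split=> [_ [[a b] _ <-]|_ [a [b ->]]]; first by exists a, b.
by exists (a, b).
Qed.

Lemma tensor_map_swap (R : realType) (A B D : cstarAlgType R) (t : A -> B -> D) :
  tensor_map t -> tensor_map (fun b a => t a b).
Proof.
case=> tl tr tM tS td; split=> [//|//|a a' b b'|//|]; first exact: tM.
rewrite -td; congr (closure (lspan _)).
by apply/seteqP; split=> [_ [[a b] _ <-]|_ [[a b] _ <-]]; exists (b, a).
Qed.

Section tensor_multipliers.
Variables (R : realType) (A B D : cstarAlgType R) (t : A -> B -> D).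
Hypothesis tP : tensor_map t.

Lemma tmapDr a b b' : t a (b + b') = t a b + t a b'.
Proof. by have := tmap_linearr tP a 1 b b'; rewrite !scale1r. Qed.
Lemma tmapDl a a' b : t (a + a') b = t a b + t a' b.
Proof. by have := tmap_linearl tP b 1 a a'; rewrite !scale1r. Qed.
Lemma tmap0r a : t a 0 = 0.
Proof. by apply: (addrI (t a 0)); rewrite -tmapDr !addr0. Qed.
Lemma tmap0l b : t 0 b = 0.
Proof. by apply: (addrI (t 0 b)); rewrite -tmapDl !addr0. Qed.
Lemma tmapZr c a b : t a (c *: b) = c *: t a b.
Proof. by have := tmap_linearr tP a c b 0; rewrite tmap0r !addr0. Qed.
Lemma tmapZl c a b : t (c *: a) b = c *: t a b.
Proof. by have := tmap_linearl tP b c a 0; rewrite tmap0l !addr0. Qed.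
Lemma tmapBr a b b' : t a (b - b') = t a b - t a b'.
Proof. by rewrite tmapDr -scaleN1r tmapZr scaleN1r. Qed.

Lemma tmap_ext (X Y : multiplier D) :
  (forall a b, X (t a b) = Y (t a b)) -> X = Y.
Proof. by move=> XY; apply: (multiplier_ext (tmap_dense tP)) => -[a b] /=. Qed.

(** Isometries preserve the inner products of elementary tensors, so [m (x) s] is bounded for
    whatever C*-norm [D] carries. *)
Lemma isometry_tensor (m : multiplier A) (s : multiplier B) :
  star m ** m = op_one _ -> star s ** s = op_one _ ->
  exists X : multiplier D, [/\ forall a b, X (t a b) = t (m a) (s b),
    forall a b, op_adj X (t a b) = t (op_adj m a) (op_adj s b) & rnorm X <= 1].
Proof.
move=> mm ss.
have iso (E : cstarAlgType R) (u : multiplier E) x y :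
    star u ** u = op_one _ -> star (u x) ** u y = star x ** y.
  move=> uu; have := op_adjE u (u x) y; rewrite /= => <-.
  by have -> : op_adj u (u x) = (star u ** u) x by []; rewrite uu.
have [||X [X1 X2 X3]] := @isometric_multiplier _ _ _ (fun p : A * B => t p.1 p.2)
    (fun p => t (m p.1) (s p.2)) (fun p => t (op_adj m p.1) (op_adj s p.2)) _ _
    (tmap_dense tP).
- move=> [a b] [a' b'] /=; rewrite -!(tmapS tP) -!(tmapM tP).
  by congr t; [exact: (op_adjE m a a')|exact: (op_adjE s b b')].
- move=> [a b] [a' b'] /=; rewrite -!(tmapS tP) -!(tmapM tP).
  by congr t; exact: iso.
exists X; split=> // a b; first exact: (X1 (a, b)).
exact: (X2 (a, b)).
Qed.

Let right_mult (b : B) (X : multiplier D) :=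
  (forall x y, X (t x y) = t x (b ** y)) /\
  (forall x y, op_adj X (t x y) = t x (star b ** y)).

Let right_mult_lin c b b' X X' : right_mult b X -> right_mult b' X' ->
  right_mult (c *: b + b') (c *: X + X').
Proof.
move=> [X1 X2] [X1' X2']; split=> x y /=.
  by rewrite X1 X1' cmulDl cmulZl tmapDr tmapZr.
by rewrite X2 X2' starD starZ cmulDl cmulZl tmapDr tmapZr.
Qed.

Let right_mult0 : right_mult 0 0.
Proof. by split=> x y /=; rewrite ?star0 cmul0r tmap0r. Qed.

(** No bound on elementary tensors is known yet, so [1 (x) b] cannot be extended by continuity
    directly. A multiple of [b] of norm at most [1 / 2] is the average of a unitary of [M(B)] and
    its adjoint, and [isometry_tensor] covers these two. *)
Let right_mult_sa b : star b = b -> exists X, right_mult b X.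
Proof.
move=> bb; pose c : R[i] := ((2 * (rnorm b + 1))^-1)%:C.
have b0 : 0 < 2 * (rnorm b + 1) by rewrite mulr_gt0// ltr_wpDl ?rnorm_ge0.
have c0 : c != 0 by rewrite /c fmorph_eq0 invr_eq0 gt_eqF.
have cc : star (c *: b) = c *: b.
  rewrite starZ bb; congr (_ *: b).
  by apply/eqP; rewrite eq_complex /= oppr0 !eqxx.
have cn : rnorm (c *: b) <= 1 / 2.
  rewrite rnormZ rnorm_real ger0_norm ?invr_ge0 ?(ltW b0)// mulrC.
  by rewrite ler_pdivrMr//; lra.
have o1 := @op_onel _ _ _ (cstar_ip B); have o2 := @op_oner _ _ _ (cstar_ip B).
have [||U [uu uu' uE]] := @sa_average_unitary _ _ _ (left_mul (c *: b)) o1 o2.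
- by rewrite -left_mul_star cc.
- by rewrite rnorm_left_mul.
have e1 : star (op_one (cstar_ip A)) ** op_one (cstar_ip A) = op_one _.
  exact: adjop_eqP.
have [X [X1 X2 _]] := isometry_tensor e1 uu.
have [|X' [X1' X2' _]] := @isometry_tensor _ (star U) e1; first by rewrite starK.
have half : (2^-1 : R[i])^* = 2^-1 by rewrite fmorphV rmorph_nat.
have good : right_mult (c *: b) (2^-1 *: (X + X')).
  split=> x y /=.
    rewrite X1 X1' /= -tmapDr -tmapZr.
    by have -> : c *: b ** y = left_mul (c *: b) y by []; rewrite uE.
  rewrite X2 X2' /= half -tmapDr -tmapZr cc.
  have -> : c *: b ** y = left_mul (c *: b) y by [].
  by rewrite uE /= addrC.
exists (c^-1 *: (2^-1 *: (X + X')) + 0).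
have := right_mult_lin c^-1 good right_mult0.
by rewrite [c^-1 *: (c *: b)]scalerA mulVf// scale1r [b + 0]addr0.
Qed.

Let right_mult_exists b : exists X, right_mult b X.
Proof.
pose i := (0 +i* 1 : R[i]).
have iS : (- i)^* = i by apply/eqP; rewrite eq_complex /= oppr0 opprK !eqxx.
have ii : i * i = -1.
  by apply/eqP; rewrite eq_complex /=; apply/andP; split; apply/eqP; ring.
have [|X XP] := @right_mult_sa (b + star b); first by rewrite starD starK addrC.
have [|Y YP] := @right_mult_sa (- i *: (b - star b)).
  by rewrite starZ iS starB starK -opprB scalerN scaleNr.
have H := right_mult_lin 2^-1 XP (right_mult_lin (2^-1 * i) YP right_mult0).
exists (2^-1 *: X + ((2^-1 * i) *: Y + 0)).
move: H; rewrite [X in right_mult X _ -> _](_ : _ = b)//.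
rewrite addr0 scalerA mulrN -mulrA ii mulrN1 opprK -scalerDr addrACA subrr addr0.
by rewrite scalerDr -scalerDl (_ : _ + _ = 1) ?scale1r// -[2^-1]mul1r -splitr.
Qed.

Lemma tensor_right_hom : exists rho : B -> multiplier D, star_hom rho /\
  forall b x y, rho b (t x y) = t x (b ** y).
Proof.
have /choice[rho rhoP] := right_mult_exists.
have r1 b x y : rho b (t x y) = t x (b ** y) by have [] := rhoP b.
have r2 b x y : op_adj (rho b) (t x y) = t x (star b ** y) by have [] := rhoP b.
exists rho; split=> //; split=> [c b b'|b b'|b]; apply: tmap_ext => x y /=.
- by rewrite !r1 cmulDl cmulZl tmapDr tmapZr.
- by rewrite !r1 cmulA.
- by rewrite r1 r2.
Qed.

End tensor_multipliers.

(** The multiplier [a (x) b] is the product of [a (x) 1] and [1 (x) b], the images of [a] and [b]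
    under star-homomorphisms, which are contractive. *)
Lemma tensor_norm_le (R : realType) (A B D : cstarAlgType R) (t : A -> B -> D) a b :
  tensor_map t -> rnorm (t a b) <= rnorm a * rnorm b.
Proof.
move=> tP; have [rho [rhoH rhoP]] := tensor_right_hom tP.
have [lam [lamH lamP]] := tensor_right_hom (tensor_map_swap tP).
rewrite -rnorm_left_mul.
have -> : left_mul (t a b) = lam a ** rho b.
  by apply: (tmap_ext tP) => x y /=; rewrite rhoP lamP (tmapM tP).
rewrite (le_trans (rnorm_cmul _ _))//.
by apply: ler_pM; rewrite ?rnorm_ge0 ?star_hom_contractive.
Qed.

Lemma tensor_dense_right (R : realType) (A B D : cstarAlgType R) (t : A -> B -> D)
    (I : Type) (b : I -> B) :
  tensor_map t -> closure (lspan (range b)) = setT ->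
  closure (lspan (range (fun p : A * I => t p.1 (b p.2)))) = setT.
Proof.
move=> tP bd; apply/seteqP; split=> // x _.
have : closure (lspan (range (fun p => t p.1 p.2))) x by rewrite (tmap_dense tP).
apply: closure_lspan_sub => _ [[a y] _ <-] /=; apply/closure_rnorm => e e0.
have a0 : 0 < rnorm a + 1 by rewrite ltr_wpDl ?rnorm_ge0.
have : closure (lspan (range b)) y by rewrite bd.
move=> /closure_rnorm /(_ _ (divr_gt0 e0 a0))[z zb yz]; exists (t a z); last first.
  rewrite -tmapBr// (le_lt_trans (tensor_norm_le _ _ tP))//.
  rewrite ltr_pdivlMr// in yz; apply: le_lt_trans yz.
  by rewrite mulrC ler_wpM2l ?rnorm_ge0// lerDl.
have [S0 Sl] := lspan_subspace (range (fun p : A * I => t p.1 (b p.2))).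
move: z zb {yz}; apply: lspan_ind.
  split=> [|c u v uE vE] /=; first by rewrite tmap0r.
  by rewrite tmapDr// tmapZr//; exact: Sl.
by move=> _ [i _ <-] /=; apply: sub_lspan; exists (a, i).
Qed.

(** * Matrix units of the compact operators *)

Section matrix_units.
Variable R : realType.
Local Notation H := (ell2 R).
Implicit Types x y : H.

Lemma series_single (u : nat -> R) n : (forall k, k != n -> u k = 0) ->
  cvgn (series u) /\ limn (series u) = u n.
Proof.
move=> un; suff H : series u k @[k --> \oo] --> u n.
  by split; [apply/cvg_ex; exists (u n)|exact: cvg_lim].
apply: cvg_near_cst; exists n.+1 => // N /= nN.
rewrite /series /= (bigD1_seq n) ?iota_uniq ?mem_index_iota//=.
by rewrite big1 ?addr0// => k /un.
Qed.

Fact delta_summable n : square_summable (fun k => (k == n)%:R : R[i]).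
Proof.
apply: (proj1 (@series_single _ n _)) => k /negbTE kn /=.
by rewrite kn /sqmod /= expr0n /= addr0.
Qed.

Definition delta n : H := Ell2 (@delta_summable n).

Lemma dot_delta n x : ell2_dot (delta n) x = x n.
Proof.
rewrite /ell2_dot /csum.
have z k : k != n -> (delta n k)^* * x k = 0.
  by move=> /negbTE kn; rewrite /= kn conjC0 mul0r.
have o : (delta n n)^* * x n = x n by rewrite /= eqxx conjC1 mul1r.
have [|_ ->] := @series_single (@complex.Re R \o (fun k => (delta n k)^* * x k)) n.
  by move=> k /z /(congr1 (@complex.Re R)).
have [|_ ->] := @series_single (@complex.Im R \o (fun k => (delta n k)^* * x k)) n.
  by move=> k /z /(congr1 (@complex.Im R)).
by rewrite [X in X +i* _]/= [X in _ +i* X]/= o; case: (x n).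
Qed.

Lemma ell2_norm_le1_delta n : rnorm (delta n) <= 1.
Proof.
rewrite /rnorm ell2_normE /= /ell2_norm /ell2_sq.
have [|_ ->] := @series_single (@sqmod R \o delta n) n.
  by move=> k /negbTE kn /=; rewrite kn /sqmod /= expr0n /= addr0.
by rewrite /= eqxx /sqmod /= expr1n expr0n /= addr0 sqrtr1.
Qed.

Definition trunc N x : H := \sum_(k < N) x k *: delta k.

Lemma trunc_coord N x j : trunc N x j = if (j < N)%N then x j else 0.
Proof.
rewrite /trunc; elim: N => [|N ih]; first by rewrite big_ord0.
rewrite big_ord_recr ell2DE ih ell2ZE ltnS [(j <= N)%N]leq_eqVlt /=.
have [->|jN] := eqVneq j N; first by rewrite ltnn mulr1 add0r.
by rewrite mulr0 addr0.
Qed.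

Lemma trunc_cvg x (e : R) : 0 < e -> exists N, rnorm (x - trunc N x) < e.
Proof.
move=> e0; have cx : cvgn (series (@sqmod R \o x)) by exact: ell2P.
have e20 : 0 < e ^+ 2 / 4 by rewrite divr_gt0// exprn_gt0.
have /cvgrPdist_lt /(_ _ e20)[N _ NP] : series (@sqmod R \o x) n @[n --> \oo] --> ell2_sq x.
  exact: cx.
exists N; have {NP} /ltW := NP N (leqnn _).
have sN := partial_le_lim N (fun k => sqmod_ge0 (x k)) cx.
rewrite ger0_norm; last by rewrite subr_ge0.
move=> NP; rewrite /rnorm ell2_normE /=.
apply: (@le_lt_trans _ _ (e / 2)); last by lra.
rewrite -(@ler_pXn2r _ 2) ?nnegrE ?ell2_norm_ge0 ?divr_ge0 ?(ltW e0)// ell2_norm_sq.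
have -> : (e / 2) ^+ 2 = e ^+ 2 / 4 by rewrite !expr2; lra.
apply: le_trans NP; rewrite /ell2_sq.
have [||_] // := @lim_series_le_bound R (@sqmod R \o (x - trunc N x))
  (ell2_sq x - series (@sqmod R \o x) N).
  by move=> k; exact: sqmod_ge0.
move=> n; rewrite lerBrDr.
have z k : (k < N)%N -> (@sqmod R \o (x - trunc N x)) k = 0.
  by move=> kN; rewrite -[LHS]/(sqmod ((x - trunc N x) k)) ell2BE trunc_coord kN subrr /sqmod /= expr0n /= addr0.
have z' k : (N <= k)%N -> (@sqmod R \o (x - trunc N x)) k = sqmod (x k).
  by move=> kN; rewrite -[LHS]/(sqmod ((x - trunc N x) k)) ell2BE trunc_coord ltnNge kN subr0.
have [nN|Nn] := leqP n N.
  rewrite big_nat big1 ?add0r// => k /andP[_ kn]; apply: z.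
  exact: leq_trans nN.
rewrite (big_cat_nat (n := N))//=; last exact: ltnW.
rewrite big_nat big1 => [|k /andP[_ kn]]; last exact: z.
rewrite add0r.
have -> : \sum_(N <= i < n) sqmod ((x - trunc N x) i) = \sum_(N <= i < n) sqmod (x i).
  by apply: eq_big_nat => k /andP[kN _]; exact: z'.
rewrite addrC /series /= -big_cat_nat//; last exact: ltnW.
exact: (partial_le_lim n (fun k => sqmod_ge0 (x k)) cx).
Qed.

Lemma rnorm_rank_one x y : rnorm (rank_one x y) <= rnorm x * rnorm y.
Proof.
rewrite op_rnormE; apply: opnorm_le => [|v]; last exact: rank_one_bounded.
by rewrite mulr_ge0 ?rnorm_ge0.
Qed.

Lemma rank_oneDl x x' y : rank_one (x + x') y = rank_one x y + rank_one x' y.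
Proof. by apply: adjop_eqP => v /=; rewrite scalerDr. Qed.
Lemma rank_oneZl c x y : rank_one (c *: x) y = c *: rank_one x y.
Proof. by apply: adjop_eqP => v /=; rewrite !scalerA mulrC. Qed.
Lemma rank_oneDr x y y' : rank_one x (y + y') = rank_one x y + rank_one x y'.
Proof. by apply: adjop_eqP => v /=; rewrite ell2_dotDl scalerDl. Qed.
Lemma rank_oneZr c x y : rank_one x (c *: y) = c^* *: rank_one x y.
Proof. by apply: adjop_eqP => v /=; rewrite ell2_dotZl scalerA. Qed.
Lemma rank_oneM x y u v : rank_one x y ** rank_one u v = ell2_dot y u *: rank_one x v.
Proof. by apply: adjop_eqP => z /=; rewrite ell2_dotZr scalerA mulrC. Qed.
Lemma rank_one_star x y : star (rank_one x y) = rank_one y x.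
Proof. exact: adjop_eqP. Qed.

Lemma finite_rank_closure (T : adjop (ell2_ip R)) : closure (finite_rank (R := R)) T ->
  closure (lspan (range (fun p => rank_one (delta p.1) (delta p.2)))) T.
Proof.
apply: closure_lspan_sub => _ [x [y ->]]; apply/closure_rnorm => e e0.
have x0 : 0 < rnorm x + rnorm y + 1 by rewrite ltr_wpDl ?addr_ge0 ?rnorm_ge0.
pose d := Num.min 1 (e / (rnorm x + rnorm y + 1)).
have d0 : 0 < d by rewrite lt_min ltr01 divr_gt0.
have d1 : d <= 1 by rewrite ge_min lexx.
have dE : d * (rnorm x + rnorm y + 1) <= e by rewrite -ler_pdivlMr// ge_min lexx orbT.
have [N xN] := trunc_cvg x d0; have [M yM] := trunc_cvg y d0.
have tr (K : nat) z : lspan (range delta) (trunc K z).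
  rewrite /trunc; have [S0 Sl] := lspan_subspace (range delta).
  elim: K => [|K ih]; first by rewrite big_ord0.
  rewrite big_ord_recr /= addrC; apply: Sl ih; by apply: sub_lspan; exists K.
exists (rank_one (trunc N x) (trunc M y)).
  apply: (@lspan_map R _ _ (rank_one (trunc N x)) (@Num.conj _) (range delta) _ _ _ _ _ (tr _ _)).
  - by move=> u v; rewrite rank_oneDr.
  - by move=> c u; rewrite rank_oneZr.
  move=> _ [j _ <-].
  apply: (@lspan_map R _ _ (fun u => rank_one u (delta j)) id (range delta) _ _ _ _ _ (tr _ _)).
  - by move=> u v; rewrite rank_oneDl.
  - by move=> c u; rewrite rank_oneZl.
  by move=> _ [i _ <-]; apply: sub_lspan; exists (i, j).
have -> : rank_one x y - rank_one (trunc N x) (trunc M y) =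
    rank_one (x - trunc N x) (trunc M y) + rank_one x (y - trunc M y).
  have nl (u v w : H) : rank_one (u - v) w = rank_one u w - rank_one v w.
    by rewrite rank_oneDl -scaleN1r rank_oneZl scaleN1r.
  have nr (u v w : H) : rank_one w (u - v) = rank_one w u - rank_one w v.
    by rewrite rank_oneDr -scaleN1r rank_oneZr rmorphN1 scaleN1r.
  by rewrite nl nr [RHS]addrC addrA subrK.
have ty : rnorm (trunc M y) <= rnorm y + 1.
  by rewrite (le_trans (rnormB_le _ y))// lerD2l rnormC ltW// (lt_le_trans yM).
apply: le_lt_trans (rnormD _ _) _; apply: lt_le_trans dE.
have := rnorm_rank_one (x - trunc N x) (trunc M y).
have := rnorm_rank_one x (y - trunc M y).
have := rnorm_ge0 x; have := rnorm_ge0 y; have := rnorm_ge0 (x - trunc N x).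
have := rnorm_ge0 (y - trunc M y); have := rnorm_ge0 (trunc M y).
move: xN yM ty; move: (rnorm _) (rnorm _) (rnorm _) (rnorm _) (rnorm _) => a b c f g.
move: (rnorm _) (rnorm _) => h k; nra.
Qed.

Fact munit_compact m n : closure (finite_rank (R := R)) (rank_one (delta m) (delta n)).
Proof. by apply: subset_closure; apply: sub_lspan; exists (delta m), (delta n). Qed.

Definition munit m n : compacts R := SubCStar _ (@munit_compact m n).

Lemma munitM m n k l : munit m n ** munit k l = if n == k then munit m l else 0.
Proof.
apply: subcstar_inj => /=; rewrite rank_oneM dot_delta /=.
by case: eqP => _ /=; rewrite ?scale1r ?scale0r.
Qed.

Lemma munit_star m n : star (munit m n) = munit n m.
Proof. by apply: subcstar_inj; exact: rank_one_star. Qed.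

Lemma rnorm_munit m n : rnorm (munit m n) <= 1.
Proof.
have -> : rnorm (munit m n) = rnorm (rank_one (delta m) (delta n)) by [].
rewrite (le_trans (rnorm_rank_one _ _))//.
have := ell2_norm_le1_delta m; have := ell2_norm_le1_delta n.
have := rnorm_ge0 (delta m); have := rnorm_ge0 (delta n).
by move: (rnorm _) (rnorm _) => a b; nra.
Qed.

Lemma munit_neq0 n : munit n n <> 0.
Proof.
move=> /(congr1 (fun T : compacts R => subcstar_val T (delta n) n)) /=.
rewrite dot_delta /= eqxx mulr1 => /eqP; apply/negP.
exact: oner_neq0.
Qed.

Lemma munit_dense : closure (lspan (range (fun p => munit p.1 p.2))) = setT.
Proof.
apply/seteqP; split=> // T _; apply/closure_rnorm => e e0.
have := finite_rank_closure (subcstarP T).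
move=> /closure_rnorm /(_ e e0)[S SE TS].
suff [S' S'E SS'] : exists2 S' : compacts R, lspan (range (fun p => munit p.1 p.2)) S' &
    subcstar_val S' = S.
  by exists S' => //; rewrite sub_rnormB SS'.
have [L0 Ll] := lspan_subspace (range (fun p => munit p.1 p.2)).
move: S SE {TS}; apply: lspan_ind.
  split=> [|c x y [u uL <-] [v vL <-]]; first by exists 0.
  by exists (c *: u + v) => //; exact: Ll.
by move=> _ [p _ <-]; exists (munit p.1 p.2) => //; apply: sub_lspan; exists p.
Qed.

End matrix_units.

(** * Crossed products *)

Section subalgebra_lemmas.
Variables (R : realType) (C : cstarAlgType R).

Lemma subalgebra_dense (I : Type) (S : set C) (cB : is_cstar_subalgebra (closure (lspan S)))
    (s : I -> subalgebra cB) :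
  (forall x, S x -> exists i, x = subcstar_val (s i)) ->
  closure (lspan (range s)) = setT.
Proof.
move=> Ss; apply/seteqP; split=> // T _; apply/closure_rnorm => e e0.
have := subcstarP T; move=> /closure_rnorm /(_ e e0)[z zS Tz].
suff [z' z'S zz'] : exists2 z', lspan (range s) z' & subcstar_val z' = z.
  by exists z' => //; rewrite sub_rnormB zz'.
have [L0 Ll] := lspan_subspace (range s).
move: z zS {Tz}; apply: lspan_ind.
  split=> [|c x y [u uL <-] [v vL <-]]; first by exists 0.
  by exists (c *: u + v) => //; exact: Ll.
by move=> x /Ss[i ->]; exists (s i) => //; apply: sub_lspan; exists i.
Qed.

Lemma closure_lspan_mull (S : set C) (v : C) :
  (forall x, S x -> lspan S (v ** x)) ->
  forall x, closure (lspan S) x -> closure (lspan S) (v ** x).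
Proof.
move=> vS x /closure_rnorm xS; apply/closure_rnorm => e e0.
have v0 : 0 < rnorm v + 1 by rewrite ltr_wpDl ?rnorm_ge0.
have [y yS xy] := xS _ (divr_gt0 e0 v0); exists (v ** y).
  apply: (@lspan_map R _ _ (cmul v) id S) yS => //; first by move=> ? ?; exact: cmulDr.
  by move=> ? ?; exact: cmulZr.
rewrite -cmulBr (le_lt_trans (rnorm_cmul _ _))//.
rewrite ltr_pdivlMr// in xy; apply: le_lt_trans xy.
by rewrite mulrC ler_wpM2l ?rnorm_ge0// lerDl.
Qed.

Lemma subalgebra_multiplier (B : set C) (cB : is_cstar_subalgebra B) (v : C) :
  (forall x, B x -> B (v ** x)) -> (forall x, B x -> B (star v ** x)) ->
  exists X : multiplier (subalgebra cB),
    (forall x, subcstar_val (X x) = v ** subcstar_val x) /\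
    (forall x, subcstar_val (op_adj X x) = star v ** subcstar_val x).
Proof.
move=> Bv Bv'.
pose f (x : subalgebra cB) : subalgebra cB := SubCStar cB (Bv _ (subcstarP x)).
pose g (x : subalgebra cB) : subalgebra cB := SubCStar cB (Bv' _ (subcstarP x)).
have fg x y : cstar_ip _ (g x) y = cstar_ip _ x (f y).
  by apply: subcstar_inj; rewrite /= starM starK cmulA.
have fM x : rnorm (f x) <= rnorm v * rnorm x by exact: (@rnorm_cmul _ C).
by exists (make_adjop fg fM).
Qed.

End subalgebra_lemmas.

Section automorphism_powers.
Variables (R : realType) (A : cstarAlgType R) (alpha : automorphism A).

Lemma aut_powS (n : int) a : aut_pow alpha (1 + n) a = alpha (aut_pow alpha n a).
Proof.
case: n => [n|[|n]]; first by rewrite -PoszD add1n.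
  by rewrite NegzE addrN /= aut_invK.
have -> : 1 + Negz n.+1 = Negz n.
  by rewrite !NegzE -[n.+2%:Z]/(Posz (1 + n.+1)%N) PoszD opprD addrA subrr add0r.
by rewrite /= aut_invK.
Qed.

Lemma aut_powP (n : int) a : aut_pow alpha (n - 1) a = aut_inv alpha (aut_pow alpha n a).
Proof.
have -> : aut_pow alpha n a = alpha (aut_pow alpha (n - 1) a).
  by rewrite -aut_powS addrC subrK.
by rewrite aut_funK.
Qed.

Lemma aut_powD (m n : int) a : aut_pow alpha (m + n) a = aut_pow alpha m (aut_pow alpha n a).
Proof.
elim/int_rect: m => [|m ih|m ih]; first by rewrite add0r.
  by rewrite -add1n PoszD -addrA aut_powS ih -aut_powS.
by rewrite -addn1 PoszD opprD addrAC !aut_powP ih.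
Qed.

Lemma aut_inv_star_hom : star_hom (aut_inv alpha).
Proof.
have aI : injective alpha := can_inj (@aut_funK _ _ alpha).
have aH := aut_star_hom alpha.
split=> [c x y|x y|x]; apply: aI.
- by rewrite (star_homD aH) (star_homZ aH) !aut_invK.
- by rewrite (star_homM aH) !aut_invK.
- by rewrite (star_homS aH) !aut_invK.
Qed.

Lemma aut_pow_star_hom n : star_hom (aut_pow alpha n).
Proof.
have it (f : A -> A) k : star_hom f -> star_hom (iter k f).
  move=> fH; elim: k => [|k ih] //; split=> [c x y|x y|x] /=.
  - by rewrite (star_homD ih) (star_homZ ih) star_homD// star_homZ.
  - by rewrite (star_homM ih) star_homM.
  - by rewrite (star_homS ih) star_homS.
case: n => n; first exact: it (aut_star_hom alpha).
exact: it aut_inv_star_hom.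
Qed.

End automorphism_powers.

Section crossed_product_norm.
Variables (R : realType) (A : cstarAlgType R) (alpha : automorphism A).
Variables (B : cstarAlgType R) (jA : A -> B) (jZ : int -> multiplier B).
Hypothesis BP : is_crossed_product alpha jA jZ.
Variables (C : cstarAlgType R) (e : C) (iota : A -> C) (u : int -> C).
Hypotheses (e1l : forall x : C, e ** x = x) (e1r : forall x : C, x ** e = x).
Hypotheses (iotaH : star_hom iota) (u0 : u 0 = e).
Hypotheses (uD : forall m n, u (m + n) = u m ** u n) (uS : forall n, star (u n) = u (- n)).
Hypothesis (cov : forall n a, iota (aut_pow alpha n a) = u n ** iota a ** star (u n)).

Let S := range (fun p : int * A => u p.1 ** iota p.2).

Let iota_u n a : iota (aut_pow alpha n a) ** u n = u n ** iota a.
Proof. by rewrite cov -cmulA uS -uD addNr u0 e1r. Qed.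

Let S_star_closed : star_closed (lspan S).
Proof.
split; first exact: lspan_subspace.
  apply: lspan_bilin => [y|x|].
  - by move=> c x x'; rewrite cmulDl cmulZl.
  - by move=> c y y'; rewrite cmulDr cmulZr.
  move=> _ _ [[n a] _ <-] [[m b] _ <-] /=; apply: sub_lspan.
  exists (n + m, aut_pow alpha (- m) a ** b) => //=.
  by rewrite star_homM// cov uS opprK !cmulA -uD -addrA subrr addr0 -!cmulA.
apply: (@lspan_map R _ _ (@star _ C) (@Num.conj _)) => [x y|c x|].
- exact: starD.
- exact: starZ.
move=> _ [[n a] _ <-] /=; apply: sub_lspan.
exists (- n, aut_pow alpha n (star a)) => //=.
by rewrite cov starM uS star_homS// !cmulA -uD addNr u0 e1l.
Qed.

Local Notation D := (subalgebra (closure_cstar_subalgebra S_star_closed)).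

Let gen_in n a : closure (lspan S) (u n ** iota a).
Proof. by apply: subset_closure; apply: sub_lspan; exists (n, a). Qed.

Let iota_in a : closure (lspan S) (iota a).
Proof. by rewrite -[iota a]e1l -u0. Qed.

Let rnorm_u n : rnorm (u n) <= 1.
Proof.
have := rnorm_cstar (u n); rewrite uS -uD addNr u0 => E.
have := rnorm_unit_le1 e1l; rewrite E => n1.
by rewrite -(@ler_pXn2r _ 2) ?nnegrE ?rnorm_ge0// expr1n.
Qed.

(** The universal property asks for a nondegenerate pair in a multiplier algebra. It is therefore
    applied to the C*-subalgebra [D] spanned by the [u_n iota(a)], on which the [u_n] act as
    multipliers although they may lie outside it. *)
Lemma crossed_product_norm_le p :
  lspan (range (fun q : int * A => (jZ q.1 (jA q.2), u q.1 ** iota q.2))) p ->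
  rnorm p.2 <= rnorm p.1.
Proof.
pose gen (q : int * A) : D := SubCStar _ (@gen_in q.1 q.2).
pose io a : D := SubCStar _ (@iota_in a).
pose pi a := left_mul (io a).
have uin n x : closure (lspan S) x -> closure (lspan S) (u n ** x).
  apply: closure_lspan_mull => _ [[m a] _ <-] /=; apply: sub_lspan.
  by exists (n + m, a) => //=; rewrite uD cmulA.
have /choice[U UP] : forall n, exists X : multiplier D,
    (forall x, subcstar_val (X x) = u n ** subcstar_val x) /\
    (forall x, subcstar_val (op_adj X x) = u (- n) ** subcstar_val x).
  by move=> n; rewrite -uS; apply: subalgebra_multiplier => x; rewrite ?uS; exact: uin.
have U1 n x : subcstar_val (U n x) = u n ** subcstar_val x by case: (UP n).
have U2 n x : subcstar_val (op_adj (U n) x) = u (- n) ** subcstar_val x by case: (UP n).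
have ioH : star_hom io.
  split=> [c x y|x y|x]; apply: subcstar_inj => /=.
  - by rewrite star_homD// star_homZ.
  - by rewrite star_homM.
  - by rewrite star_homS.
have piH : star_hom pi.
  split=> [c x y|x y|x].
  - by rewrite /pi (star_homD ioH) (star_homZ ioH) left_mulD left_mulZ.
  - by rewrite /pi (star_homM ioH) left_mulM.
  - by rewrite /pi (star_homS ioH) left_mul_star.
have gend : closure (lspan (range gen)) = setT.
  by apply: subalgebra_dense => _ [q _ <-]; exists q.
have pin : Defs.nondegenerate pi.
  apply/seteqP; split=> // x _; have : closure (lspan (range gen)) x by rewrite gend.
  apply: closure_lspan_sub => _ [[n a] _ <-]; apply/closure_rnorm => d d0.
  (* Nondegeneracy: [u_n iota(a) = iota(alpha^n a) u_n], and writing [alpha^n a] nearly as [y z]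
     splits off the factor [iota(y)]. *)
  have [y [z yz]] := cmul_dense (aut_pow alpha n a) d0.
  exists (pi y (gen (n, aut_pow alpha (- n) z))).
    by apply: sub_lspan; exists y, (gen (n, aut_pow alpha (- n) z)).
  rewrite sub_rnormB /= -iota_u -[u n ** iota (aut_pow _ _ _)]iota_u -aut_powD addrN /=.
  rewrite cmulA -star_homM// -cmulBl -star_homB//.
  rewrite (le_lt_trans (rnorm_cmul _ _))//; apply: le_lt_trans yz.
  rewrite -[leRHS]mulr1 ler_pM ?rnorm_ge0//.
  exact: star_hom_contractive.
have Ur : unitary_rep U.
  split=> [|m n|m]; apply: adjop_eqP => x; apply: subcstar_inj => /=.
  - by rewrite U1 u0 e1l.
  - by rewrite !U1 uD cmulA.
  - by rewrite U1 U2.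
have Uc : covariant alpha pi U.
  move=> n a; apply: adjop_eqP => x; apply: subcstar_inj => /=.
  by rewrite U1 /= U2 cov uS !cmulA.
have [Phi [PhiH _ PhiA PhiZ]] := crossed_universal BP piH pin Ur Uc.
(* [Phi] maps the first coordinate to left multiplication by the second, and [left_mul] is
   isometric. *)
move=> pS; suff [c cE cP] : exists2 c : D, subcstar_val c = p.2 & Phi p.1 = left_mul c.
  have -> : rnorm p.2 = rnorm c by rewrite -cE.
  by rewrite -rnorm_left_mul -cP star_hom_contractive.
move: p pS; apply: lspan_ind.
  split=> [|c x y [v vE vP] [w wE wP]].
    by exists 0 => //=; rewrite star_hom0// (star_hom0 (@left_mul_star_hom _ _)).
  exists (c *: v + w) => /=; first by rewrite vE wE.
  by rewrite star_homD// star_homZ// vP wP left_mulD left_mulZ.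
move=> _ [[n a] _ <-] /=; exists (U n (io a)); first by rewrite U1.
by rewrite PhiZ PhiA mul_left_mul.
Qed.

End crossed_product_norm.

Lemma tensor_eq0 (R : realType) (A B D : cstarAlgType R) (t : A -> B -> D) a b :
  is_tensor_product t -> b <> 0 -> t a b = 0 -> a = 0.
Proof.
move=> tP b0 tab.
apply: (@tensor_inj _ _ _ _ _ tP 1 (fun=> a) (fun=> b)); last exact: ord0.
  move=> c; rewrite big_ord1 => /eqP; rewrite scaler_eq0 => /orP[/eqP c0 i|/eqP//].
  by rewrite ord1.
by rewrite big_ord1.
Qed.

(** A bijection that lets the matrix units of [l^2(N)] carry the two-sided shift of [l^2(Z)]. *)
Definition nat_to_int (n : nat) : int := if odd n then Negz n./2 else Posz n./2.
Definition int_to_nat (n : int) : nat :=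
  match n with Posz m => m.*2 | Negz m => m.*2.+1 end.

Lemma nat_to_intK : cancel nat_to_int int_to_nat.
Proof.
move=> n; rewrite -[RHS](odd_double_half n) /nat_to_int.
by case: (odd n).
Qed.

Lemma int_to_natK : cancel int_to_nat nat_to_int.
Proof. by case=> n; rewrite /nat_to_int /= ?odd_double ?uphalf_double ?doubleK. Qed.

(** * The regular representation and the injectivity of [jA] *)

Section crossed_product_faithful.
Variables (R : realType) (A : cstarAlgType R) (alpha : automorphism A).
Variables (AK : cstarAlgType R) (tK : A -> compacts R -> AK).
Hypothesis AKP : is_tensor_product tK.
Local Notation E := (@munit R).

Let tP := is_tensor_product_map AKP.

Let g (p : A * (nat * nat)) : AK := tK p.1 (E p.2.1 p.2.2).

Lemma tensor_compacts_dense : closure (lspan (range g)) = setT.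
Proof. exact: (tensor_dense_right tP (@munit_dense R)). Qed.

Lemma tensor_compacts_ext (X Y : multiplier AK) :
  (forall a m n, X (tK a (E m n)) = Y (tK a (E m n))) -> X = Y.
Proof.
by move=> XY; apply: (multiplier_ext tensor_compacts_dense) => -[a [m n]]; exact: XY.
Qed.

Let tKM a b m n k l : tK a (E m n) ** tK b (E k l) = if n == k then tK (a ** b) (E m l) else 0.
Proof. by rewrite -(tmapM tP) munitM; case: eqP => // _; rewrite (tmap0r tP). Qed.

Let tKS a m n : star (tK a (E m n)) = tK (star a) (E n m).
Proof. by rewrite -(tmapS tP) munit_star. Qed.

Let beta (m : nat) := aut_pow alpha (- nat_to_int m).

(** The cut of the regular representation to the first [N] positions, the entry at the position
    coded by [m] being [beta m a]. Unlike the full diagonal, it has values in [AK] itself. *)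
Let diag N a : AK := \sum_(m < N) tK (beta m a) (E m m).

Let diag_star_hom N : star_hom (diag N).
Proof.
have bH m : star_hom (beta m) := aut_pow_star_hom alpha _.
split=> [c x y|x y|x].
- rewrite /diag scaler_sumr -big_split; apply: eq_bigr => m _ /=.
  by rewrite (star_homD (bH m)) (star_homZ (bH m)) (tmapDl tP) (tmapZl tP).
- rewrite /diag cmul_suml; apply: eq_bigr => m _.
  rewrite cmul_sumr (bigD1 m)//= tKM eqxx (star_homM (bH m)) big1 ?addr0// => k km.
  by rewrite tKM; case: eqP => // mk; case/eqP: km; exact/esym/val_inj.
- rewrite /diag star_sum; apply: eq_bigr => m _.
  by rewrite (star_homS (bH m)) tKS.
Qed.

Let diag_mul N a x k l : (k < N)%N -> diag N a ** tK x (E k l) = tK (beta k a ** x) (E k l).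
Proof.
move=> kN; rewrite /diag cmul_suml (bigD1 (Ordinal kN))//= tKM eqxx big1 ?addr0// => m mk.
by rewrite tKM -[k]/(val (Ordinal kN)) val_eqE (negbTE mk).
Qed.

(** Boundedness comes from the cuts: on a given finite span [pi a] agrees with multiplication by
    [diag M a] for all large [M], and each [diag M] is a star-homomorphism, hence contractive. *)
Lemma diagonal_representation : exists pi : A -> multiplier AK, star_hom pi /\
  forall a x k l, pi a (tK x (E k l)) = tK (beta k a ** x) (E k l).
Proof.
have bH m : star_hom (beta m) := aut_pow_star_hom alpha _.
have /choice[pi piP] : forall a, exists X : multiplier AK,
    (forall x k l, X (tK x (E k l)) = tK (beta k a ** x) (E k l)) /\
    (forall x k l, op_adj X (tK x (E k l)) = tK (beta k (star a) ** x) (E k l)).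
  move=> a; pose f b p : AK := tK (beta p.2.1 b ** p.1) (E p.2.1 p.2.2).
  have [||X [X1 X2 _]] := @multiplier_exists _ _ _ g (f a) (f (star a)) (rnorm a)
      (rnorm_ge0 _) _ tensor_compacts_dense.
  - move=> [x [k l]] [y [i j]]; rewrite /g /f /= !tKS !tKM.
    case: eqP => // <-; rewrite (star_homS (bH k)) starM starK.
    by rewrite cmulA.
  - move=> p pG; suff [N NP] : exists N, forall M, (N <= M)%N -> p.2 = diag M a ** p.1.
      rewrite (NP N)// (le_trans (rnorm_cmul _ _))// ler_wpM2r ?rnorm_ge0//.
      exact: star_hom_contractive (diag_star_hom N) a.
    move: p pG; apply: lspan_ind.
      split=> [|c x y [N NP] [M MP]]; first by exists 0 => M _; rewrite cmulr0.
      exists (maxn N M) => K; rewrite geq_max => /andP[NK MK] /=.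
      by rewrite cmulDr cmulZr -NP// -MP.
    move=> _ [[x [k l]] _ <-]; exists k.+1 => M kM.
    by rewrite /g /f /= diag_mul.
  exists X; split=> x k l; first exact: (X1 (x, (k, l))).
  exact: (X2 (x, (k, l))).
have P1 a x k l : pi a (tK x (E k l)) = tK (beta k a ** x) (E k l) by case: (piP a).
have P2 a x k l : op_adj (pi a) (tK x (E k l)) = tK (beta k (star a) ** x) (E k l).
  by case: (piP a).
exists pi; split=> //; split=> [c a b|a b|a]; apply: tensor_compacts_ext => x k l /=.
- by rewrite !P1 (star_homD (bH k)) (star_homZ (bH k)) cmulDl cmulZl (tmapDl tP) (tmapZl tP).
- by rewrite !P1 (star_homM (bH k)) cmulA.
- by rewrite P1 P2.
Qed.

Let sh (n : int) (k : nat) := int_to_nat (nat_to_int k + n).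

Let shP n k i : (sh (- n) k == i) = (k == sh n i).
Proof.
apply/eqP/eqP => [<-|->]; first by rewrite /sh int_to_natK subrK nat_to_intK.
by rewrite /sh int_to_natK addrK nat_to_intK.
Qed.

Lemma bilateral_shift : exists u : int -> multiplier AK,
  (forall n, star (u n) = u (- n)) /\
  forall n x k l, u n (tK x (E k l)) = tK x (E (sh n k) l).
Proof.
have /choice[u uP] : forall n, exists X : multiplier AK,
    (forall x k l, X (tK x (E k l)) = tK x (E (sh n k) l)) /\
    (forall x k l, op_adj X (tK x (E k l)) = tK x (E (sh (- n) k) l)).
  move=> n; pose f m p : AK := tK p.1 (E (sh m p.2.1) p.2.2).
  have [||X [X1 X2 _]] := @isometric_multiplier _ _ _ g (f n) (f (- n)) _ _
      tensor_compacts_dense.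
  - move=> [x [k l]] [y [i j]]; rewrite /g /f /= !tKS !tKM.
    by rewrite shP.
  - move=> [x [k l]] [y [i j]]; rewrite /g /f /= !tKS !tKM.
    by rewrite -shP /sh int_to_natK addrK nat_to_intK.
  exists X; split=> x k l; first exact: (X1 (x, (k, l))).
  exact: (X2 (x, (k, l))).
exists u; split=> [n|n x k l]; last by case: (uP n).
apply: tensor_compacts_ext => x k l /=.
by case: (uP n) => _ ->; case: (uP (- n)) => -> _.
Qed.

(** The diagonal matrices and the two-sided shift form a covariant pair, so [jA b = 0] forces
    [pi b = 0] by the norm inequality. The entry of [pi b] at position [0] is [b] itself, and
    testing it on [b^*] gives [b b^* = 0]. *)
Lemma crossed_product_faithful (B : cstarAlgType R) (jA : A -> B) (jZ : int -> multiplier B) :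
  is_crossed_product alpha jA jZ -> injective jA.
Proof.
move=> BP.
have [pi [piH piP]] := diagonal_representation; have [u [uS uP]] := bilateral_shift.
have o1 := @op_onel _ _ _ (cstar_ip AK); have o2 := @op_oner _ _ _ (cstar_ip AK).
have u0 : u 0 = op_one _.
  by apply: tensor_compacts_ext => x k l; rewrite uP /sh addr0 nat_to_intK.
have uD m n : u (m + n) = u m ** u n.
  apply: tensor_compacts_ext => x k l /=; rewrite !uP /sh int_to_natK.
  by rewrite -addrA [n + m]addrC.
have cov n a : pi (aut_pow alpha n a) = u n ** pi a ** star (u n).
  apply: tensor_compacts_ext => x k l /=.
  rewrite -[op_adj (u n) _]/(star (u n) _) uS uP !piP uP /sh int_to_natK subrK nat_to_intK.
  by rewrite /beta int_to_natK opprB -aut_powD [n - _]addrC.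
have jH := crossed_jA_hom BP.
move=> a b ab; apply/eqP; rewrite -subr_eq0; apply/eqP.
have jab : jA (a - b) = 0 by rewrite star_homB// ab subrr.
move: (a - b) jab => {a ab} {}b jb.
have := @crossed_product_norm_le _ _ _ _ _ _ BP _ _ _ _ o1 o2 piH u0 uD uS cov
  (jZ 0 (jA b), u 0 ** pi b).
have gin : range (fun q : int * A => (jZ q.1 (jA q.2), u q.1 ** pi q.2))
    (jZ 0 (jA b), u 0 ** pi b) by exists (0, b).
move=> /(_ (sub_lspan gin)) /=.
rewrite jb op0 rnorm0 u0 o1 => pb0.
have {pb0} pb : pi b = 0.
  by apply/rnorm_eq0/eqP; rewrite eq_le rnorm_ge0 andbT.
have := piP b (star b) 0 0; rewrite pb /= /beta /= => /esym H.
have {H} bb : b ** star b = 0 by apply: tensor_eq0 AKP _ H; exact: munit_neq0.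
apply: rnorm_eq0; apply/eqP; rewrite -sqrf_eq0 -rnorm_cstar' bb; exact/eqP/rnorm0.
Qed.

End crossed_product_faithful.

(** * The Choi-Effros product *)

(* The Choi-Effros product [E (x y)] makes the range of a suitable            *)
(* contractive projection [E] of a C*-algebra into a C*-algebra.              *)
Record choi_effros_projection (R : realType) (A : cstarAlgType R) (E : A -> A) : Prop :=
ChoiEffrosProjection {
  ce_linear : linear E;
  ce_star : forall x, E (star x) = star (E x);
  ce_idem : forall x, E (E x) = E x;
  ce_mull : forall x y, E (E x ** y) = E (x ** y);
  ce_mulr : forall x y, E (x ** E y) = E (x ** y);
  ce_le : forall x, rnorm (E x) <= rnorm x;
  ce_cstar : forall x, rnorm (E x) ^+ 2 <= rnorm (E (star x ** x))
}.

Record choi_effros (R : realType) (A : cstarAlgType R) (E : A -> A)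
    (EP : choi_effros_projection E) :=
  ChoiEffros { ce_val :> A; ce_valP : E ce_val = ce_val }.

Section choi_effros_algebra.
Variables (R : realType) (A : cstarAlgType R) (E : A -> A).
Variable EP : choi_effros_projection E.
Local Notation C := (choi_effros EP).
Local Notation ChoiEffros := (ChoiEffros EP).

Lemma ceD x y : E (x + y) = E x + E y.
Proof. by have := ce_linear EP 1 x y; rewrite !scale1r. Qed.
Lemma ce0 : E 0 = 0.
Proof. by apply: (addrI (E 0)); rewrite -ceD !addr0. Qed.
Lemma ceZ c x : E (c *: x) = c *: E x.
Proof. by have := ce_linear EP c x 0; rewrite ce0 !addr0. Qed.

Lemma ce_val_inj (u v : C) : u = v :> A -> u = v.
Proof.
case: u v => [x xE] [y yE] /= xy; subst y.
by congr ChoiEffros; exact: Prop_irrelevance.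
Qed.

HB.instance Definition _ := gen_eqMixin C.
HB.instance Definition _ := gen_choiceMixin C.

Let addP (u v : C) : E (ce_val u + ce_val v) = ce_val u + ce_val v.
Proof. by rewrite ceD !ce_valP. Qed.
Let scaleP c (u : C) : E (c *: ce_val u) = c *: ce_val u.
Proof. by rewrite ceZ ce_valP. Qed.
Let starP (u : C) : E (star (ce_val u)) = star (ce_val u).
Proof. by rewrite (ce_star EP) ce_valP. Qed.

Definition ce_zero := ChoiEffros ce0.
Definition ce_add (u v : C) := ChoiEffros (addP u v).
Definition ce_scale c (u : C) := ChoiEffros (scaleP c u).
Definition ce_opp := ce_scale (-1).
Definition ce_mul (u v : C) := ChoiEffros (ce_idem EP (ce_val u ** ce_val v)).
Definition ce_adj (u : C) := ChoiEffros (starP u).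

Fact ce_addA : associative ce_add.
Proof. by move=> ? ? ?; apply: ce_val_inj; rewrite /= addrA. Qed.
Fact ce_addC : commutative ce_add.
Proof. by move=> ? ?; apply: ce_val_inj; rewrite /= addrC. Qed.
Fact ce_add0 : left_id ce_zero ce_add.
Proof. by move=> ?; apply: ce_val_inj; rewrite /= add0r. Qed.
Fact ce_addN : left_inverse ce_zero ce_opp ce_add.
Proof. by move=> ?; apply: ce_val_inj; rewrite /= scaleN1r addNr. Qed.

HB.instance Definition _ :=
  GRing.isZmodule.Build C ce_addA ce_addC ce_add0 ce_addN.

Fact ce_scaleA a b u : ce_scale a (ce_scale b u) = ce_scale (a * b) u.
Proof. by apply: ce_val_inj; rewrite /= scalerA. Qed.
Fact ce_scale1 : left_id 1 ce_scale.
Proof. by move=> ?; apply: ce_val_inj; rewrite /= scale1r. Qed.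
Fact ce_scaleDr : right_distributive ce_scale +%R.
Proof. by move=> ? ? ?; apply: ce_val_inj; rewrite /= scalerDr. Qed.
Fact ce_scaleDl u : {morph ce_scale^~ u : a b / a + b}.
Proof. by move=> ? ?; apply: ce_val_inj; rewrite /= scalerDl. Qed.

HB.instance Definition _ := GRing.Zmodule_isLmodule.Build R[i] C
  ce_scaleA ce_scale1 ce_scaleDr ce_scaleDl.

Definition ce_norm (u : C) : R[i] := `|u : A|.
Fact ce_normD (u v : C) : ce_norm (u + v) <= ce_norm u + ce_norm v.
Proof. exact: ler_normD. Qed.
Fact ce_normZ c (u : C) : ce_norm (c *: u) = `|c| * ce_norm u.
Proof. exact: normrZ. Qed.
Fact ce_norm_eq0 (u : C) : ce_norm u = 0 -> u = 0.
Proof. by move=> u0; apply: ce_val_inj; exact: normr0_eq0. Qed.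

HB.instance Definition _ := Lmodule_isNormed.Build R[i] C
  ce_normD ce_normZ ce_norm_eq0.

Lemma ce_rnormB (u v : C) : rnorm (u - v) = rnorm (ce_val u - ce_val v).
Proof. by rewrite -(scaleN1r (ce_val v)). Qed.

Lemma ce_complete (F : set_system C) : ProperFilter F -> cauchy F -> cvg F.
Proof.
apply: rnorm_complete => {}F FF cF.
have [|l lP] := @rnorm_cvg R A _ F (@ce_val _ _ _ EP) FF.
  move=> d /cF[u Fu]; exists (ce_val u); apply: filterS Fu => v/=.
  by rewrite ce_rnormB.
have lE : E l = l.
  apply: (@rnorm_eq_eps _ _ _ _ 2) => d d0.
  have [u /= lu] := filter_ex (lP _ d0).
  have := rnorm_split (ce_val u) (E l) l.
  have := ce_le EP (l - ce_val u); rewrite ceD -scaleN1r ceZ ce_valP scaleN1r.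
  by have := rnormC (ce_val u) l; move: lu; lra.
exists (ChoiEffros lE) => d /lP; apply: filterS => v/=.
by rewrite ce_rnormB.
Qed.

HB.instance Definition _ := Uniform_isComplete.Build C ce_complete.

Fact ce_mulA : associative ce_mul.
Proof. by move=> ? ? ?; apply: ce_val_inj; rewrite /= (ce_mulr EP) (ce_mull EP) cmulA. Qed.
Fact ce_mulDl : left_distributive ce_mul +%R.
Proof. by move=> ? ? ?; apply: ce_val_inj; rewrite /= cmulDl ceD. Qed.
Fact ce_mulDr : right_distributive ce_mul +%R.
Proof. by move=> ? ? ?; apply: ce_val_inj; rewrite /= cmulDr ceD. Qed.
Fact ce_mulZl c u v : ce_mul (c *: u) v = c *: ce_mul u v.
Proof. by apply: ce_val_inj; rewrite /= cmulZl ceZ. Qed.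
Fact ce_mulZr c u v : ce_mul u (c *: v) = c *: ce_mul u v.
Proof. by apply: ce_val_inj; rewrite /= cmulZr ceZ. Qed.
Fact ce_adjK : involutive ce_adj.
Proof. by move=> ?; apply: ce_val_inj; exact: starK. Qed.
Fact ce_adjD : {morph ce_adj : u v / u + v}.
Proof. by move=> ? ?; apply: ce_val_inj; exact: starD. Qed.
Fact ce_adjZ c u : ce_adj (c *: u) = c^* *: ce_adj u.
Proof. by apply: ce_val_inj; exact: starZ. Qed.
Fact ce_adjM u v : ce_adj (ce_mul u v) = ce_mul (ce_adj v) (ce_adj u).
Proof. by apply: ce_val_inj; rewrite /= -(ce_star EP) starM. Qed.
Fact ce_normM (u v : C) : `|ce_mul u v| <= `|u| * `|v|.
Proof.
rewrite !normr_rnorm -rmorphM lecR; apply: le_trans (ce_le EP _) _.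
exact: (@rnorm_cmul _ A).
Qed.
Fact ce_cstarE (u : C) : `|ce_mul (ce_adj u) u| = `|u| ^+ 2.
Proof.
rewrite !normr_rnorm -rmorphXn; congr (_%:C); apply/eqP; rewrite eq_le.
apply/andP; split.
  by apply: le_trans (ce_le EP _) _; rewrite /= rnorm_cstar.
by have := ce_cstar EP u; rewrite ce_valP.
Qed.

HB.instance Definition _ := isCStar.Build R C ce_mulA ce_mulDl
  ce_mulDr ce_mulZl ce_mulZr ce_adjK ce_adjD ce_adjZ ce_adjM
  ce_normM ce_cstarE.

End choi_effros_algebra.

(** * Semigroups of isometries *)

Section isometry_semigroup.
Variables (R : realType) (M : cstarAlgType R) (e : M).
Hypotheses (e1l : forall x : M, e ** x = x) (e1r : forall x : M, x ** e = x).
Variable W : nat -> M.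
Hypotheses (W0 : W 0 = e) (WD : forall m n, W (m + n)%N = W m ** W n).
Hypothesis (WW : forall n, star (W n) ** W n = e).
Implicit Types (x y z : M).

Definition wcomm z := (forall n, z ** W n = W n ** z) /\
  (forall n, z ** star (W n) = star (W n) ** z).

(** The family [W] extended to negative exponents by adjoints. It becomes multiplicative after the
    limit of compressions, by [to_toeplitz_bishift]. *)
Definition bishift (k : int) : M :=
  match k with Posz m => W m | Negz m => star (W m.+1) end.

Lemma wcomm_mul y z : wcomm y -> wcomm z -> wcomm (y ** z).
Proof.
move=> [y1 y2] [z1 z2]; split=> n.
  by rewrite -cmulA z1 cmulA y1 cmulA.
by rewrite -cmulA z2 cmulA y2 cmulA.
Qed.

Lemma wcomm_star z : wcomm z -> wcomm (star z).
Proof.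
move=> [z1 z2]; split=> n; first by rewrite -[W n]starK -!starM z2.
by rewrite -!starM z1.
Qed.

Lemma wcomm_unit : wcomm e.
Proof. by split=> n; rewrite e1l e1r. Qed.

Lemma bishift_comm z k : wcomm z -> z ** bishift k = bishift k ** z.
Proof. by move=> [z1 z2]; case: k => k; [exact: z1|exact: z2]. Qed.

Lemma bishiftN k : star (bishift k) = bishift (- k).
Proof.
case: k => [[|k]|k]; first by rewrite (_ : - Posz 0 = Posz 0)//= W0 (star_unit e1l).
  by rewrite -NegzE.
by rewrite NegzE opprK /= starK.
Qed.

Lemma starW_W m n : star (W m) ** W n = bishift (n%:Z - m%:Z).
Proof.
have [mn|nm] := leqP m n.
  by rewrite subzn//= -{1}(subnKC mn) WD cmulA WW e1l.
rewrite -opprB subzn ?(ltnW nm)// -bishiftN /=.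
by rewrite -{1}(subnKC (ltnW nm)) WD starM -cmulA WW e1r.
Qed.

Lemma starW_starW m n : star (W (m + n)) = star (W m) ** star (W n).
Proof. by rewrite addnC WD starM. Qed.

Lemma bishift_W k N : (`|k| <= N)%N -> exists2 K, K%:Z = N%:Z + k & bishift k ** W N = W K.
Proof.
case: k => k /= kN; first by exists (k + N)%N; rewrite ?WD// addnC.
exists (N - k.+1)%N; first by rewrite -subzn.
by rewrite starW_W subzn.
Qed.

Lemma rnormW n : rnorm (W n) <= 1.
Proof.
have := rnorm_cstar (W n); rewrite WW => E.
have := rnorm_unit_le1 e1l; rewrite E => n1.
by rewrite -(@ler_pXn2r _ 2) ?nnegrE ?rnorm_ge0// expr1n.
Qed.

Definition compress N x := star (W N) ** x ** W N.

Lemma compress_lin N c x y : compress N (c *: x + y) = c *: compress N x + compress N y.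
Proof. by rewrite /compress cmulDr cmulDl cmulZr cmulZl. Qed.

Lemma compressB N x y : compress N (x - y) = compress N x - compress N y.
Proof. by rewrite /compress cmulBr cmulBl. Qed.

Lemma compress_star N x : compress N (star x) = star (compress N x).
Proof. by rewrite /compress !starM starK cmulA. Qed.

Lemma compress_add N K x : compress (N + K) x = compress N (compress K x).
Proof. by rewrite /compress starW_starW addnC WD !cmulA. Qed.

Lemma rnorm_mulW x n : rnorm (x ** W n) <= rnorm x.
Proof. by rewrite (le_trans (rnorm_cmul _ _))// ler_piMr ?rnorm_ge0 ?rnormW. Qed.

Lemma rnorm_starW_mul x n : rnorm (star (W n) ** x) <= rnorm x.
Proof. by rewrite (le_trans (rnorm_cmul _ _))// ler_piMl ?rnorm_ge0// rnorm_star rnormW. Qed.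

Lemma rnorm_compress N x : rnorm (compress N x) <= rnorm x.
Proof. by rewrite (le_trans (rnorm_mulW _ _))// rnorm_starW_mul. Qed.

(** A relation and not a function, because the limit of the compressions is shown to exist on the
    closed span of [wgens]. The limits are the Toeplitz elements, those fixed by every
    [compress n]. *)
Definition to_toeplitz x y := forall d : R, 0 < d ->
  exists N, forall n, (N <= n)%N -> rnorm (compress n x - y) <= d.

Definition eventually_compress x y := exists N, forall n, (N <= n)%N -> compress n x = y.

Lemma eventually_to_toeplitz x y : eventually_compress x y -> to_toeplitz x y.
Proof.
by move=> [N NP] d d0; exists N => n /NP ->; rewrite subrr rnorm0 ltW.
Qed.

Lemma to_toeplitz_uniq x y z : to_toeplitz x y -> to_toeplitz x z -> y = z.
Proof.
move=> xy xz; apply: (@rnorm_eq_eps _ _ _ _ 2) => d d0.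
have [N NP] := xy d d0; have [K KP] := xz d d0; pose n := maxn N K.
have := NP n (leq_maxl _ _); have := KP n (leq_maxr _ _).
by have := rnorm_split (compress n x) y z; rewrite (rnormC y (compress n x)); lra.
Qed.

Lemma to_toeplitz_lin c x y x' y' : to_toeplitz x y -> to_toeplitz x' y' ->
  to_toeplitz (c *: x + x') (c *: y + y').
Proof.
move=> xy xy' d d0; have c0 : 0 < rnorm c + 1 by rewrite ltr_wpDl ?rnorm_ge0.
have [N NP] := xy _ (divr_gt0 d0 c0).
have [|K KP] := xy' (d / (rnorm c + 1)); first by rewrite divr_gt0.
exists (maxn N K) => n; rewrite geq_max => /andP[Nn Kn].
rewrite compress_lin opprD addrACA -scalerBr (le_trans (rnormD _ _))// rnormZ.
have -> : d = rnorm c * (d / (rnorm c + 1)) + d / (rnorm c + 1).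
  by rewrite -[X in _ + X]mul1r -mulrDl mulrC divfK// gt_eqF.
by rewrite lerD ?KP// ler_wpM2l ?rnorm_ge0// NP.
Qed.

Lemma to_toeplitz_star x y : to_toeplitz x y -> to_toeplitz (star x) (star y).
Proof.
by move=> xy d /xy[N NP]; exists N => n /NP; rewrite compress_star -starB rnorm_star.
Qed.

Lemma to_toeplitz_le x y : to_toeplitz x y -> rnorm y <= rnorm x.
Proof.
move=> xy; apply: le_eps => d /xy[N NP].
have := rnormB_le y (compress N x); have := rnorm_compress N x.
by have := NP N (leqnn _); rewrite rnormC; lra.
Qed.

Lemma to_toeplitz_compress x y n : to_toeplitz x y -> compress n y = y.
Proof.
move=> xy; apply: (@rnorm_eq_eps _ _ _ _ 2) => d d0; have [N NP] := xy d d0.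
have := rnorm_split (compress n (compress N x)) (compress n y) y.
rewrite -compressB -compress_add.
have := NP (n + N)%N (leq_addl _ _); have := NP N (leqnn _).
by have := rnorm_compress n (y - compress N x); rewrite (rnormC y); lra.
Qed.

Lemma to_toeplitz_idem x y : to_toeplitz x y -> to_toeplitz y y.
Proof.
by move=> /to_toeplitz_compress xy; apply: eventually_to_toeplitz; exists 0.
Qed.

(** A Kadison-Schwarz inequality, true for every [compress n] since [compress n x] is a contraction
    times [x W_n]. The accuracy [b] is chosen so that the error [b (2 |y| + 2)] left in the limit is
    at most [d]. *)
Lemma to_toeplitz_cstar x y z : to_toeplitz x y -> to_toeplitz (star x ** x) z ->
  rnorm y ^+ 2 <= rnorm z.
Proof.
move=> xy xz; have y0 := rnorm_ge0 y; apply: le_eps => d d0.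
pose b := Num.min 1 (d / (2 * (rnorm y + 1))).
have D0 : 0 < 2 * (rnorm y + 1) by rewrite mulr_gt0// ltr_wpDl.
have b0 : 0 < b by rewrite lt_min ltr01 divr_gt0.
have bd : b * (2 * (rnorm y + 1)) <= d by rewrite -ler_pdivlMr// ge_min lexx orbT.
have [N NP] := xy _ b0; have [K KP] := xz _ b0; pose n := maxn N K.
have := NP n (leq_maxl _ _); have := KP n (leq_maxr _ _).
have H : rnorm (compress n x) ^+ 2 <= rnorm (compress n (star x ** x)).
  have -> : compress n (star x ** x) = star (x ** W n) ** (x ** W n).
    by rewrite /compress starM !cmulA.
  rewrite rnorm_cstar ler_pXn2r ?nnegrE ?rnorm_ge0//.
  by rewrite /compress -cmulA rnorm_starW_mul.
have := rnormB_le y (compress n x); have := rnormB_le (compress n (star x ** x)) z.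
rewrite (rnormC y); move: H (rnorm_ge0 (compress n x)).
have b1 : b <= 1 by rewrite ge_min lexx.
clear NP KP D0; clearbody b; move: bd b1 b0 y0 (rnorm_ge0 z).
move: (rnorm (compress n x)) (rnorm y) (rnorm (compress n (star x ** x))).
move: (rnorm z) (rnorm _) (rnorm _) => z' p q c s' s bd b1 b0 y0 z0 cs c0 sz yc pb qb.
have [sb|bs] := lerP s' b; first by nra.
have : (s' - b) ^+ 2 <= c ^+ 2 by rewrite ler_pXn2r ?nnegrE//; lra.
by nra.
Qed.

Definition wgen (p : nat * nat * M) := W p.1.1 ** p.2 ** star (W p.1.2).
Definition wgens : set M := [set wgen p | p in [set p | wcomm p.2]].

Lemma wgenM m n z p q y : wcomm z -> wcomm y ->
  wgen (m, n, z) ** wgen (p, q, y) =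
  if (n <= p)%N then wgen (m + (p - n), q, z ** y)%N else wgen (m, q + (n - p), z ** y)%N.
Proof.
move=> zc yc; rewrite /wgen /=.
have -> : W m ** z ** star (W n) ** (W p ** y ** star (W q)) =
    W m ** z ** (star (W n) ** W p) ** y ** star (W q) by rewrite !cmulA.
rewrite starW_W -(cmulA (W m)) (bishift_comm _ zc) cmulA.
case: leqP => np; first by rewrite subzn//= WD !cmulA.
rewrite -opprB subzn ?(ltnW np)// -bishiftN /= addnC starW_starW.
rewrite -(cmulA _ z y) -(cmulA (W m) _ (z ** y)).
by rewrite -(proj2 (wcomm_mul zc yc)) !cmulA.
Qed.

Lemma wgen_star m n z : star (wgen (m, n, z)) = wgen (n, m, star z).
Proof. by rewrite /wgen /= !starM starK cmulA. Qed.

Lemma wgens_star_closed : star_closed (lspan wgens).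
Proof.
split; first exact: lspan_subspace.
  apply: lspan_bilin => [y|x|].
  - by move=> c x x'; rewrite cmulDl cmulZl.
  - by move=> c y y'; rewrite cmulDr cmulZr.
  move=> _ _ [[[m n] z] /= zc <-] [[[p q] y] /= yc <-]; apply: sub_lspan.
  rewrite wgenM//; case: ifP => _; [exists (m + (p - n), q, z ** y)%N|
    exists (m, q + (n - p), z ** y)%N] => //=; exact: wcomm_mul.
apply: (@lspan_map R _ _ (@star _ M) (@Num.conj _)) => [x y|c x|].
- exact: starD.
- exact: starZ.
move=> _ [[[m n] z] /= zc <-]; rewrite wgen_star; apply: sub_lspan.
by exists (n, m, star z) => //=; exact: wcomm_star.
Qed.

Definition toeplitz_gen (p : nat * nat * M) := p.2 ** bishift (p.1.1%:Z - p.1.2%:Z).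

(** Once [n] dominates both exponents, the outer products are shifts, and what remains is [z] times
    the shift by [a - b]; the compressions are constant from there on. *)
Lemma compress_wgen p n : wcomm p.2 -> (maxn p.1.1 p.1.2 <= n)%N ->
  compress n (wgen p) = toeplitz_gen p.
Proof.
case: p => [[a b] z] /= zc; rewrite geq_max => /andP[an bn].
rewrite /compress /wgen /toeplitz_gen /=.
have -> : star (W n) ** (W a ** z ** star (W b)) ** W n =
  (star (W n) ** W a) ** z ** (star (W b) ** W n) by rewrite !cmulA.
rewrite !starW_W -bishift_comm// -cmulA; congr (z ** _).
rewrite -[a%:Z - n%:Z]opprB -bishiftN (subzn an) (subzn bn) /= starW_W.
by congr bishift; rewrite -!subzn//; ring.
Qed.

Lemma toeplitz_gen_in p : wcomm p.2 -> wgens (toeplitz_gen p).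
Proof.
case: p => [[m n] z] /= zc; rewrite /toeplitz_gen /=.
have [nm|mn] := leqP n m.
  exists (m - n, 0, z)%N => //; rewrite /wgen /= subzn//= W0 star_unit// e1r.
  by rewrite (proj1 zc).
exists (0, n - m, z)%N => //; rewrite /wgen /= W0 e1l.
by rewrite -opprB subzn ?(ltnW mn)// -bishiftN.
Qed.

Let G : set (M * M) := lspan [set (wgen p, toeplitz_gen p) | p in [set p | wcomm p.2]].

Let G_eventually p : G p -> eventually_compress p.1 p.2.
Proof.
move: p; apply: lspan_ind.
  split=> [|c x y [N NP] [K KP]].
    by exists 0 => n _; rewrite /compress cmulr0 cmul0r.
  by exists (maxn N K) => n; rewrite geq_max => /andP[nN nK];
    rewrite compress_lin NP// KP.
move=> _ [p pc <-] /=; exists (maxn p.1.1 p.1.2) => n; exact: compress_wgen.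
Qed.

(** On the span of the generators the compressions are eventually constant, and they are uniformly
    contractive, so the limit extends to the closure. *)
Lemma toeplitz_limit_exists x : closure (lspan wgens) x ->
  exists2 y, closure (lspan wgens) y & to_toeplitz x y.
Proof.
have Gs : is_subspace G := lspan_subspace _.
have Gb p : G p -> rnorm p.2 <= 1 * rnorm p.1.
  move=> /G_eventually/eventually_to_toeplitz/to_toeplitz_le.
  by rewrite mul1r.
move=> xA; have [|y xy] := gcl_total Gs ler01 Gb (x := x).
  apply: closureS xA => z zA; apply: lspan_fst; move: z zA.
  apply: lspan_ind => [|_ [p pc <-]]; first exact: lspan_subspace.
  by apply: sub_lspan; exists (wgen p, toeplitz_gen p) => //; exists p.
exists y.
  apply/closure_rnorm => d /xy[p [Gp _ py]]; exists p.2 => //.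
  have [L0 Ll] := lspan_subspace wgens.
  move: p Gp {py}; apply: lspan_ind => [|_ [p pc <-]].
    by split=> // c p q pL qL; exact: Ll.
  by apply: sub_lspan; exact: toeplitz_gen_in.
move=> d d0; have d20 : 0 < d / 2 by rewrite divr_gt0.
have [p [/G_eventually[N NP] px py]] := xy _ d20; exists N => n Nn.
have := rnorm_split p.2 (compress n x) y; rewrite -[in rnorm (_ - p.2)](NP n Nn) -compressB.
by have := rnorm_compress n (x - p.1); rewrite (rnormC p.2); lra.
Qed.

(** Together with adjoints this makes the null space of the limit a two-sided ideal of the closed
    span of [wgens], the source of the Choi-Effros identities. For a generator [z = W_m y W_n^*] the
    compression of [x z] reduces to [W_k^* x W_(m+k-n) y]. *)
Lemma to_toeplitz_mulr0 x z : to_toeplitz x 0 -> closure (lspan wgens) z ->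
  to_toeplitz (x ** z) 0.
Proof.
move=> x0 zA; pose Z := [set z | to_toeplitz (x ** z) 0].
have ZS : lspan wgens `<=` Z.
  apply: lspan_ind.
    split=> [|c u v uZ vZ] /=.
      change (to_toeplitz (x ** 0) 0); rewrite cmulr0.
      by apply: eventually_to_toeplitz; exists 0 => n _; rewrite /compress cmulr0 cmul0r.
    change (to_toeplitz (x ** (c *: u + v)) 0).
    rewrite cmulDr cmulZr; have := to_toeplitz_lin c uZ vZ.
    by rewrite scaler0 addr0.
  move=> _ [[[m n] y] /= yc <-] d d0.
  have y0 : 0 < rnorm y + 1 by rewrite ltr_wpDl ?rnorm_ge0.
  have [N NP] := x0 _ (divr_gt0 d0 y0).
  exists (N + n + m)%N => k Nk; rewrite subr0.
  have E : compress k (x ** wgen (m, n, y)) = star (W k) ** x ** W (m + (k - n))%N ** y.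
    rewrite /compress /wgen /= WD.
    have -> : star (W k) ** (x ** (W m ** y ** star (W n))) ** W k =
      star (W k) ** x ** W m ** y ** (star (W n) ** W k) by rewrite !cmulA.
    rewrite starW_W subzn /=; last by rewrite (leq_trans _ Nk)// addnAC leq_addl.
    by rewrite -cmulA (proj1 yc) !cmulA.
  (* The two exponents differ by a fixed amount. The surplus is peeled off as a contraction on the
     side of the larger one, leaving a compression of [x] at level [k] or [m + k - n], both at least
     [N]. *)
  have H : rnorm (star (W k) ** x ** W (m + (k - n))%N) <= d / (rnorm y + 1).
    have [mn|nm] := leqP n m.
      have -> : (m + (k - n) = k + (m - n))%N.
        by rewrite addnBA ?addnBA// 1?addnC// (leq_trans _ Nk)// addnAC leq_addl.
      rewrite WD cmulA (le_trans (rnorm_mulW _ _))//.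
      by have := NP k; rewrite subr0; apply; rewrite (leq_trans _ Nk)// -addnA leq_addr.
    have nk : (n <= k)%N by rewrite (leq_trans _ Nk)// addnAC leq_addl.
    have kE : (k = (n - m) + (m + (k - n)))%N by rewrite addnA subnK ?(ltnW nm)// subnKC.
    rewrite {1}kE starW_starW -!cmulA (le_trans (rnorm_starW_mul _ _))// cmulA.
    have := NP (m + (k - n))%N; rewrite subr0; apply.
    by rewrite (leq_trans _ (leq_addl _ _))// leq_subRL// (leq_trans _ Nk)// [(n + N)%N]addnC leq_addr.
  rewrite E (le_trans (rnorm_cmul _ _))//.
  apply: (@le_trans _ _ (d / (rnorm y + 1) * rnorm y)); first by rewrite ler_wpM2r ?rnorm_ge0.
  by rewrite mulrAC ler_pdivrMr// ler_wpM2l ?lerDl// ltW.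
move=> d d0; have D0 : 0 < 2 * (rnorm x + 1) by rewrite mulr_gt0// ltr_wpDl ?rnorm_ge0.
move/closure_rnorm: zA => /(_ _ (divr_gt0 d0 D0))[z' /ZS z'Z zz'].
have d20 : 0 < d / 2 by rewrite divr_gt0.
have [N NP] := z'Z _ d20; exists N => n /NP; rewrite !subr0 => H.
have := rnormB_le (compress n (x ** z)) (compress n (x ** z')).
rewrite -compressB -cmulBr.
have := rnorm_compress n (x ** (z - z')); have := rnorm_cmul x (z - z').
rewrite ltr_pdivlMr// in zz'; have := rnorm_ge0 (z - z').
move: zz' H; move: (rnorm _) (rnorm _) (rnorm _) (rnorm _) (rnorm _) (rnorm _) => x1 x2 x3 x4 x5 x6.
by nra.
Qed.

End isometry_semigroup.

(** * Contractivity of the Toeplitz lifting *)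

Section toeplitz_bound.
Variables (R : realType) (M : cstarAlgType R) (e : M).
Hypotheses (e1l : forall x : M, e ** x = x) (e1r : forall x : M, x ** e = x).
Variable W : nat -> M.
Hypotheses (W0 : W 0 = e) (WD : forall m n, W (m + n)%N = W m ** W n).
Hypothesis (WW : forall n, star (W n) ** W n = e).
Variables (A : cstarAlgType R) (alpha : automorphism A).
Variables (B : cstarAlgType R) (jA : A -> B) (jZ : int -> multiplier B).
Hypothesis BP : is_crossed_product alpha jA jZ.
Variables (iota : A -> M) (u : int -> M).
Hypotheses (iotaH : star_hom iota) (u0 : u 0 = e).
Hypotheses (uD : forall m n, u (m + n) = u m ** u n) (uS : forall n, star (u n) = u (- n)).
Hypothesis (cov : forall n a, iota (aut_pow alpha n a) = u n ** iota a ** star (u n)).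
Hypotheses (iota_comm : forall a, wcomm W (iota a)) (u_comm : forall n, wcomm W (u n)).

Local Notation S := (bishift W).
Local Notation cA := (closure_cstar_subalgebra (wgens_star_closed e1l e1r W0 WD WW)).
Local Notation A1 := (subalgebra cA).

(** Applied to [W_N] with [N] large, the shifts [S_m] and [S_n] only move the exponent, so composing
    them adds [m] and [n]. Hence the [S_n] are unitaries for the Choi-Effros product. *)
Lemma to_toeplitz_bishift m n z : wcomm W z ->
  to_toeplitz W (S m ** S n ** z) (S (m + n) ** z).
Proof.
move=> zc; apply: eventually_to_toeplitz; exists (`|m| + `|n|)%N => N mnN.
have [|K KE SK] := @bishift_W _ _ _ e1l e1r _ W0 WD WW n N.
  by rewrite (leq_trans _ mnN)// leq_addl.
have [|L LE SL] := @bishift_W _ _ _ e1l e1r _ W0 WD WW m K.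
  rewrite -lez_nat KE; move: mnN; rewrite -lez_nat PoszD.
  by move: (abszN n) => _; lia.
rewrite /compress -!cmulA (proj1 zc) !cmulA -(cmulA _ (S n)) SK -(cmulA _ (S m)) SL.
rewrite (starW_W e1l e1r W0 WD WW) LE KE; congr (S _ ** z).
by ring.
Qed.

(** In the Choi-Effros algebra of the limit map [E], the elements [S_n u_n] form a unitary
    representation covariant with [iota], so [crossed_product_norm_le] applies there. That algebra
    carries the norm of [M], which returns the estimate to [M]. *)
Lemma toeplitz_norm_le p :
  lspan (range (fun q : int * A => (jZ q.1 (jA q.2), S q.1 ** (u q.1 ** iota q.2)))) p ->
  rnorm p.2 <= rnorm p.1.
Proof.
have /choice[E EP] : forall x : A1, exists y : A1,
    to_toeplitz W (subcstar_val x) (subcstar_val y).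
  move=> x; have [y yA xy] := toeplitz_limit_exists e1l e1r W0 WD WW (subcstarP x).
  by exists (SubCStar _ yA).
have E_uniq (x y : A1) : to_toeplitz W (subcstar_val x) (subcstar_val y) -> E x = y.
  by move=> xy; apply: subcstar_inj; exact: to_toeplitz_uniq (EP x) xy.
have E_lin : linear E.
  by move=> c x y; apply: E_uniq; exact: to_toeplitz_lin.
have E_star x : E (star x) = star (E x).
  by apply: E_uniq; exact: to_toeplitz_star.
have E_idem x : E (E x) = E x.
  by apply: E_uniq; apply: (to_toeplitz_idem e1l WD WW (EP x)).
have ED x y : E (x + y) = E x + E y.
  by have := E_lin 1 x y; rewrite !scale1r.
have EB x y : E (x - y) = E x - E y.
  by rewrite addrC -scaleN1r E_lin scaleN1r addrC.
(* The null space of [E] is a two-sided ideal and contains [E x - x]; this gives the two absorption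
   laws required of a Choi-Effros projection. *)
have E_mulr0 x y : E x = 0 -> E (x ** y) = 0.
  move=> Ex; apply: E_uniq; apply: (to_toeplitz_mulr0 e1l e1r W0 WD WW); last exact: subcstarP.
  by have := EP x; rewrite Ex.
have E_mull0 x y : E y = 0 -> E (x ** y) = 0.
  move=> Ey; rewrite -[x ** y]starK E_star starM E_mulr0 ?star0//.
  by rewrite E_star Ey star0.
have E_mull x y : E (E x ** y) = E (x ** y).
  apply/eqP; rewrite -subr_eq0 -EB -cmulBl; apply/eqP/E_mulr0.
  by rewrite EB E_idem subrr.
have E_mulr x y : E (x ** E y) = E (x ** y).
  apply/eqP; rewrite -subr_eq0 -EB -cmulBr; apply/eqP/E_mull0.
  by rewrite EB E_idem subrr.
have E_le x : rnorm (E x) <= rnorm x by exact: (to_toeplitz_le e1l WW (EP x)).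
have E_cstar x : rnorm (E x) ^+ 2 <= rnorm (E (star x ** x)).
  exact: (to_toeplitz_cstar e1l WW (EP x) (EP (star x ** x))).
have CE : choi_effros_projection E by split.
have genA m n z : wcomm W z -> closure (lspan (wgens W)) (wgen W (m, n, z)).
  by move=> zc; apply: subset_closure; apply: sub_lspan; exists (m, n, z).
have SA n z : wcomm W z -> closure (lspan (wgens W)) (S n ** z).
  move=> zc; case: n => n /=.
    by have := genA n 0 z zc; rewrite /wgen /= W0 (star_unit e1l) e1r.
  by have := genA 0 n.+1 z zc; rewrite /wgen /= W0 e1l (proj2 zc).
have S0 : S 0 = e by rewrite /= W0.
have fixS n z (zc : wcomm W z) : E (SubCStar cA (SA n z zc)) = SubCStar cA (SA n z zc).
  apply: E_uniq => /=; have := to_toeplitz_bishift 0 n zc.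
  by rewrite S0 e1l add0r.
pose el n z (zc : wcomm W z) : choi_effros CE := ChoiEffros CE (fixS n z zc).
have valM (x y : choi_effros CE) m n z w : wcomm W (z ** w) ->
    subcstar_val (ce_val x) = S m ** z -> subcstar_val (ce_val y) = S n ** w ->
    wcomm W z ->
    subcstar_val (ce_val (x ** y)) = S (m + n) ** (z ** w).
  move=> zwc xE yE zc; rewrite /=.
  have -> : E (ce_val x ** ce_val y) = SubCStar cA (SA (m + n) (z ** w) zwc) => //.
  apply: E_uniq => /=; rewrite xE yE.
  have -> : S m ** z ** (S n ** w) = S m ** S n ** (z ** w).
    by rewrite -cmulA (cmulA z) (bishift_comm _ zc) !cmulA.
  exact: to_toeplitz_bishift.
pose one := el 0 e (@wcomm_unit _ _ _ e1l e1r W).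
pose io a := el 0 (iota a) (iota_comm a).
pose v n := el n (u n) (u_comm n).
have o1 x : one ** x = x.
  apply: ce_val_inj; rewrite -[RHS]ce_valP /=; congr E.
  by apply: subcstar_inj; rewrite /= W0 !e1l.
have o2 x : x ** one = x.
  apply: ce_val_inj; rewrite -[RHS]ce_valP /=; congr E.
  by apply: subcstar_inj; rewrite /= W0 e1l e1r.
have val_inj (x y : choi_effros CE) :
    subcstar_val (ce_val x) = subcstar_val (ce_val y) -> x = y.
  by move=> xy; apply: ce_val_inj; exact: subcstar_inj.
have ioE a : subcstar_val (ce_val (io a)) = iota a by rewrite /= W0 e1l.
have ioH : star_hom io.
  split=> [c x y|x y|x]; apply: val_inj.
  - by rewrite [RHS]/= !ioE star_homD// star_homZ// /= W0 !e1l.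
  - rewrite (valM (io x) (io y) 0 0 (iota x) (iota y))//; last 1 first.
      exact: wcomm_mul.
    by rewrite ioE star_homM// S0 e1l.
  - by rewrite [RHS]/= ioE star_homS// W0 e1l.
have v0 : v 0 = one by apply: val_inj; rewrite /= u0.
have vD m n : v (m + n) = v m ** v n.
  by apply: val_inj; rewrite (valM (v m) (v n) m n (u m) (u n)) ?uD// -uD.
have vS n : star (v n) = v (- n).
  apply: val_inj; rewrite /= starM uS (bishiftN e1l W0).
  by rewrite (bishift_comm _ (u_comm _)).
have vio n a : subcstar_val (ce_val (v n ** io a)) = S n ** (u n ** iota a).
  rewrite (valM (v n) (io a) n 0 (u n) (iota a)) ?addr0//; exact: wcomm_mul.
have vcov n a : io (aut_pow alpha n a) = v n ** io a ** star (v n).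
  apply: val_inj; rewrite vS (valM (v n ** io a) (v (- n)) n (- n) (u n ** iota a) (u (- n)))//.
  - by rewrite addrN S0 e1l ioE cov uS.
  - by apply: wcomm_mul => //; exact: wcomm_mul.
  - exact: wcomm_mul.
move=> pS.
suff [c cE cS] : exists2 c : choi_effros CE, subcstar_val (ce_val c) = p.2 &
    lspan (range (fun q : int * A => (jZ q.1 (jA q.2), v q.1 ** io q.2))) (p.1, c).
  have -> : rnorm p.2 = rnorm c by rewrite -cE.
  exact: (crossed_product_norm_le BP o1 o2 ioH v0 vD vS vcov cS).
move: p pS; apply: lspan_ind.
  have [L0 Ll] := lspan_subspace (range (fun q : int * A => (jZ q.1 (jA q.2), v q.1 ** io q.2))).
  split=> [|c x y [a aE aS] [b bE bS]]; first by exists 0.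
  exists (c *: a + b); first by rewrite /= aE bE.
  exact: (Ll c _ _ aS bS).
move=> _ [[n a] _ <-]; exists (v n ** io a); first exact: vio.
by apply: sub_lspan; exists (n, a).
Qed.

End toeplitz_bound.

(** * Uniqueness of the norm on finite matrices *)

(** If [y < x], the powers of [y / x] fall below any positive constant. *)
Lemma pow2_le (R : realType) (x y C : R) : 0 <= x -> 0 <= y -> 0 <= C ->
  (forall k, x ^+ (2 ^ k) <= C * y ^+ (2 ^ k)) -> x <= y.
Proof.
move=> x0 y0 C0 H; rewrite leNgt; apply/negP => yx.
have xp : 0 < x := le_lt_trans y0 yx.
have C1 : 0 < C + 1 by rewrite ltr_wpDl.
have [||N NP] := @expr_lt_eps R (y / x) (C + 1)^-1.
- by rewrite divr_ge0//= ltr_pdivrMr// mul1r.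
- by rewrite invr_gt0.
have /NP : (N <= 2 ^ N)%N by exact: ltnW (ltn_expl _ _).
have := H N; move: (2 ^ N)%N => n.
rewrite expr_div_n; have xn : 0 < x ^+ n by rewrite exprn_gt0.
move=> Hn; rewrite ltr_pdivrMr// [_^-1 * _]mulrC ltr_pdivlMr//; move: Hn.
have : 0 <= y ^+ n by rewrite exprn_ge0.
by move: (x ^+ n) (y ^+ n) => a b; nra.
Qed.

(* The C*-identity gives [|x|^(2^k) = |(x^* x)^(2^(k-1))|], which removes the *)
(* constant [C] as [k] tends to infinity.                                     *)
Lemma equivalent_cstar_norms (R : realType) (V F : cstarAlgType R) (G : set (V * F)) (C : R) :
  (forall p q, G p -> G q -> G (p.1 ** q.1, p.2 ** q.2)) ->
  (forall p, G p -> G (star p.1, star p.2)) ->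
  0 <= C -> (forall p, G p -> rnorm p.2 <= C * rnorm p.1) ->
  forall p, G p -> rnorm p.2 <= rnorm p.1.
Proof.
move=> GM GS C0 GC p Gp.
rewrite -(@ler_pXn2r _ 2) ?nnegrE ?rnorm_ge0//.
apply: (pow2_le (C := C)); rewrite ?exprn_ge0 ?rnorm_ge0// => k.
pose fix h n : V * F := if n is n.+1 then ((h n).1 ** (h n).1, (h n).2 ** (h n).2)
  else (star p.1 ** p.1, star p.2 ** p.2).
have hG n : G (h n).
  elim: n => [|n ih] /=; last exact: GM.
  by apply: (GM (star p.1, star p.2) p) => //; exact: GS.
have h1 n : star (h n).1 = (h n).1 /\ rnorm (h n).1 = (rnorm p.1 ^+ 2) ^+ (2 ^ n).
  elim: n => [|n [ih1 ih2]] /=; first by rewrite starM starK rnorm_cstar expr1.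
  by split; [rewrite starM ih1|rewrite rnorm_sa_sq// ih2 expnSr exprM].
have h2 n : star (h n).2 = (h n).2 /\ rnorm (h n).2 = (rnorm p.2 ^+ 2) ^+ (2 ^ n).
  elim: n => [|n [ih1 ih2]] /=; first by rewrite starM starK rnorm_cstar expr1.
  by split; [rewrite starM ih1|rewrite rnorm_sa_sq// ih2 expnSr exprM].
by have := GC _ (hG k); rewrite (proj2 (h1 k)) (proj2 (h2 k)).
Qed.

(* A copy of the finite matrices over [A], whose [(m, n)] entries are the     *)
(* [Y m n a], together with the diagonal projections [d i].                   *)
Record matrix_system (R : realType) (A M : cstarAlgType R)
    (Y : nat -> nat -> A -> M) (d : nat -> M) : Prop := MatrixSystem {
  msys_linear : forall m n, linear (Y m n);
  msysM : forall m n k l a b, Y m n a ** Y k l b = if n == k then Y m l (a ** b) else 0;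
  msysS : forall m n a, star (Y m n a) = Y n m (star a);
  msys_inj : forall n a, Y n n a = 0 -> a = 0;
  msys_dl : forall i m n a, d i ** Y m n a = if i == m then Y m n a else 0;
  msys_dr : forall i m n a, Y m n a ** d i = if n == i then Y m n a else 0;
  msys_d1 : forall i, rnorm (d i) <= 1
}.

Section matrix_systems.
Variables (R : realType) (A M M' : cstarAlgType R).
Variables (Y : nat -> nat -> A -> M) (d : nat -> M).
Variables (Y' : nat -> nat -> A -> M') (d' : nat -> M').
Hypotheses (YP : matrix_system Y d) (Y'P : matrix_system Y' d').

Let index N : set (nat * nat * A) := [set p | (p.1.1 < N)%N && (p.1.2 < N)%N].
Let pair (p : nat * nat * A) : M * M' := (Y p.1.1 p.1.2 p.2, Y' p.1.1 p.1.2 p.2).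
Let G N : set (M * M') := lspan (pair @` index N).

Let msys0 (M0 : cstarAlgType R) (Z : nat -> nat -> A -> M0) f m n :
  matrix_system Z f -> Z m n 0 = 0.
Proof.
move=> ZP; have := msys_linear ZP m n (-1) 0 0.
by rewrite !scaleN1r oppr0 addr0 addNr.
Qed.

(** A diagonal entry map is an injective star-homomorphism, hence isometric; the C*-identity reduces
    [Z m n a] to the diagonal element [Z n n (a^* a)]. *)
Lemma msys_norm (M0 : cstarAlgType R) (Z : nat -> nat -> A -> M0) f m n a :
  matrix_system Z f -> rnorm (Z m n a) = rnorm a.
Proof.
move=> ZP; have ZH k : star_hom (Z k k).
  split=> [|x y|x]; first exact: (msys_linear ZP).
    by rewrite (msysM ZP) eqxx.
  by rewrite (msysS ZP).
have ZI k : injective (Z k k).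
  move=> x y xy; apply/eqP; rewrite -subr_eq0; apply/eqP/(msys_inj ZP (n := k)).
  by rewrite (star_homB (ZH k)) xy subrr.
apply/eqP; rewrite -(@eqrXn2 _ 2) ?rnorm_ge0//; apply/eqP.
rewrite -rnorm_cstar (msysS ZP) (msysM ZP) eqxx.
by rewrite (star_hom_isometric (ZH n) (ZI n)) rnorm_cstar.
Qed.

Let G_decomp (M0 : cstarAlgType R) (Z : nat -> nat -> A -> M0) f N
    (ZP : matrix_system Z f) (x : M0) :
  lspan ((fun p => Z p.1.1 p.1.2 p.2) @` index N) x ->
  x = \sum_(i < N) \sum_(j < N) f i ** x ** f j.
Proof.
move: x; apply: lspan_ind.
  split=> [|c u v uE vE].
    by rewrite big1// => i _; rewrite big1// => j _; rewrite cmulr0 cmul0r.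
  rewrite {1}uE {1}vE scaler_sumr -big_split; apply: eq_bigr => i _ /=.
  rewrite scaler_sumr -big_split; apply: eq_bigr => j _ /=.
  by rewrite cmulDr cmulDl cmulZr cmulZl.
move=> _ [[[m n] a] /= /andP[mN nN] <-].
rewrite (bigD1 (Ordinal mN))//= [X in _ + X]big1 => [|i im]; last first.
  rewrite big1// => j _; rewrite (msys_dl ZP).
  by rewrite -[m]/(val (Ordinal mN)) val_eqE (negbTE im) cmul0r.
rewrite addr0 (bigD1 (Ordinal nN))//= big1 => [|j jn]; last first.
  rewrite -cmulA (msys_dr ZP) -[n]/(val (Ordinal nN)) val_eqE eq_sym.
  by rewrite (negbTE jn) cmulr0.
by rewrite addr0 (msys_dl ZP) eqxx (msys_dr ZP) eqxx.
Qed.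

Let G_snd N p : G N p -> lspan ((fun p => Y' p.1.1 p.1.2 p.2) @` index N) p.2.
Proof.
have [L0 Ll] := lspan_subspace ((fun p => Y' p.1.1 p.1.2 p.2) @` index N).
move: p; apply: lspan_ind; first by split=> // c x y xL yL; exact: Ll.
by move=> _ [p pN <-]; apply: sub_lspan; exists p.
Qed.

Let G_entry N p i j : G N p ->
  exists a, d i ** p.1 ** d j = Y i j a /\ d' i ** p.2 ** d' j = Y' i j a.
Proof.
move: p; apply: lspan_ind.
  split=> [|c x y [a [a1 a2]] [b [b1 b2]]].
    by exists 0; rewrite !cmulr0 !cmul0r !(msys0 _ _ YP) !(msys0 _ _ Y'P).
  exists (c *: a + b); rewrite (msys_linear YP) (msys_linear Y'P) -a1 -a2 -b1 -b2.
  by rewrite !cmulDr !cmulDl !cmulZr !cmulZl.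
move=> _ [[[m n] a] _ <-] /=; rewrite (msys_dl YP) (msys_dl Y'P).
have [->|im] := eqVneq i m; last first.
  by exists 0; rewrite !cmul0r (msys0 _ _ YP) (msys0 _ _ Y'P).
rewrite (msys_dr YP) (msys_dr Y'P); have [->|jn] := eqVneq n j; first by exists a.
by exists 0; rewrite (msys0 _ _ YP) (msys0 _ _ Y'P).
Qed.

Let GM N p q : G N p -> G N q -> G N (p.1 ** q.1, p.2 ** q.2).
Proof.
have [L0 _] := lspan_subspace (pair @` index N).
apply: (@lspan_bilin R _ _ _ (fun p q : M * M' => (p.1 ** q.1, p.2 ** q.2) : M * M')).
- by move=> q' c x y; rewrite /= !cmulDl !cmulZl.
- by move=> q' c x y; rewrite /= !cmulDr !cmulZr.
move=> _ _ [[[m n] a] /= /andP[mN nN] <-] [[[k l] b] /= /andP[kN lN] <-].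
rewrite /pair /= (msysM YP) (msysM Y'P); case: eqP => _; last exact: L0.
by apply: sub_lspan; exists (m, l, a ** b) => //; exact/andP.
Qed.

Let GS N p : G N p -> G N (star p.1, star p.2).
Proof.
apply: (@lspan_map R _ _ (fun p : M * M' => (star p.1, star p.2) : M * M') (@Num.conj _)).
- by move=> x y; rewrite /= !starD.
- by move=> c x; rewrite /= !starZ.
move=> _ [[[m n] a] /= /andP[mN nN] <-]; rewrite /pair /= (msysS YP) (msysS Y'P).
by apply: sub_lspan; exists (n, m, star a) => //; exact/andP.
Qed.

(** Each of the [N^2] entries of [p.2] has the norm of the same entry of [p.1], which is [p.1] cut
    by two contractions. *)
Let G_bound N p : G N p -> rnorm p.2 <= (N * N)%:R * rnorm p.1.
Proof.
move=> Gp; rewrite {1}(G_decomp Y'P (G_snd Gp)).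
have -> : (N * N)%:R * rnorm p.1 = \sum_(i < N) \sum_(j < N) rnorm p.1.
  rewrite sumr_const card_ord sumr_const card_ord -mulrnA.
  by rewrite mulr_natl.
rewrite (le_trans (rnorm_sum _ _ _))//; apply: ler_sum => i _.
rewrite (le_trans (rnorm_sum _ _ _))//; apply: ler_sum => j _.
have [a [a1 a2]] := G_entry i j Gp.
rewrite a2 (msys_norm _ _ _ Y'P) -(msys_norm i j a YP) -a1.
rewrite (le_trans (rnorm_cmul _ _))// -[leRHS]mulr1 ler_pM ?rnorm_ge0 ?(msys_d1 YP)//.
by rewrite (le_trans (rnorm_cmul _ _))// ler_piMl ?rnorm_ge0 ?(msys_d1 YP).
Qed.

(** An element of the span lives in some [N] by [N] corner, where the norms compare with the
    constant [N^2]. Since both are C*-norms, [equivalent_cstar_norms] improves the constant to [1],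
    so its dependence on [N] is harmless. *)
Lemma matrix_system_norm_le p :
  lspan (range (fun q : nat * nat * A => (Y q.1.1 q.1.2 q.2, Y' q.1.1 q.1.2 q.2))) p ->
  rnorm p.2 <= rnorm p.1.
Proof.
move=> pS; suff [N] : exists N, G N p.
  move=> Gp; apply: (equivalent_cstar_norms (@GM N) (@GS N) _ (@G_bound N) Gp).
  exact: ler0n.
have Gle N K q : (N <= K)%N -> G N q -> G K q.
  move=> NK qG W sW SW; apply: qG => // _ [r /= /andP[r1 r2] <-]; apply: SW.
  by exists r => //; apply/andP; split; [exact: leq_trans r1 NK|exact: leq_trans r2 NK].
move: p pS; apply: lspan_ind.
  split=> [|c x y [N xN] [K yK]].
    by exists 0; have [] := lspan_subspace (pair @` index 0).
  exists (maxn N K); have [_ Gl] := lspan_subspace (pair @` index (maxn N K)).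
  by apply: Gl; [apply: Gle xN; exact: leq_maxl|apply: Gle yK; exact: leq_maxr].
move=> _ [[[m n] a] _ <-]; exists (maxn m n).+1; apply: sub_lspan.
by exists (m, n, a) => //; apply/andP; rewrite /= !ltnS leq_maxl leq_maxr.
Qed.

End matrix_systems.

(** * The extension *)

Section pimsner_voiculescu.
Variables (R : realType) (M : cstarAlgType R) (e : M).
Hypotheses (e1l : forall x : M, e ** x = x) (e1r : forall x : M, x ** e = x).
Variable W : nat -> M.
Hypotheses (W0 : W 0 = e) (WD : forall m n, W (m + n)%N = W m ** W n).
Hypothesis (WW : forall n, star (W n) ** W n = e).
Variables (A : cstarAlgType R) (alpha : automorphism A).
Variables (B : cstarAlgType R) (jA : A -> B) (jZ : int -> multiplier B).
Hypotheses (BP : is_crossed_product alpha jA jZ) (jA_inj : injective jA).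
Variables (beta : B -> M) (U : int -> M).
Hypotheses (betaH : star_hom beta) (U0 : U 0 = e).
Hypotheses (UD : forall m n, U (m + n) = U m ** U n) (US : forall n, star (U n) = U (- n)).
Hypothesis (Ubeta : forall n b, U n ** beta b = beta (jZ n b)).
Hypothesis (cov : forall n a,
  beta (jA (aut_pow alpha n a)) = U n ** beta (jA a) ** star (U n)).
Hypotheses (beta_comm : forall b, wcomm W (beta b)) (U_comm : forall n, wcomm W (U n)).

Let e0 := e - W 1%N ** star (W 1%N).
Hypothesis beta_e0_inj : forall b, beta b ** e0 = 0 -> b = 0.

Let e0S : star e0 = e0.
Proof. by rewrite starB starM starK (star_unit e1l). Qed.

Let e0W n : e0 ** W n.+1 = 0.
Proof. by rewrite -add1n WD cmulA /e0 cmulBl e1l -cmulA WW e1r subrr cmul0r. Qed.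

Let Se0 n : star (W n.+1) ** e0 = 0.
Proof. by rewrite -e0S -starM e0W star0. Qed.

Let e0e0 : e0 ** e0 = e0.
Proof. by rewrite {2}/e0 cmulBr e1r cmulA e0W cmul0r subr0. Qed.

Let e0_comm z : wcomm W z -> z ** e0 = e0 ** z.
Proof.
by move=> [z1 z2]; rewrite /e0 cmulBl cmulBr e1l e1r cmulA z1 -cmulA z2 cmulA.
Qed.

Let e0_norm : rnorm e0 <= 1.
Proof.
have := rnorm_cstar e0; rewrite e0S e0e0 expr2 => E.
have [->|n0] := eqVneq (rnorm e0) 0; first by rewrite ler01.
by rewrite -(mulIf n0 (etrans (esym E) (esym (mul1r _)))).
Qed.

(** The [W_n e0] behave like an orthonormal family with [e0] in place of the scalar [1]. *)
Let e0WWe0 m n : e0 ** star (W m) ** (W n ** e0) = if m == n then e0 else 0.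
Proof.
have -> : e0 ** star (W m) ** (W n ** e0) = e0 ** (star (W m) ** W n) ** e0.
  by rewrite !cmulA.
rewrite (starW_W e1l e1r W0 WD WW); case: (ltngtP m n) => [mn|nm|->].
- rewrite subzn ?(ltnW mn)//=; rewrite -(subnKC mn) -addnBAC//.
  by rewrite subSnn add1n e0W cmul0r.
- rewrite -opprB subzn ?(ltnW nm)// -(bishiftN e1l W0) /=.
  by rewrite -(subnKC nm) -addnBAC// subSnn add1n -cmulA Se0 cmulr0.
- by rewrite subrr /= W0 e1r.
Qed.

Let beta_e0_norm b : rnorm (beta b ** e0) = rnorm b.
Proof.
have fH : star_hom (fun b => beta b ** e0).
  split=> [c x y|x y|x].
  - by rewrite (star_homD betaH) (star_homZ betaH) cmulDl cmulZl.
  - rewrite (star_homM betaH) -[in RHS]cmulA (cmulA e0) -(e0_comm (beta_comm y)).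
    by rewrite -(cmulA _ e0 e0) e0e0 cmulA.
  - by rewrite (star_homS betaH) starM e0S (e0_comm (wcomm_star (beta_comm x))).
apply: (star_hom_isometric fH) => x y xy; apply/eqP; rewrite -subr_eq0; apply/eqP.
by apply: beta_e0_inj; rewrite (star_homB betaH) cmulBl xy subrr.
Qed.

Let beta_inj : injective beta.
Proof.
move=> x y xy; apply/eqP; rewrite -subr_eq0; apply/eqP/beta_e0_inj.
by rewrite (star_homB betaH) xy subrr cmul0r.
Qed.

Let iota a := beta (jA a).
Let iotaH : star_hom iota.
Proof.
have jH := crossed_jA_hom BP.
split=> [c x y|x y|x]; rewrite /iota.
- by rewrite (star_homD jH) (star_homZ jH) star_homD// star_homZ.
- by rewrite (star_homM jH) star_homM.
- by rewrite (star_homS jH) star_homS.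
Qed.

Let C (m n : nat) a := U m%:Z ** iota a ** star (U n%:Z).
(** The element of the crossed product that [beta] maps to [C m n a], with both unitaries gathered
    on the left by covariance. *)
Let c (m n : nat) a : B := jZ (m%:Z - n%:Z) (jA (aut_pow alpha n%:Z a)).

Let beta_c m n a : beta (c m n a) = C m n a.
Proof. by rewrite -Ubeta cov !cmulA -UD subrK. Qed.

Let C_comm m n a : wcomm W (C m n a).
Proof. by rewrite -beta_c. Qed.

Let C_linear m n : linear (C m n).
Proof.
move=> k x y; rewrite /C (star_homD iotaH) (star_homZ iotaH).
by rewrite cmulDr cmulDl cmulZr cmulZl.
Qed.

Let CM m n l a b : C m n a ** C n l b = C m l (a ** b).
Proof.
rewrite /C (star_homM iotaH).
have -> : U m%:Z ** iota a ** star (U n%:Z) ** (U n%:Z ** iota b ** star (U l%:Z)) =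
  U m%:Z ** iota a ** (star (U n%:Z) ** U n%:Z) ** iota b ** star (U l%:Z).
  by rewrite !cmulA.
by rewrite US -UD addNr U0 e1r !cmulA.
Qed.

Let CS m n a : star (C m n a) = C n m (star a).
Proof. by rewrite /C !starM starK (star_homS iotaH) cmulA. Qed.

(** Covariance lets both indices be raised together. This aligns the inner indices of two generators
    before they are multiplied. *)
Let C_shift m n r a : C (m + r) (n + r) (aut_pow alpha (- r%:Z) a) = C m n a.
Proof.
rewrite /C /iota cov !US !PoszD opprK !cmulA -UD addrK.
by rewrite -cmulA -UD opprD addrCA addrN addr0.
Qed.

Let cM m n l a b : c m n a ** c n l b = c m l (a ** b).
Proof. by apply: beta_inj; rewrite star_homM// !beta_c CM. Qed.

Let cS m n a : star (c m n a) = c n m (star a).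
Proof. by apply: beta_inj; rewrite star_homS// !beta_c CS. Qed.

Let c_shift m n r a : c (m + r) (n + r) (aut_pow alpha (- r%:Z) a) = c m n a.
Proof. by apply: beta_inj; rewrite !beta_c C_shift. Qed.

Let gen (q : nat * nat * A) := wgen W (q.1.1, q.1.2, C q.1.1 q.1.2 q.2).
(** The graph of the quotient map on generators. Products of pairs stay in [Q] because the inner
    indices can be aligned by [C_shift] and [c_shift]. *)
Let Q : set (M * B) := lspan (range (fun q => (gen q, c q.1.1 q.1.2 q.2))).

Let QM p q : Q p -> Q q -> Q (p.1 ** q.1, p.2 ** q.2).
Proof.
apply: (@lspan_bilin R _ _ _ (fun p q : M * B => (p.1 ** q.1, p.2 ** q.2) : M * B)).
- by move=> q' k x y; rewrite /= !cmulDl !cmulZl.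
- by move=> q' k x y; rewrite /= !cmulDr !cmulZr.
move=> _ _ [[[m n] a] _ <-] [[[k l] b] _ <-] /=; apply: sub_lspan.
rewrite /gen /= (wgenM e1l e1r W0 WD WW) => [|//|//].
have [nk|kn] := leqP n k.
  exists (m + (k - n), l, aut_pow alpha (- (k - n)%N%:Z) a ** b)%N => //=.
  rewrite -(C_shift m n (k - n) a) -(c_shift m n (k - n) a).
  by rewrite !subnKC// CM cM.
exists (m, l + (n - k), a ** aut_pow alpha (- (n - k)%N%:Z) b)%N => //=.
rewrite -(C_shift k l (n - k) b) -(c_shift k l (n - k) b).
by rewrite !subnKC ?(ltnW kn)// CM cM.
Qed.

Let QS p : Q p -> Q (star p.1, star p.2).
Proof.
apply: (@lspan_map R _ _ (fun p : M * B => (star p.1, star p.2) : M * B) (@Num.conj _)).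
- by move=> x y; rewrite /= !starD.
- by move=> k x; rewrite /= !starZ.
move=> _ [[[m n] a] _ <-] /=; rewrite /gen wgen_star /= CS cS.
by apply: sub_lspan; exists (n, m, star a).
Qed.

Let Q_fst p : Q p -> lspan (range gen) p.1.
Proof.
have [L0 Ll] := lspan_subspace (range gen).
move: p; apply: lspan_ind; first by split=> // k x y xL yL; exact: Ll.
by move=> _ [q _ <-]; apply: sub_lspan; exists q.
Qed.

Let fst_Q x : lspan (range gen) x -> exists y, Q (x, y).
Proof.
move=> xL; apply: lspan_fst; move: x xL.
apply: lspan_ind => [|_ [q _ <-]]; first exact: lspan_subspace.
by apply: sub_lspan; exists (gen q, c q.1.1 q.1.2 q.2) => //; exists q.
Qed.

Lemma pv_star_closed : star_closed (lspan (range gen)).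
Proof.
split=> [|x y /fst_Q[x' xQ] /fst_Q[y' yQ]|x /fst_Q[x' xQ]]; first exact: lspan_subspace.
  exact: Q_fst (QM xQ yQ).
exact: Q_fst (QS xQ).
Qed.

(* The unit vector [(W_K + ... + W_(K + N - 1)) e0 / sqrt N] with             *)
(* [N = (k + 1)^2]: it is moved by at most [2 / sqrt N] by the shift.         *)
Let cst (k : nat) : R[i] := ((k.+1%:R)^-1 : R)%:C.
Let y K k := cst k *: \sum_(i < (k.+1 * k.+1)%N) (W (K + i) ** e0).

Let cst_norm k : rnorm (cst k) = (k.+1%:R)^-1.
Proof. by rewrite /cst rnorm_real ger0_norm// invr_ge0 ler0n. Qed.

Let yy K k : star (y K k) ** y K k = e0.
Proof.
rewrite /y starZ star_sum cmulZl cmulZr scalerA.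
rewrite cmul_suml (eq_bigr (fun=> e0)) => [|i _]; last first.
  rewrite cmul_sumr (bigD1 i)//= starM e0S e0WWe0 eqxx big1 ?addr0// => j ji.
  rewrite e0WWe0 eqn_add2l; case: eqP => // ij.
  by case/eqP: ji; exact/esym/val_inj.
rewrite sumr_const card_ord -scaler_nat scalerA.
rewrite [X in X *: _](_ : _ = 1) ?scale1r//.
have n0 : (k.+1%:R : R) != 0 by rewrite pnatr_eq0.
have -> : (cst k)^* = cst k by apply/eqP; rewrite eq_complex /= oppr0 !eqxx.
rewrite /cst -(rmorph_nat (real_complex R)) -!rmorphM /= natrM.
have -> : (k.+1%:R^-1 / k.+1%:R * (k.+1%:R * k.+1%:R) : R) = 1.
  by rewrite mulrACA mulVf// mulr1.
exact: rmorph1.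
Qed.

Let y_norm K k : rnorm (y K k) <= 1.
Proof.
rewrite -(@ler_pXn2r _ 2) ?nnegrE ?rnorm_ge0// -rnorm_cstar yy expr1n.
exact: e0_norm.
Qed.

Let y_shift1 K k : rnorm (y K.+1 k - y K k) <= 2 / k.+1%:R.
Proof.
have -> : y K.+1 k - y K k = cst k *: (W (K + k.+1 * k.+1)%N ** e0 - W K ** e0).
  rewrite /y -scalerBr; congr (_ *: _); apply/eqP; rewrite subr_eq addrAC eq_sym subr_eq.
  apply/eqP; move: (k.+1 * k.+1)%N => N; pose F i := W (K + i) ** e0.
  have : F N + \sum_(i < N) F i = \sum_(i < N) F i.+1 + F 0%N.
    transitivity (\sum_(i < N.+1) F i); first by rewrite big_ord_recr /= addrC.
    by rewrite big_ord_recl /= addrC.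
  by rewrite /F addn0 => ->; congr (_ + _); apply: eq_bigr => i _; rewrite addnS.
rewrite rnormZ cst_norm mulrC ler_wpM2r ?invr_ge0 ?ler0n//.
have We n : rnorm (W n ** e0) <= 1.
  rewrite (le_trans (rnorm_cmul _ _))//.
  have := rnormW e1l WW n; have := e0_norm.
  by have := rnorm_ge0 (W n); have := rnorm_ge0 e0; nra.
by rewrite (le_trans (rnormD _ _))// rnormN; have := We K; have := We (K + k.+1 * k.+1)%N; lra.
Qed.

Let y_shift K d k : rnorm (y (K + d) k - y K k) <= (2 * d%:R) / k.+1%:R.
Proof.
elim: d => [|d ih]; first by rewrite addn0 subrr rnorm0 mulr0 mul0r.
rewrite (le_trans (rnorm_split (y (K + d) k) _ _))// addnS.
have := y_shift1 (K + d) k.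
have dS : d.+1%:R = d%:R + 1 :> R by rewrite natr1.
rewrite dS mulrDr mulr1 mulrDl; move: ih; move: (2 * d%:R / _) (2 / _) => f g; lra.
Qed.

Let y_comm z K k : wcomm W z -> star (y K k) ** z = z ** star (y K k).
Proof.
move=> zc; rewrite /y starZ cmulZl cmulZr; congr (_ *: _).
rewrite star_sum cmul_suml cmul_sumr; apply: eq_bigr => i _.
rewrite starM e0S -cmulA -(proj2 zc) cmulA -(e0_comm zc).
by rewrite cmulA.
Qed.

Let wgen_y m n z K k : wcomm W z -> (n <= K)%N ->
  wgen W (m, n, z) ** y K k = z ** y (m + (K - n)) k.
Proof.
move=> zc nK; rewrite /y !cmulZr; congr (_ *: _).
rewrite !cmul_sumr; apply: eq_bigr => i _; rewrite /wgen /=.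
have -> : W m ** z ** star (W n) ** (W (K + i) ** e0) =
    W m ** z ** (star (W n) ** W (K + i)) ** e0 by rewrite !cmulA.
have nKi : (n <= K + i)%N by rewrite (leq_trans nK)// leq_addr.
rewrite (starW_W e1l e1r W0 WD WW) subzn//= -(proj1 zc) -(cmulA z) -WD.
by rewrite cmulA; congr (z ** W _ ** e0); lia.
Qed.

(** On a generator, [y] averages out the isometries: [wgen y] is [C] times [y] with its starting
    index moved by [m - n], a change of norm at most [2 (m + n) / (k + 1)]. The compression thus
    tends to [beta(p.2) e0], whose norm is that of [p.2]. *)
Let Q_average p : Q p -> exists (D : R) K0, 0 <= D /\ forall K k, (K0 <= K)%N ->
  rnorm (star (y K k) ** p.1 ** y K k - beta p.2 ** e0) <= D / k.+1%:R.
Proof.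
move: p; apply: lspan_ind.
  split=> [|a u v [D [K0 [D0 DP]]] [D' [K0' [D'0 D'P]]]].
    exists 0, 0%N; split=> // K k _ /=.
    by rewrite cmulr0 (star_hom0 betaH) !cmul0r subrr rnorm0 mul0r.
  exists (rnorm a * D + D'), (maxn K0 K0'); split=> [|K k].
    by rewrite addr_ge0// mulr_ge0 ?rnorm_ge0.
  rewrite geq_max => /andP[/(DP _ k) + /(D'P _ k)] /=.
  move: (star (y K k)) (y K k) => s t H1 H2.
  rewrite (star_homD betaH) (star_homZ betaH) cmulDr !cmulDl cmulZr !cmulZl.
  rewrite opprD addrACA -scalerBr (le_trans (rnormD _ _))// rnormZ mulrDl -mulrA.
  by rewrite lerD// ler_wpM2l ?rnorm_ge0.
move=> _ [[[m n] a] _ <-]; exists (rnorm (C m n a) * (2 * (m + n)%:R)), n.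
split=> [|K k nK /=]; first by rewrite mulr_ge0 ?rnorm_ge0 ?mulr_ge0 ?ler0n.
have Cc := C_comm m n a.
rewrite /gen /= -cmulA wgen_y// cmulA y_comm// -cmulA beta_c -(yy K k) -cmulBr.
rewrite (le_trans (rnorm_cmul _ _))// -mulrA ler_wpM2l ?rnorm_ge0//.
rewrite -cmulBr (le_trans (rnorm_cmul _ _))// rnorm_star.
rewrite (@le_trans _ _ (rnorm (y (m + (K - n)) k - y K k)))//.
  by rewrite ler_piMl ?rnorm_ge0// y_norm.
have mono d : (d <= m + n)%N -> 2 * d%:R / k.+1%:R <= 2 * (m + n)%:R / k.+1%:R :> R.
  by move=> dmn; rewrite ler_wpM2r ?invr_ge0 ?ler0n// ler_pM2l// ler_nat.
have [nm|mn] := leqP n m.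
  have -> : (m + (K - n) = K + (m - n))%N by lia.
  by apply: le_trans (y_shift _ _ _) (mono _ _); lia.
have {2}-> : (K = m + (K - n) + (n - m))%N by lia.
by rewrite rnormC; apply: le_trans (y_shift _ _ _) (mono _ _); lia.
Qed.

Let Q_bound p : Q p -> rnorm p.2 <= 1 * rnorm p.1.
Proof.
move=> /Q_average[D [K [D0 DP]]]; rewrite mul1r -beta_e0_norm.
apply: le_eps => d d0; have [N NP] := @inv_lt_eps R D d d0.
have := DP K N (leqnn _); have := NP N (leqnn _).
have := rnormB_le (beta p.2 ** e0) (star (y K N) ** p.1 ** y K N).
have : rnorm (star (y K N) ** p.1 ** y K N) <= rnorm p.1.
  rewrite (le_trans (rnorm_cmul _ _))// -[leRHS]mulr1 ler_pM ?rnorm_ge0//.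
  by rewrite (le_trans (rnorm_cmul _ _))// ler_piMl ?rnorm_ge0// rnorm_star.
by rewrite rnormC; move: (D / _) => f; lra.
Qed.

(** The graph of a linear lifting of the crossed product. It is not multiplicative, but its closure
    is a right inverse of the quotient map. *)
Let T : set (B * M) :=
  lspan (range (fun q : int * A => (jZ q.1 (jA q.2), bishift W q.1 ** (U q.1 ** iota q.2)))).

Let T_bound p : T p -> rnorm p.2 <= 1 * rnorm p.1.
Proof.
move=> Tp; rewrite mul1r.
exact: (toeplitz_norm_le e1l e1r W0 WD WW BP iotaH U0 UD US cov
  (fun a => beta_comm (jA a)) U_comm Tp).
Qed.

Let T_Q p : T p -> Q (p.2, p.1).
Proof.
apply: (@lspan_map R _ _ (fun p : B * M => (p.2, p.1) : M * B) id) => //.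
move=> _ [[[k|k] a] _ <-] /=; apply: sub_lspan.
  exists (k, 0, a)%N => //=; rewrite /gen /= /c subr0 /=; congr (_, _).
  by rewrite /wgen /= W0 (star_unit e1l) e1r /C US oppr0 U0 e1r.
exists (0, k.+1, aut_pow alpha (- k.+1%:Z) a)%N => //=.
have cE : c 0 k.+1 (aut_pow alpha (- k.+1%:Z) a) = jZ (Negz k) (jA a).
  by rewrite /c -aut_powD addrN sub0r.
rewrite cE /gen /= -beta_c cE -Ubeta /wgen /= W0 e1l; congr (_, _).
exact: (proj2 (wcomm_mul (U_comm _) (beta_comm _))).
Qed.

Let X (m n : nat) a := W m ** (C m n a ** e0) ** star (W n).
Let J : set M := lspan (range (fun q : nat * nat * A => X q.1.1 q.1.2 q.2)).

Let wgenS m n a : wgen W (m.+1, n.+1, C m n a) = wgen W (m, n, C m n a) - X m n a.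
Proof.
rewrite /X /e0 (e0_comm (C_comm m n a)) /e0 /wgen /=.
rewrite -(addn1 m) -(addn1 n) WD (starW_starW WD) [star (W n) ** _](_ : _ =
  star (W 1%N) ** star (W n)); last by rewrite -!(starW_starW WD) addnC.
have [_ C2] := C_comm m n a; have [C1 _] := C_comm m n a.
rewrite cmulBl e1l cmulBr cmulBl opprB addrC subrK; move: (C m n a) C1 C2 => z _ zS.
by rewrite -!cmulA (cmulA z) zS !cmulA.
Qed.

(** Telescoping of [wgenS], with [C_shift] rewriting [C] at each stage. *)
Let J_shift r m n a : J (wgen W (m + r, n + r, C m n a)%N - wgen W (m, n, C m n a)).
Proof.
have [J0 Jl] := lspan_subspace (range (fun q : nat * nat * A => X q.1.1 q.1.2 q.2)).
elim: r => [|r ih]; first by rewrite !addn0 subrr.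
have JX : J (X (m + r) (n + r) (aut_pow alpha (- r%:Z) a)).
  by apply: sub_lspan; exists (m + r, n + r, aut_pow alpha (- r%:Z) a)%N.
have := Jl (-1) _ _ JX ih; rewrite scaleN1r.
have := wgenS (m + r) (n + r) (aut_pow alpha (- r%:Z) a); rewrite C_shift !addnS => ->.
by rewrite addrA [- X _ _ _ + _]addrC.
Qed.

(** Lowering both indices until one of them is [0] changes a generator by an element of [J] and
    turns it into a lifted element. *)
Let Q_T p : Q p -> exists2 x, T (p.2, x) & J (p.1 - x).
Proof.
have [J0 Jl] := lspan_subspace (range (fun q : nat * nat * A => X q.1.1 q.1.2 q.2)).
have [T0 Tl] := lspan_subspace
  (range (fun q : int * A => (jZ q.1 (jA q.2), bishift W q.1 ** (U q.1 ** iota q.2)))).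
move: p; apply: lspan_ind.
  split=> [|k u v [x xT xJ] [y' yT yJ]].
    by exists 0; rewrite ?subrr.
  exists (k *: x + y') => /=; first exact: Tl xT yT.
  by rewrite opprD addrACA -scalerBr; exact: Jl.
move=> _ [[[m n] a] _ <-] /=.
exists (bishift W (m%:Z - n%:Z) ** C m n a).
  apply: sub_lspan; exists (m%:Z - n%:Z, aut_pow alpha n%:Z a) => //=.
  by rewrite -/(c m n a) -beta_c -Ubeta.
rewrite /gen /=; have [nm|mn] := leqP n m.
  have E : C (m - n) 0 (aut_pow alpha n%:Z a) = C m n a.
    have := C_shift (m - n) 0 n (aut_pow alpha n%:Z a).
    by rewrite subnK// add0n -aut_powD addNr.
  have := J_shift n (m - n) 0 (aut_pow alpha n%:Z a); rewrite E subnK// add0n.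
  congr (J (_ - _)).
  by rewrite /wgen /= W0 (star_unit e1l) e1r subzn.
have nm := ltnW mn.
have E : C 0 (n - m) (aut_pow alpha m%:Z a) = C m n a.
  have := C_shift 0 (n - m) m (aut_pow alpha m%:Z a).
  by rewrite subnK// add0n -aut_powD addNr.
have := J_shift m 0 (n - m) (aut_pow alpha m%:Z a); rewrite E subnK// add0n.
congr (J (_ - _)); rewrite /wgen /= W0 e1l -opprB subzn// -(bishiftN e1l W0) /=.
exact: (proj2 (C_comm _ _ _)).
Qed.

(** Each [X] is the difference of two generators with the same image in the crossed product. *)
Let J_gen x : J x -> Q (x, 0).
Proof.
have [Q0 Ql] := lspan_subspace (range (fun q => (gen q, c q.1.1 q.1.2 q.2))).
apply: (@lspan_map R _ _ (fun x : M => (x, 0) : M * B) id).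
- by move=> u v; congr (_, _); rewrite /= addr0.
- by move=> k u; congr (_, _); rewrite /= scaler0.
move=> _ [[[m n] a] _ <-] /=.
have q1 : Q (gen (m, n, a), c m n a) by apply: sub_lspan; exists (m, n, a).
have q2 : Q (wgen W (m.+1, n.+1, C m n a), c m n a).
  apply: sub_lspan; exists (m.+1, n.+1, aut_pow alpha (- 1%:Z) a) => //=.
  by rewrite /gen /= -(addn1 m) -(addn1 n) C_shift c_shift.
have := Ql (-1) _ _ q2 q1; congr (Q (_, _)) => /=; last by rewrite scaleN1r addNr.
by rewrite wgenS scaleN1r opprB subrK.
Qed.

Let X_system : matrix_system X (fun i => W i ** e0 ** star (W i)).
Proof.
have XE m n a : X m n a = W m ** e0 ** C m n a ** star (W n).
  by rewrite /X (e0_comm (C_comm m n a)) cmulA.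
split.
- by move=> m n k x z; rewrite /X (C_linear m n k x z) cmulDl cmulDr cmulDl cmulZl cmulZr cmulZl.
- move=> m n k l a b; rewrite (XE k) /X.
  have -> : W m ** (C m n a ** e0) ** star (W n) ** (W k ** e0 ** C k l b ** star (W l)) =
      W m ** C m n a ** (e0 ** star (W n) ** (W k ** e0)) ** C k l b ** star (W l).
    by rewrite !cmulA.
  rewrite e0WWe0; case: eqP => [->|_]; last by rewrite cmulr0 !cmul0r.
  rewrite -(CM m k l a b); have := C_comm k l b; move: (C m k a) (C k l b) => z w wc.
  by rewrite -(cmulA z w) (e0_comm wc) !cmulA.
- by move=> m n a; rewrite XE /X -CS; move: (C m n a) => z; rewrite !starM starK e0S !cmulA.
- move=> n a Xn; have : star (W n) ** X n n a ** W n = C n n a ** e0.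
    rewrite /X; have -> : star (W n) ** (W n ** (C n n a ** e0) ** star (W n)) ** W n =
      (star (W n) ** W n) ** (C n n a ** e0) ** (star (W n) ** W n) by rewrite !cmulA.
    by rewrite WW e1l e1r.
  rewrite Xn cmulr0 cmul0r /C -cov => /esym/beta_e0_inj an.
  have {}an : aut_pow alpha n%:Z a = 0.
    by apply: jA_inj; rewrite an (star_hom0 (crossed_jA_hom BP)).
  have := congr1 (aut_pow alpha (- n%:Z)) an.
  by rewrite -aut_powD addNr (star_hom0 (aut_pow_star_hom alpha _)).
- move=> i m n a; rewrite XE.
  have -> : W i ** e0 ** star (W i) ** (W m ** e0 ** C m n a ** star (W n)) =
    W i ** (e0 ** star (W i) ** (W m ** e0)) ** C m n a ** star (W n) by rewrite !cmulA.
  by rewrite e0WWe0; case: eqP => [->//|_]; rewrite cmulr0 !cmul0r.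
- move=> i m n a; rewrite /X.
  have -> : W m ** (C m n a ** e0) ** star (W n) ** (W i ** e0 ** star (W i)) =
    W m ** C m n a ** (e0 ** star (W n) ** (W i ** e0)) ** star (W i) by rewrite !cmulA.
  by rewrite e0WWe0; case: eqP => [->|_]; rewrite ?cmulA// cmulr0 cmul0r.
- move=> i; have := rnormW e1l WW i; rewrite -cmulA => Wi.
  rewrite (le_trans (rnorm_cmul _ _))// -[leRHS]mulr1 ler_pM ?rnorm_ge0//.
  rewrite (le_trans (rnorm_cmul _ _))// -[leRHS]mulr1 ler_pM ?rnorm_ge0//.
  by rewrite rnorm_star.
Qed.

Variables (AK : cstarAlgType R) (tK : A -> compacts R -> AK).
Hypothesis AKP : is_tensor_product tK.

Let I : set (AK * M) := lspan (range (fun q : nat * nat * A =>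
  (tK q.2 (munit R q.1.1 q.1.2), X q.1.1 q.1.2 q.2))).

Let tP := is_tensor_product_map AKP.

Let tKM a b m n k l : tK a (munit R m n) ** tK b (munit R k l) =
  if n == k then tK (a ** b) (munit R m l) else 0.
Proof. by rewrite -(tmapM tP) munitM; case: eqP => // _; rewrite (tmap0r tP). Qed.

Let tKS a m n : star (tK a (munit R m n)) = tK (star a) (munit R n m).
Proof. by rewrite -(tmapS tP) munit_star. Qed.

(** The diagonal projections [1 (x) e_ii] need not lie in [AK] when [A] has no unit, so the matrix
    system is placed in the multiplier algebra. *)
Let Y_system : exists d : nat -> multiplier AK,
  matrix_system (fun m n a => left_mul (tK a (munit R m n))) d.
Proof.
have [rho [rhoH rhoP]] := tensor_right_hom tP.
exists (fun i => rho (munit R i i)); split.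
- by move=> m n k x z; rewrite (tmapDl tP) (tmapZl tP) left_mulD left_mulZ.
- move=> m n k l a b; rewrite -left_mulM tKM; case: eqP => // _.
  exact: (star_hom0 (@left_mul_star_hom _ _)).
- by move=> m n a; rewrite -left_mul_star tKS.
- move=> n a /(congr1 (fun L : multiplier AK => rnorm L)).
  rewrite rnorm_left_mul rnorm0 => /rnorm_eq0; apply: tensor_eq0 AKP _.
  exact: munit_neq0.
- move=> i m n a; rewrite mul_left_mul rhoP munitM; case: eqP => [->//|_].
  by rewrite (tmap0r tP) (star_hom0 (@left_mul_star_hom _ _)).
- move=> i m n a; have rS : star (rho (munit R i i)) = rho (munit R i i).
    by rewrite -(star_homS rhoH) munit_star.
  rewrite -[LHS]starK starM rS -left_mul_star tKS mul_left_mul rhoP munitM eq_sym.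
  case: eqP => [->|_]; first by rewrite -left_mul_star tKS starK.
  by rewrite (tmap0r tP) (star_hom0 (@left_mul_star_hom _ _)) star0.
- by move=> i; rewrite (le_trans (star_hom_contractive rhoH _))// rnorm_munit.
Qed.

Let I_le p : I p -> rnorm p.2 <= 1 * rnorm p.1.
Proof.
move=> Ip; have [d dP] := Y_system; rewrite mul1r -(rnorm_left_mul p.1).
apply: (matrix_system_norm_le dP X_system (p := (left_mul p.1, p.2))).
apply: (@lspan_map R _ _ (fun p : AK * M => (left_mul p.1, p.2) : multiplier AK * M) id _ _
  _ _ _ _ Ip) => [u v|k u|].
- by rewrite /= left_mulD.
- by rewrite /= left_mulZ.
by move=> _ [q _ <-]; apply: sub_lspan; exists q.
Qed.

(** The two matrix systems exchange their roles. This inequality makes the inclusion injective and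
    allows it to be inverted on the closure of [J]. *)
Let I_ge p : I (p.2, p.1) -> rnorm p.2 <= 1 * rnorm p.1.
Proof.
move=> Ip; have [d dP] := Y_system; rewrite mul1r -(rnorm_left_mul p.2).
apply: (matrix_system_norm_le X_system dP (p := (p.1, left_mul p.2))).
apply: (@lspan_map R _ _ (fun p : AK * M => (p.2, left_mul p.1) : M * multiplier AK) id _ _
  _ _ _ _ Ip) => [u v|k u|].
- by rewrite /= left_mulD.
- by rewrite /= left_mulZ.
by move=> _ [q _ <-]; apply: sub_lspan; exists q.
Qed.

Let IM p q : I p -> I q -> I (p.1 ** q.1, p.2 ** q.2).
Proof.
have [I0 _] := lspan_subspace (range (fun q : nat * nat * A =>
  (tK q.2 (munit R q.1.1 q.1.2), X q.1.1 q.1.2 q.2))).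
apply: (@lspan_bilin R _ _ _ (fun p q : AK * M => (p.1 ** q.1, p.2 ** q.2) : AK * M)).
- by move=> q' k x z; rewrite /= !cmulDl !cmulZl.
- by move=> q' k x z; rewrite /= !cmulDr !cmulZr.
move=> _ _ [[[m n] a] _ <-] [[[k l] b] _ <-] /=.
rewrite tKM (msysM X_system); case: eqP => _; last exact: I0.
by apply: sub_lspan; exists (m, l, a ** b).
Qed.

Let IS p : I p -> I (star p.1, star p.2).
Proof.
apply: (@lspan_map R _ _ (fun p : AK * M => (star p.1, star p.2) : AK * M) (@Num.conj _)).
- by move=> x z; rewrite /= !starD.
- by move=> k x; rewrite /= !starZ.
move=> _ [[[m n] a] _ <-] /=; rewrite tKS (msysS X_system).
by apply: sub_lspan; exists (n, m, star a).
Qed.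

Let I_J p : I p -> J p.2.
Proof.
have [J0 Jl] := lspan_subspace (range (fun q : nat * nat * A => X q.1.1 q.1.2 q.2)).
move: p; apply: lspan_ind; first by split=> // k x z xJ zJ; exact: Jl.
by move=> _ [q _ <-]; apply: sub_lspan; exists q.
Qed.

Let J_I x : J x -> exists z, I (z, x).
Proof.
have [I0 Il] := lspan_subspace (range (fun q : nat * nat * A =>
  (tK q.2 (munit R q.1.1 q.1.2), X q.1.1 q.1.2 q.2))).
move: x; apply: lspan_ind.
  split=> [|k x z [x' xI] [z' zI]]; first by exists 0.
  by exists (k *: x' + z'); exact: Il xI zI.
move=> _ [q _ <-]; exists (tK q.2 (munit R q.1.1 q.1.2)).
by apply: sub_lspan; exists q.
Qed.

Lemma pv_short_exact (PV : set M) :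
  PV = closure (lspan [set x | exists (m n : nat) (a : A),
    x = W m ** U m%:Z ** beta (jA a) ** star (W n ** U n%:Z)]) ->
  exists (PV_sub : is_cstar_subalgebra PV) (i : AK -> subalgebra PV_sub)
    (q : subalgebra PV_sub -> B), short_exact i q.
Proof.
rewrite (_ : [set x | _] = range gen); last first.
  have genE m n a : gen (m, n, a) = W m ** U m%:Z ** beta (jA a) ** star (W n ** U n%:Z).
    by rewrite /gen /wgen /C /= starM !cmulA.
  apply/seteqP; split=> [_ [m [n [a ->]]]|_ [[[m n] a] _ <-]].
    by exists (m, n, a) => //; rewrite genE.
  by exists m, n, a; rewrite genE.
move=> ->; have PVs := closure_cstar_subalgebra pv_star_closed; exists PVs.
have Qs : is_subspace Q := lspan_subspace _.
have Is : is_subspace I := lspan_subspace _.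
have Ts : is_subspace T := lspan_subspace _.
pose I' : set (M * AK) := [set p | I (p.2, p.1)].
have I's : is_subspace I'.
  by have [I0 Il] := Is; split=> // k u v; exact: Il.
have I'_bound p : I' p -> rnorm p.2 <= 1 * rnorm p.1 := @I_ge p.
have Q_in x b : gcl Q x b -> closure (lspan (range gen)) x.
  move=> xb; apply/closure_rnorm => d /xb[p [/Q_fst pL xp _]].
  by exists p.1.
have /choice[q qP] : forall v : subalgebra PVs, exists b, gcl Q (subcstar_val v) b.
  move=> v; apply: (gcl_total Qs ler01 Q_bound).
  by apply: closureS (subcstarP v) => x /fst_Q.
have q_uniq (v : subalgebra PVs) b : gcl Q (subcstar_val v) b -> q v = b.
  exact: gcl_uniq Qs ler01 Q_bound (qP v).
have I_Q z x : gcl I z x -> gcl Q x 0.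
  move=> zx d d0; have [p [/I_J/J_gen pQ zp xp]] := zx d d0.
  by exists (p.2, 0); rewrite subrr rnorm0.
have /choice[f fP] : forall z : AK, exists x, gcl I z x.
  move=> z; apply: (gcl_total Is ler01 I_le).
  have : closure (lspan (range (fun p : A * (nat * nat) => tK p.1 (munit R p.2.1 p.2.2)))) z.
    by rewrite (tensor_compacts_dense AKP).
  apply: closureS => w wL; apply: lspan_fst; move: w wL.
  apply: lspan_ind => [|_ [[a [m n]] _ <-]]; first exact: lspan_subspace.
  apply: sub_lspan; exists (tK a (munit R m n), X m n a) => //.
  by exists (m, n, a).
pose i z : subalgebra PVs := SubCStar PVs (Q_in _ _ (I_Q _ _ (fP z))).
have i_uniq z (v : subalgebra PVs) : gcl I z (subcstar_val v) -> i z = v.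
  by move=> zv; apply: subcstar_inj; exact: gcl_uniq Is ler01 I_le (fP z) zv.
exists i, q; split.
- split=> [k x z|x z|x]; apply: i_uniq.
  + exact: gcl_lin Is (fP x) (fP z).
  + exact: gclM IM (fP x) (fP z).
  + exact: gcl_star IS (fP x).
- split=> [k x z|x z|x]; apply: q_uniq.
  + exact: gcl_lin Qs (qP x) (qP z).
  + exact: gclM QM (qP x) (qP z).
  + exact: gcl_star QS (qP x).
- move=> x z xz; have := gcl_lin (-1) Is (fP z) (fP x).
  have -> : f z = f x := congr1 (fun v : subalgebra PVs => subcstar_val v) (esym xz).
  rewrite !scaleN1r addNr => /gcl_swap/(gcl_bound ler01 I'_bound).
  rewrite rnorm0 mulr0 => xz0; apply/eqP; rewrite -subr_eq0 addrC; apply/eqP/rnorm_eq0.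
  by apply/eqP; rewrite eq_le xz0 rnorm_ge0.
- apply/seteqP; split=> [_ [z _ <-]|v /= qv].
    by apply: q_uniq; exact: I_Q (fP z).
  (* Take [p] in [Q] near [(v, 0)]. The lift [x] of [p.2] is no larger than [p.2], hence small, so
     [p.1 - x], which lies in [J], is near [v]. *)
  have vJ : closure J (subcstar_val v).
    apply/closure_rnorm => d d0; have d20 : 0 < d / 2 by rewrite divr_gt0.
    have := qP v; rewrite qv => /(_ _ d20)[p [/Q_T[x xT xJ] vp p2]].
    exists (p.1 - x) => //; have := T_bound xT; rewrite mul1r => xp.
    rewrite opprB addrCA addrC; have := rnormD (subcstar_val v - p.1) x.
    by move: p2; rewrite sub0r rnormN; move: xp => /=; lra.
  have [|z vz] := gcl_total I's ler01 I'_bound (x := subcstar_val v).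
    by apply: closureS vJ => w /J_I.
  exists z => //; apply: i_uniq; have := gcl_swap vz.
  by move=> H d /H[[u w] [Iuw ? ?]]; exists (u, w).
- apply/seteqP; split=> // b _.
  (* Surjectivity: the lifting is densely defined and bounded, so its closure assigns to every [b]
     an [x], and inverting the pairs puts [(x, b)] in the closure of [Q]. *)
  have [|x bx] := gcl_total Ts ler01 T_bound (x := b).
    have : closure (lspan [set b | exists n a, b = jZ n (jA a)]) b.
      by rewrite (crossed_dense BP).
    apply: closureS => w wL; apply: lspan_fst; move: w wL.
    apply: lspan_ind => [|_ [n [a ->]]]; first exact: lspan_subspace.
    apply: sub_lspan; exists (jZ n (jA a), bishift W n ** (U n ** iota a)) => //.
    by exists (n, a).
  have xb : gcl Q x b.
    move=> d /bx[p [/T_Q pQ bp xp]]; exists (p.2, p.1); split=> //.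
  by exists (SubCStar PVs (Q_in _ _ xb)) => //; apply: q_uniq.
Qed.

End pimsner_voiculescu.

(** * The isometries of the Toeplitz algebra *)

Section toeplitz_isometries.
Variable R : realType.
Local Notation T := (@toeplitz_isometry R).

Lemma shift_powD m n : shift_pow R (m + n) = shift_pow R m ** shift_pow R n.
Proof.
elim: m => [|m ih]; first by rewrite op_onel.
by rewrite addSn /= ih cmulA.
Qed.

Lemma star_shift_powM n : star (shift_pow R n) ** shift_pow R n = op_one _.
Proof.
elim: n => [|n ih]; first by apply: adjop_eqP => x.
rewrite /= starM -cmulA (cmulA (star (unilateral_shift R))).
have -> : star (unilateral_shift R) ** unilateral_shift R = op_one _.
  by apply: adjop_eqP => x; apply: ell2_eqP.
by rewrite op_onel.
Qed.

Lemma toeplitz_isometry0l x : T 0 ** x = x.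
Proof. by apply: subcstar_inj; exact: op_onel. Qed.

Lemma toeplitz_isometryD m n : T (m + n) = T m ** T n.
Proof. by apply: subcstar_inj; exact: shift_powD. Qed.

Lemma star_toeplitz_isometryM n : star (T n) ** T n = T 0.
Proof. by apply: subcstar_inj; exact: star_shift_powM. Qed.

(** The range of the shift misses [delta 0], so the difference does not vanish there. *)
Lemma toeplitz_isometry_nonunitary : T 0 - T 1 ** star (T 1) <> 0.
Proof.
move=> /eqP; rewrite subr_eq0 => /eqP /(congr1 (fun x => subcstar_val x)).
move=> /(congr1 (fun L : adjop (ell2_ip R) => L (delta R 0%N) 0%N)) /= /eqP.
by rewrite oner_eq0.
Qed.

End toeplitz_isometries.

(** Elementary tensors determine a multiplier, so the choice made by [xget] must agree with any
    exhibited solution. *)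
Lemma tensor_multiplier_eq (R : realType) (B S D : cstarAlgType R) (t : B -> S -> D)
    (m : multiplier B) (s : S) (X : multiplier D) :
  tensor_map t -> (forall b r, X (t b r) = t (m b) (s ** r)) ->
  tensor_multiplier t m s = X.
Proof.
move=> tP XP; apply: (tmap_ext tP) => b r; rewrite XP /tensor_multiplier.
by case: xgetP => [_ -> ->|/(_ X)] //.
Qed.

Section toeplitz_tensor.
Variables (R : realType) (A : cstarAlgType R) (alpha : automorphism A).
Variables (B : cstarAlgType R) (jA : A -> B) (jZ : int -> multiplier B).
Hypothesis BP : is_crossed_product alpha jA jZ.
Variables (D : cstarAlgType R) (t : B -> toeplitz R -> D).
Hypothesis tP : is_tensor_product t.
Local Notation T := (@toeplitz_isometry R).

Let tM := is_tensor_product_map tP.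

Lemma shift_multipliers : exists W : nat -> multiplier D, forall n b r,
  W n (t b r) = t b (T n ** r) /\ star (W n) (t b r) = t b (star (T n) ** r).
Proof.
suff /choice[W WP] : forall n, exists X : multiplier D, forall b r,
    X (t b r) = t b (T n ** r) /\ star X (t b r) = t b (star (T n) ** r) by exists W.
move=> n.
have oo : star (op_one (cstar_ip B)) ** op_one _ = op_one _ by exact: adjop_eqP.
have TT : star (left_mul (T n)) ** left_mul (T n) = op_one _.
  rewrite -left_mul_star -left_mulM star_toeplitz_isometryM.
  by apply: adjop_eqP => x; exact: toeplitz_isometry0l.
have [X [X1 X2 _]] := isometry_tensor tM oo TT.
by exists X => b r; split; [exact: X1|exact: X2].
Qed.

Lemma unitary_multipliers : exists U : int -> multiplier D, forall n b r,
  U n (t b r) = t (jZ n b) r /\ star (U n) (t b r) = t (jZ (- n) b) r.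
Proof.
have [jZ0 jZD jZS] := crossed_jZ_rep BP.
suff /choice[U UP] : forall n, exists X : multiplier D, forall b r,
    X (t b r) = t (jZ n b) r /\ star X (t b r) = t (jZ (- n) b) r by exists U.
move=> n.
have oo : star (op_one (cstar_ip (toeplitz R))) ** op_one _ = op_one _ by exact: adjop_eqP.
have UU : star (jZ n) ** jZ n = op_one _ by rewrite jZS -jZD addNr.
have [X [X1 X2 _]] := isometry_tensor tM UU oo.
by exists X => b r; rewrite -jZS; split; [exact: X1|exact: X2].
Qed.

End toeplitz_tensor.

Theorem corollary5p6 (R : realType) (A : cstarAlgType R)
    (alpha : automorphism A)
    (* A x_alpha Z, with its canonical maps *)
    (AZ : cstarAlgType R) (jA : A -> AZ) (jZ : int -> multiplier AZ)
    (AZ_crossed : is_crossed_product alpha jA jZ)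
    (* (A x_alpha Z) (x) T(Z) *)
    (AZT : cstarAlgType R) (tT : AZ -> toeplitz R -> AZT)
    (AZT_tensor : is_tensor_product tT)
    (* A (x) K(l^2(N)) *)
    (AK : cstarAlgType R) (tK : A -> compacts R -> AK)
    (AK_tensor : is_tensor_product tK) :
  exists (T_PV : is_cstar_subalgebra (pimsner_voiculescu_set jA jZ tT))
         (i : AK -> subalgebra T_PV) (q : subalgebra T_PV -> AZ),
    short_exact i q.
Proof.
have tM := is_tensor_product_map AZT_tensor.
have [W WP] := shift_multipliers AZT_tensor.
have [U UP] := unitary_multipliers AZ_crossed AZT_tensor.
have [jZ0 jZD jZS] := crossed_jZ_rep AZ_crossed.
pose T := @toeplitz_isometry R.
have T0l : left_id (T 0%N) (@cmul R _) := @toeplitz_isometry0l R.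
have T0S : star (T 0%N) = T 0%N by exact: star_unit.
have W1 n b r : W n (tT b r) = tT b (T n ** r) by have [] := WP n b r.
have W2 n b r : star (W n) (tT b r) = tT b (star (T n) ** r) by have [] := WP n b r.
have U1 n b r : U n (tT b r) = tT (jZ n b) r by have [] := UP n b r.
have U2 n b r : star (U n) (tT b r) = tT (jZ (- n) b) r by have [] := UP n b r.
pose beta b : multiplier AZT := left_mul (tT b (T 0%N)).
have b1 b x r : beta b (tT x r) = tT (b ** x) r by rewrite /= -(tmapM tM) T0l.
have opM (X Y : multiplier AZT) x : (X ** Y) x = X (Y x) by [].
have betaH : star_hom beta.
  split=> [k x y|x y|x]; rewrite /beta.
  - by rewrite (tmapDl tM) (tmapZl tM) left_mulD left_mulZ.
  - by rewrite -left_mulM -(tmapM tM) T0l.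
  - by rewrite -left_mul_star -(tmapS tM) T0S.
apply: (@pv_short_exact R _ _ (@op_onel _ _ _ _) (@op_oner _ _ _ _) W _ _ _ A alpha
  AZ jA jZ AZ_crossed (crossed_product_faithful AK_tensor AZ_crossed) beta U betaH
  _ _ _ _ _ _ _ _ AK tK AK_tensor).
- by apply: (tmap_ext tM) => b r; rewrite W1 T0l.
- by move=> m n; apply: (tmap_ext tM) => b r; rewrite opM !W1 cmulA -toeplitz_isometryD.
- move=> n; apply: (tmap_ext tM) => b r.
  by rewrite opM W1 W2 cmulA star_toeplitz_isometryM T0l.
- by apply: (tmap_ext tM) => b r; rewrite U1 jZ0.
- by move=> m n; apply: (tmap_ext tM) => b r; rewrite opM !U1 jZD.
- by move=> n; apply: (tmap_ext tM) => b r; rewrite U1 U2.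
- by move=> n b; rewrite /beta mul_left_mul U1.
- move=> n a; apply: (tmap_ext tM) => b r.
  rewrite !opM U2 !b1 U1; congr (tT _ r).
  have := congr1 (fun X : multiplier AZ => X b) (crossed_covariant AZ_crossed n a).
  by rewrite jZS.
- by move=> b; split=> n; apply: (tmap_ext tM) => x r; rewrite !opM ?W1 ?W2 !b1 ?W1 ?W2.
- by move=> b; split=> n; apply: (tmap_ext tM) => x r; rewrite !opM ?W1 ?W2 !U1 ?W1 ?W2.
- move=> b b0; apply: (tensor_eq0 AZT_tensor (@toeplitz_isometry_nonunitary R)).
  apply: (@left_mul_inj R AZT); rewrite (star_hom0 (@left_mul_star_hom R AZT)) -b0.
  apply: (tmap_ext tM) => x r; rewrite opM.
  have -> : (op_one _ - W 1%N ** star (W 1%N)) (tT x r) =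
      tT x r - tT x (T 1%N ** (star (T 1%N) ** r)).
    by rewrite -W1 -W2 -opM; congr (_ + _); exact: scaleN1r.
  by rewrite -(tmapBr tM) b1 /= -(tmapM tM) cmulBl T0l cmulA.
rewrite /pimsner_voiculescu_set; congr (closure (lspan _)).
have TU n : tensor_multiplier tT (jZ n%:Z) (T n) = W n ** U n%:Z.
  by apply: (tensor_multiplier_eq tM) => b r; rewrite opM U1 W1.
have Tb a : tensor_multiplier tT (left_mul (jA a)) (T 0%N) = beta (jA a).
  by apply: (tensor_multiplier_eq tM) => b r; rewrite b1 T0l.
by apply/seteqP; split=> x [m [n [a ->]]]; exists m, n, a; rewrite !TU Tb.
Qed.
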